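(* Let $u \in \mathscr{S}'(\mathbb{R}^d)$, $m, s \in \mathbb{R}$ and $a \in G^m$. Then $$\mathrm{WF}_{Q^{s-m}}(a^w(x,D)u) \subseteq \mathrm{WF}_{Q^{s}}(u) \quad \text{and} \quad \mathrm{WF}_{Q^{s-m}}(A_a u) \subseteq \mathrm{WF}_{Q^s}(u).$$
   Context: Notation: $\langle z\rangle = \sqrt{1+|z|^2}$; $T^*\mathbb{R}^d$ is identified with $\mathbb{R}^{2d}$, with points $z=(x,\xi)$, and $T^*\mathbb{R}^d\setminus 0 = \mathbb{R}^{2d}\setminus\{0\}$. A set is conic (a cone) if it is invariant under multiplication by positive scalars. $(\cdot,\cdot)$ is the $L^2$ inner product, conjugate linear in the second argument, extended to the pairing of $\mathscr{S}'$ with $\mathscr{S}$. Shubin symbols: for $m \in \mathbb{R}$, $G^m$ is the set of $a \in C^\infty(\mathbb{R}^{2d})$ such that for all $\alpha \in \mathbb{N}^{2d}$ there is $C_\alpha>0$ with $|\partial^\alpha a(z)| \le C_\alpha \langle z\rangle^{m-|\alpha|}$ for all $z \in \mathbb{R}^{2d}$. Weyl quantization: $a^w(x,D)u(x) = (2\pi)^{-d}\int_{\mathbb{R}^{2d}} e^{i(x-y)\cdot\xi}\, a((x+y)/2,\xi)\,u(y)\,dy\,d\xi$ for $u \in \mathscr{S}(\mathbb{R}^d)$ (as an oscillatory integral); for $a \in G^m$ it is continuous on $\mathscr{S}(\mathbb{R}^d)$ and extends by duality to a continuous operator on $\mathscr{S}'(\mathbb{R}^d)$. Short-time Fourier transform: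 for $u \in \mathscr{S}'(\mathbb{R}^d)$ and $\varphi\in\mathscr{S}(\mathbb{R}^d)\setminus\{0\}$, $V_\varphi u(x,\xi) = (u, M_\xi T_x \varphi)$, where $M_\xi T_x\varphi(y) = e^{iy\cdot\xi}\varphi(y-x)$. Localization operator: with $\psi_0(y) = \pi^{-d/4}e^{-|y|^2/2}$, $A_a$ is defined weakly by $(A_a f,g) = (2\pi)^{-d}(a V_{\psi_0}f, V_{\psi_0}g)$ for $g \in \mathscr{S}(\mathbb{R}^d)$; for $a \in G^m$ it acts on $f\in\mathscr{S}'(\mathbb{R}^d)$. Sobolev–Gabor wave front set: fix any $\varphi \in \mathscr{S}(\mathbb{R}^d)\setminus\{0\}$ (the definition does not depend on this choice). For $u\in\mathscr{S}'(\mathbb{R}^d)$ and $s\in\mathbb{R}$, $\mathrm{WF}_{Q^s}(u)\subseteq T^*\mathbb{R}^d\setminus 0$ is defined by: $z_0 \in T^*\mathbb{R}^d\setminus 0$ satisfies $z_0\notin \mathrm{WF}_{Q^s}(u)$ iff there is an open cone $\Gamma \subseteq \mathbb{R}^{2d}\setminus 0$ containing $z_0$ with $\int_\Gamma \langle z\rangle^{2s}|V_\varphi u(z)|^2\,dz<\infty$. *)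

(* Defs.v *)
From HB Require Import structures.
From mathcomp Require Import all_boot all_order all_algebra.
From mathcomp Require Import all_classical all_reals all_analysis.
From mathcomp Require Import complex.
Set Implicit Arguments.
Unset Strict Implicit.
Unset Printing Implicit Defensive.
Import Order.TTheory GRing.Theory Num.Theory.
Import numFieldNormedType.Exports.
Local Open Scope classical_set_scope.
Local Open Scope ring_scope.

(* 'rV[R]_n carries the product sigma-algebra, generated by the coordinates
   (over R it coincides with the Borel one), and Lebesgue measure is the
   iterated product of the one-dimensional one; see row_lebesgue_box. *)
Definition row_display : measure_display.
Proof. exact: default_measure_display. Qed.

Section row_measurable.
Variables (R : realType) (n : nat).

Let coors (i : 'I_n) (x : 'rV[R]_n) : measurableTypeR R := x ord0 i.

Let row_set0 : g_sigma_preimage coors set0.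
Proof. exact: sigma_algebra0. Qed.

Let row_setC A : g_sigma_preimage coors A -> g_sigma_preimage coors (~` A).
Proof. exact: sigma_algebraC. Qed.

Let row_bigcup (F : _^nat) : (forall i, g_sigma_preimage coors (F i)) ->
  g_sigma_preimage coors (\bigcup_i (F i)).
Proof. exact: sigma_algebra_bigcup. Qed.

HB.instance Definition _ := @isMeasurable.Build row_display
  'rV[R]_n (g_sigma_preimage coors) row_set0 row_setC row_bigcup.

Lemma measurable_row_coor (i : 'I_n) : measurable_fun [set: 'rV[R]_n] (coors i).
Proof.
move=> _ Y mY; rewrite setTI; apply: sub_sigma_algebra => /=.
rewrite -bigcup_seq/=; exists i => /=; first by rewrite mem_index_enum.
by exists Y => //; rewrite setTI.
Qed.

Lemma measurable_fun_row d (T : measurableType d) (f : T -> 'rV[R]_n) :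
  (forall i, measurable_fun [set: T] (fun t => coors i (f t))) ->
  measurable_fun [set: T] f.
Proof.
move=> mf; have H : g_sigma_preimage (fun i => coors i \o f) `<=` measurable.
  apply: smallest_sub; first exact: sigma_algebra_measurable.
  rewrite -bigcup_seq/= => A [i _ [B mB <-]]; exact: (mf i).
by move=> _ A mA; apply: H; rewrite g_sigma_preimage_comp; exists A.
Qed.

End row_measurable.

Section row_cons.
Variable R : realType.

Definition row_cons n (p : measurableTypeR R * 'rV[R]_n) : 'rV[R]_n.+1 :=
  row_mx (p.1%:M : 'rV[R]_1) p.2.

Lemma measurable_row_cons n : measurable_fun [set: _] (@row_cons n).
Proof.
apply: measurable_fun_row => i.
pose g (p : measurableTypeR R * 'rV[R]_n) : measurableTypeR R :=
  match fintype.split (i : 'I_(1 + n)) with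
  | inl _ => p.1 | inr j => p.2 ord0 j end.
rewrite [X in measurable_fun _ X](_ : _ = g); last first.
  apply/funext => p; rewrite /g /row_cons mxE.
  by case: splitP => j; rewrite // [j]ord1 mxE eqxx mulr1n.
rewrite /g; case: fintype.split => j; first exact: measurable_fst.
exact: (measurableT_comp (measurable_row_coor j) measurable_snd).
Qed.

Definition row_uncons n (x : 'rV[R]_n.+1) : measurableTypeR R * 'rV[R]_n :=
  (x ord0 ord0, \row_j x ord0 (lift ord0 j)).

Lemma row_consK n : cancel (@row_cons n) (@row_uncons n).
Proof.
move=> [r x]; congr pair => /=.
  rewrite /row_cons mxE; case: splitP => // j _.
  by rewrite [j]ord1 mxE eqxx mulr1n.
apply/rowP => j; rewrite /row_cons !mxE.
case: splitP => k /= jk; first by have := ltn_ord k; rewrite -jk.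
by congr (x _ _); apply/val_inj; move: jk => [].
Qed.

Lemma row_unconsK n : cancel (@row_uncons n) (@row_cons n).
Proof.
move=> x; apply/rowP => i; rewrite /row_cons mxE.
case: splitP => j ij.
  rewrite [j]ord1 mxE eqxx mulr1n; congr (x _ _); apply/val_inj.
  by rewrite /= ij [j]ord1.
by rewrite mxE; congr (x _ _); apply/val_inj; rewrite /= ij.
Qed.

Lemma measurable_row_uncons n : measurable_fun [set: _] (@row_uncons n).
Proof.
apply: measurable_fun_pair; first exact: measurable_row_coor.
apply: measurable_fun_row => j.
under eq_fun do rewrite mxE.
exact: measurable_row_coor.
Qed.

End row_cons.

Section row_lebesgue_step.
Variables (R : realType) (n : nat).
Variable mu : {sigma_finite_measure set 'rV[R]_n -> \bar R}.

Definition cons_lebesgue : set 'rV[R]_n.+1 -> \bar R :=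
  pushforward (lebesgue_measure \x mu)%E (@row_cons R n).

Let cons_lebesgue0 : cons_lebesgue set0 = 0%E.
Proof. by rewrite /cons_lebesgue /pushforward preimage_set0 measure0. Qed.

Let cons_lebesgue_ge0 A : (0 <= cons_lebesgue A)%E.
Proof. by rewrite /cons_lebesgue /pushforward; exact: measure_ge0. Qed.

Let cons_lebesgue_additive : semi_sigma_additive cons_lebesgue.
Proof.
have mc := @measurable_row_cons R n.
move=> F mF tF mUF; rewrite /cons_lebesgue /pushforward preimage_bigcup.
apply: measure_semi_sigma_additive.
- by move=> k; rewrite -[X in measurable X]setTI; exact: mc.
- apply/trivIsetP => /= i j _ _ ij; rewrite -preimage_setI.
  by move/trivIsetP : tF => /(_ _ _ _ _ ij) ->//; rewrite preimage_set0.
- by rewrite -preimage_bigcup -[X in measurable X]setTI; exact: mc.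
Qed.

HB.instance Definition _ := isMeasure.Build _ _ _ cons_lebesgue
  cons_lebesgue0 cons_lebesgue_ge0 cons_lebesgue_additive.

Let cons_lebesgue_sigma_finite : sigma_finite setT cons_lebesgue.
Proof.
have /sigma_finiteP[F [TF ndF Foo]] := sigma_finiteT (@lebesgue_measure R).
have /sigma_finiteP[G [TG ndG Goo]] := sigma_finiteT mu.
exists (fun k => @row_uncons R n @^-1` (F k `*` G k)).
  rewrite -preimage_bigcup -[LHS](preimage_setT (@row_uncons R n)); congr (_ @^-1` _).
  rewrite -setXTT TF TG predeqE => -[x y]; split.
    move=> [/= [i _ Fx] [k _ Gy]]; exists (maxn i k) => //; split.
    - by move: x Fx; exact/subsetPset/ndF/leq_maxl.
    - by move: y Gy; exact/subsetPset/ndG/leq_maxr.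
  by move=> [k _ []/= ? ?]; split; exists k.
move=> k; have [mF ?] := Foo k; have [mG ?] := Goo k; split.
  rewrite -[X in measurable X]setTI; apply: measurable_row_uncons => //.
  exact: measurableX.
rewrite /cons_lebesgue /pushforward -comp_preimage.
rewrite (_ : @row_uncons R n \o _ = id) ?preimage_id.
  by rewrite product_measure1E// lte_mul_pinfty// ge0_fin_numE.
by apply/funext => p /=; exact: row_consK.
Qed.

HB.instance Definition _ := Measure_isSigmaFinite.Build _ _ _ cons_lebesgue
  cons_lebesgue_sigma_finite.

End row_lebesgue_step.

Fixpoint row_lebesgue (R : realType) (n : nat) :
    {sigma_finite_measure set 'rV[R]_n -> \bar R} :=
  match n with
  | 0 => dirac (0 : 'rV[R]_0)
  | k.+1 => cons_lebesgue (row_lebesgue R k)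
  end.

Lemma row_lebesgue_box (R : realType) (n : nat) (A : 'I_n -> set R) :
  (forall i, measurable (A i : set (measurableTypeR R))) ->
  row_lebesgue R n [set x | forall i, A i (x ord0 i)] =
  (\prod_(i < n) lebesgue_measure (A i))%E.
Proof.
elim: n A => [|n IH] A mA.
  rewrite big_ord0 /= /dirac indicE mem_set//=; by case.
pose B : set 'rV[R]_n := [set x | forall i : 'I_n, A (lift ord0 i) (x ord0 i)].
have consE (r : measurableTypeR R) (x : 'rV[R]_n) (i : 'I_n) :
    row_cons (r, x) ord0 (lift ord0 i) = x ord0 i.
  by have := congr1 (fun p : measurableTypeR R * 'rV[R]_n => p.2 ord0 i)
    (row_consK (r, x)); rewrite /= mxE.
have cons0E (r : measurableTypeR R) (x : 'rV[R]_n) :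
    row_cons (r, x) ord0 ord0 = r.
  exact: (congr1 (fun p : measurableTypeR R * 'rV[R]_n => p.1)
    (row_consK (r, x))).
have -> : row_lebesgue R n.+1 [set x | forall i, A i (x ord0 i)] =
    (lebesgue_measure \x row_lebesgue R n)%E
      ((A ord0 : set (measurableTypeR R)) `*` B).
  congr (product_measure1 _ _ _); apply/seteqP; split=> -[r x] /= h.
    by split=> [|i]; [have := h ord0; rewrite cons0E
                     |have := h (lift ord0 i); rewrite consE].
  case: h => h0 h1 i.
  by case: (unliftP ord0 i) => [j ->|->]; rewrite ?consE ?cons0E//; exact: h1.
rewrite product_measure1E//; first by rewrite big_ord_recl -IH.
rewrite (_ : B = \bigcap_(i in [set: 'I_n])
  ((fun x : 'rV[R]_n => x ord0 i : measurableTypeR R) @^-1` A (lift ord0 i))).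
  apply: fin_bigcap_measurable => // i _.
  by rewrite -[X in measurable X]setTI; exact: measurable_row_coor.
by apply/seteqP; split=> x /= h i; [move=> _|]; exact: h.
Qed.

Notation cabs := ComplexField.Normc.normc.

Section phase_space.
Variable R : realType.
Local Open Scope complex_scope.
Local Notation C := R[i].

Definition cis (t : R) : C := cos t +i* sin t.

(* The norm of 'rV[R]_n in the library is the sup norm. *)
Definition dot n (x y : 'rV[R]_n) : R := \sum_(i < n) x ord0 i * y ord0 i.
Definition euclid n (x : 'rV[R]_n) : R := Num.sqrt (dot x x).
Definition japanese n (x : 'rV[R]_n) : R := Num.sqrt (1 + euclid x ^+ 2).

Definition cintegral n (f : 'rV[R]_n -> C) : C :=
  (\int[row_lebesgue R n]_x complex.Re (f x)) +i* (\int[row_lebesgue R n]_x complex.Im (f x)).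

Definition pderiv n (i : 'I_n) (f : 'rV[R]_n -> C) : 'rV[R]_n -> C :=
  fun x => ('D_(delta_mx ord0 i) (fun y => complex.Re (f y) : R^o) x)
           +i* ('D_(delta_mx ord0 i) (fun y => complex.Im (f y) : R^o) x).

Definition smooth n (f : 'rV[R]_n -> C) : Prop :=
  forall s : seq 'I_n, let g := foldr (@pderiv n) f s in
  [/\ continuous (fun x => complex.Re (g x) : R^o),
      continuous (fun x => complex.Im (g x) : R^o) &
      forall (i : 'I_n) x,
        derivable (fun y => complex.Re (g y) : R^o) x (delta_mx ord0 i) /\
        derivable (fun y => complex.Im (g y) : R^o) x (delta_mx ord0 i)].

Definition mderiv n (alpha : {ffun 'I_n -> nat}) (f : 'rV[R]_n -> C) :
    'rV[R]_n -> C :=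
  foldr (fun i => iter (alpha i) (pderiv i)) f (enum 'I_n).

Definition mlength n (alpha : {ffun 'I_n -> nat}) : nat := \sum_(i < n) alpha i.

Definition shubin n (m : R) (a : 'rV[R]_n -> C) : Prop :=
  smooth a /\
  forall alpha : {ffun 'I_n -> nat}, exists2 K : R, 0 < K & forall z,
    cabs (mderiv alpha a z) <= K * japanese z `^ (m - (mlength alpha)%:R).

Definition schwartz n (f : 'rV[R]_n -> C) : Prop :=
  smooth f /\
  forall (k : nat) (alpha : {ffun 'I_n -> nat}), exists K : R, forall x,
    japanese x ^+ k * cabs (mderiv alpha f x) <= K.

Definition schwartz_norm n (k : nat) (f : 'rV[R]_n -> C) : R :=
  sup [set r | exists (alpha : {ffun 'I_n -> nat}) (x : 'rV[R]_n),
         (mlength alpha <= k)%N /\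
         r = japanese x ^+ k * cabs (mderiv alpha f x)].

(* A distribution is represented by a functional on all functions; only its
   values on Schwartz functions are constrained or used. *)
Definition functional n := ('rV[R]_n -> C) -> C.

Definition tempered n (u : functional n) : Prop :=
  (forall (c : C) (f g : 'rV[R]_n -> C), schwartz f -> schwartz g ->
     u (fun x => c * f x + g x) = c * u f + u g) /\
  exists (k : nat) (K : R), forall f, schwartz f ->
    cabs (u f) <= K * schwartz_norm k f.

(* The sesquilinear pairing (u, f), and the functional u with given (u, .). *)
Definition pairing n (u : functional n) (f : 'rV[R]_n -> C) : C :=
  u (fun x => conjc (f x)).
Definition of_pairing n (B : ('rV[R]_n -> C) -> C) : functional n :=
  fun f => B (fun x => conjc (f x)).

Definition distribution_of n (f : 'rV[R]_n -> C) : functional n :=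
  fun g => cintegral (fun x => f x * g x).

(* Points z = (x, xi) of phase space are block rows row_mx x xi. *)
Definition time_freq d (phi : 'rV[R]_d -> C) (z : 'rV[R]_(d + d)) :
    'rV[R]_d -> C :=
  fun y => cis (dot y (rsubmx z)) * phi (y - lsubmx z).

Definition stft d (phi : 'rV[R]_d -> C) (u : functional d)
    (z : 'rV[R]_(d + d)) : C :=
  pairing u (time_freq phi z).

(* The oscillatory integral of F y xi dy dxi: the common limit, for all Schwartz
   cutoffs chi with chi 0 = 1, of the integrals of chi (eps xi) F y xi. The
   cutoff is in xi only: in weyl, F y xi is rapidly decreasing in y. *)
Definition osc_integral d (F : 'rV[R]_d -> 'rV[R]_d -> C) : C :=
  xget 0 [set v : C | forall chi : 'rV[R]_d -> C, schwartz chi -> chi 0 = 1 ->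
    cabs (cintegral (fun w : 'rV[R]_(d + d) =>
            chi (eps *: rsubmx w) * F (lsubmx w) (rsubmx w)) - v)
    @[eps --> (0 : R)^'+] --> (0 : R)].

Definition weyl d (a : 'rV[R]_(d + d) -> C) (f : 'rV[R]_d -> C) :
    'rV[R]_d -> C :=
  fun x => ((2 * pi) ^- d)%:C *
    osc_integral (fun y xi =>
      cis (dot (x - y) xi) * a (row_mx (2^-1 *: (x + y)) xi) * f y).

(* Extension by duality: the formal adjoint of a^w is the Weyl quantization of
   the complex conjugate of a. *)
Definition weyl_op d (a : 'rV[R]_(d + d) -> C) (u : functional d) :
    functional d :=
  of_pairing (fun g => pairing u (weyl (fun z => conjc (a z)) g)).

Definition gaussian d : 'rV[R]_d -> C :=
  fun y => (pi `^ (- (d%:R / 4)) * expR (- (euclid y ^+ 2 / 2)))%:C.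

Definition localization d (a : 'rV[R]_(d + d) -> C) (u : functional d) :
    functional d :=
  of_pairing (fun g => ((2 * pi) ^- d)%:C *
    cintegral (fun z => a z * stft (@gaussian d) u z *
                        conjc (stft (@gaussian d) (distribution_of g) z))).

Definition conic n (G : set 'rV[R]_n) : Prop :=
  forall (t : R) (z : 'rV[R]_n), 0 < t -> G z -> G (t *: z).

Definition WF d (phi : 'rV[R]_d -> C) (s : R) (u : functional d) :
    set 'rV[R]_(d + d) :=
  [set z0 | z0 != 0 /\
    ~ exists G : set 'rV[R]_(d + d),
      [/\ open G, conic G, ~ G 0, G z0 &
       (\int[row_lebesgue R (d + d)]_(z in G)
          (japanese z `^ (2 * s) * cabs (stft phi u z) ^+ 2)%:E < +oo)%E]].

End phase_space.

(* Main.v *)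
(* For a fixed window phi, the matrix coefficients of a^w in the coherent states pi(z) phi decay
   rapidly off the diagonal: |(a^w pi(z) phi, pi(w) phi)| <= C_N <z>^m <z - w>^-N. Indeed this
   coefficient is, up to a phase, the Fourier transform at (z - w), rotated by the symplectic
   matrix, of a rapidly decreasing function of phase space whose derivatives are O(<z>^m <z - w>^|m|).
   The inversion formula f = c * int V_phi f(w) pi(w) phi dw, through which a tempered distribution
   can be applied, then gives
     |V_phi (a^w u)(z)| <= C_N <z>^m * int <z - w>^-N |V_phi u(w)| dw.
   For A_a the same bound with the Gaussian window on the right is immediate from the definition,
   and changing the window from phi to the Gaussian costs the same bound with m = 0.
   Such a bound propagates integrability of <z>^(2s) |V_phi u|^2 from a cone to smaller cones:
   for w in the cone use Cauchy-Schwarz and Peetre's inequality, and for w outside of it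
   <z - w> dominates both <z> and <w>^(1/2), while V_phi u grows polynomially. *)

Require Import Defs.
From mathcomp Require Import all_boot all_order all_algebra.
From mathcomp Require Import all_classical all_reals all_analysis.
From mathcomp Require Import complex.
From mathcomp Require Import measurable_realfun zify ring lra.
Import Order.TTheory GRing.Theory Num.Theory.
Import numFieldNormedType.Exports.
Local Open Scope classical_set_scope.
Local Open Scope ring_scope.
Set Implicit Arguments.
Unset Strict Implicit.
Unset Printing Implicit Defensive.

(** The operator acts on u by duality: V_phi (a^w u)(z) is u applied to the conjugate of the
    function obtained from pi(z) phi by the Weyl operator of the conjugate symbol. To evaluate u,
    this function must be known to be Schwartz, which its oscillatory integral does not show
    directly. It is shown to be continuous, of polynomial growth and with rapidly decreasing STFT;
    the inversion formula then writes it as a superposition of the pi(w) phi with rapidly decreasing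
    coefficients, hence as a Schwartz function. Passing u through the superposition uses only a
    bound by one Schwartz seminorm: the integral is replaced by finite sums over a grid, with error
    O(1/N) in that seminorm. In the matrix coefficient the symbol grows in xi, and decay in xi
    appears only after the y-integration. The growth rate in xi must be the same for derivatives of
    every order, so that enough integrations by parts in y outweigh it. Derivatives of the resulting
    partial Fourier transform are again transforms of amplitudes of the same kind, so all of them
    decay. *)

Local Notation RL R n := (row_lebesgue R n).

(** * Lebesgue measure on rows *)

Section row_measure.
Variable R : realType.

Definition box n (A : 'I_n -> set R) : set 'rV[R]_n :=
  [set x | forall i, A i (x ord0 i)].

Lemma measurable_box n (A : 'I_n -> set (measurableTypeR R)) :
  (forall i, measurable (A i)) -> measurable (box A).
Proof.
move=> mA; rewrite (_ : box A = \bigcap_(i in [set: 'I_n])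
  ((fun x : 'rV[R]_n => x ord0 i : measurableTypeR R) @^-1` A i)).
  apply: fin_bigcap_measurable => // i _.
  by rewrite -[X in measurable X]setTI; exact: measurable_row_coor.
by apply/seteqP; split=> x /= h i; [move=> _|]; exact: h.
Qed.

(** Boxes are stable under intersection and generate the sigma-algebra, and the cubes [-k, k]^n
    exhaust the space with finite measure. The scaling and block formulas below are reduced to boxes
    through this. *)
Lemma row_lebesgue_unique n (m' : {measure set 'rV[R]_n -> \bar R}) :
  (forall A : 'I_n -> set (measurableTypeR R), (forall i, measurable (A i)) ->
     m' (box A) = (\prod_(i < n) lebesgue_measure (A i))%E) ->
  forall X, measurable X -> m' X = row_lebesgue R n X.
Proof.
move=> m'E X mX; apply/esym.
pose G := [set B : set 'rV[R]_n | exists2 A : 'I_n -> set (measurableTypeR R),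
  (forall i, measurable (A i)) & B = box A].
have bE (A : 'I_n -> set (measurableTypeR R)) : (forall i, measurable (A i)) ->
  row_lebesgue R n (box A) = (\prod_(i < n) lebesgue_measure (A i))%E.
  exact: row_lebesgue_box.
apply: (measure_unique G (fun k => box (fun=> `[- (k%:R : R), k%:R]%classic))) => //.
- apply/seteqP; split=> A.
    apply: smallest_sub; first exact: smallest_sigma_algebra.
    rewrite -bigcup_seq/= => B [i _ [C mC <-]].
    apply: sub_sigma_algebra; exists (fun j => if j == i then C else setT).
      by move=> j; case: ifPn.
    apply/seteqP; split=> x /=.
      by move=> [_ Cx] j; case: ifPn => // /eqP ->.
    by move=> /(_ i); rewrite eqxx; split.
  apply: smallest_sub; first exact: sigma_algebra_measurable.
  by move=> B [C mC ->]; exact: measurable_box.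
- move=> _ _ [A mA ->] [B mB ->]; exists (fun i => A i `&` B i).
    by move=> i; exact: measurableI.
  apply/seteqP; split=> x /=; first by move=> [hA hB] i; split.
  by move=> h; split=> i; case: (h i).
- by move=> k; exists (fun=> `[- (k%:R : R), k%:R]%classic).
- apply/seteqP; split=> // x _.
  exists (Num.bound (\sum_(i < n) `|x ord0 i|)) => // i /=.
  rewrite in_itv/= -ler_norml; apply/ltW.
  apply: le_lt_trans (archi_boundP _); last exact: sumr_ge0.
  by rewrite (bigD1 i)//= lerDl sumr_ge0.
- by move=> A [B mB ->]; rewrite [RHS]m'E; first exact: bE.
- move=> k.
  rewrite [X in (X < _)%E](_ : _ = (\prod_(i < n)
      lebesgue_measure (`[- k%:R, k%:R]%classic : set R)%R)%E); last first.
    by apply: bE => i; exact: measurable_itv.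
  apply: le_lt_trans (ltry (fine _)); rewrite fineK//.
  elim/big_ind : _ => // [a b|i _]; first exact: fin_numM.
  by rewrite lebesgue_measure_itv/=; case: ifP.
Qed.

Lemma lebesgue_measure_affine (e c : R) (A : set (measurableTypeR R)) : 0 < e ->
  measurable A ->
  lebesgue_measure [set t : R | A (e * t + c)] = (e^-1%:E * lebesgue_measure A)%E.
Proof.
move=> e0 mA.
pose f (t : measurableTypeR R) : measurableTypeR R := e * t + c.
have mf : measurable_fun setT f.
  by apply: measurable_funD => //; exact: measurable_funM.
pose fe := [the {nonneg R} of NngNum (ltW e0)].
have /= := @lebesgue_measure_unique R (mscale fe (pushforward lebesgue_measure f)).
move=> /(_ mf)/(_ _ A mA) H.
rewrite [in RHS]H; last first.
  move=> _ [[a b] _ <-] /=; rewrite /mscale/= /pushforward.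
  rewrite (_ : f @^-1` _ = `](a - c) / e, (b - c) / e]%classic); last first.
    apply/seteqP; split=> t /=; rewrite !in_itv/= /f ltr_pdivrMr// ler_pdivlMr//;
      by rewrite ltrBlDr lerBrDr mulrC.
  rewrite !lebesgue_measure_itv/= !lte_fin.
  rewrite ltr_pM2r ?invr_gt0// ltrD2r; case: ifP => _; last by rewrite mule0.
  by rewrite -!EFinD -EFinM; congr EFin; field; rewrite gt_eqF.
by rewrite /mscale/= muleA -EFinM mulVf ?gt_eqF// mul1e.
Qed.

Lemma measurable_row_affine n (e : R) (c : 'rV[R]_n) :
  measurable_fun [set: 'rV[R]_n] (fun x => e *: x + c).
Proof.
apply: measurable_fun_row => i; under eq_fun do rewrite !mxE.
apply: measurable_funD => //; apply: measurable_funM => //.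
exact: measurable_row_coor.
Qed.

Lemma row_lebesgue_affine n (e : R) (c : 'rV[R]_n) (A : set 'rV[R]_n) : 0 < e ->
  measurable A ->
  row_lebesgue R n [set x | A (e *: x + c)] =
  ((e ^- n)%:E * row_lebesgue R n A)%E.
Proof.
move=> e0 mA; have en0 : 0 <= e ^+ n by rewrite exprn_ge0// ltW.
pose f (x : 'rV[R]_n) := e *: x + c.
have mf : measurable_fun setT f by exact: measurable_row_affine.
have := @row_lebesgue_unique n (mscale (NngNum en0) (pushforward (row_lebesgue R n) f)).
move=> /(_ mf) H; rewrite -[in RHS]H//; last first.
  move=> B mB; transitivity ((e ^+ n)%:E *
      row_lebesgue R n (box (fun i => [set t | B i (e * t + c ord0 i)%R])))%E.
    congr (_ * row_lebesgue R n _)%E.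
    by apply/seteqP; split=> x /= h i; have := h i; rewrite /f !mxE.
  rewrite row_lebesgue_box; last first.
    move=> i; rewrite -[X in measurable X]setTI.
    apply: (_ : measurable_fun setT (fun t : measurableTypeR R => e * t + c ord0 i : measurableTypeR R)) => //.
    by apply: measurable_funD => //; exact: measurable_funM.
  under eq_bigr do rewrite lebesgue_measure_affine//.
  rewrite big_split/= muleA prodEFin.
  rewrite -EFinM prodr_const card_ord exprVn mulfV ?mul1e// expf_eq0.
  by rewrite (gt_eqF e0) andbF.
rewrite /mscale/= muleA -EFinM mulVf ?mul1e// expf_eq0.
by rewrite (gt_eqF e0) andbF.
Qed.

Lemma measurable_row_mx m n :
  measurable_fun [set: 'rV[R]_m * 'rV[R]_n] (fun p => row_mx p.1 p.2).
Proof.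
apply: measurable_fun_row => i.
case: (fintype.splitP i) => j ij.
  rewrite [X in measurable_fun _ X](_ : _ = fun p : 'rV[R]_m * 'rV[R]_n => p.1 ord0 j).
    exact: (measurableT_comp (measurable_row_coor j) measurable_fst).
  by apply/funext => p; rewrite (_ : i = lshift n j) ?row_mxEl//; exact/val_inj.
rewrite [X in measurable_fun _ X](_ : _ = fun p : 'rV[R]_m * 'rV[R]_n => p.2 ord0 j).
  exact: (measurableT_comp (measurable_row_coor j) measurable_snd).
by apply/funext => p; rewrite (_ : i = rshift m j) ?row_mxEr//; exact/val_inj.
Qed.

Lemma row_lebesgue_row_mx m n (A : set 'rV[R]_(m + n)) : measurable A ->
  (row_lebesgue R m \x row_lebesgue R n)%E [set p | A (row_mx p.1 p.2)] =
  row_lebesgue R (m + n) A.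
Proof.
move=> mA; have mf := @measurable_row_mx m n.
have := @row_lebesgue_unique (m + n) (pushforward
  (row_lebesgue R m \x row_lebesgue R n)%E (fun p => row_mx p.1 p.2)).
move=> /(_ mf) H; rewrite -[in RHS]H//.
move=> B mB; transitivity ((row_lebesgue R m \x row_lebesgue R n)%E
  (box (fun i => B (lshift n i)) `*` box (fun i => B (rshift m i)))); last first.
  rewrite product_measure1E; [|exact: measurable_box..].
  rewrite big_split_ord/=.
  by congr (_ * _)%E; exact: row_lebesgue_box.
congr (product_measure1 _ _ _); apply/seteqP; split=> -[x y] /=.
  by move=> h; split=> i; [have := h (lshift n i)|have := h (rshift m i)];
    rewrite ?row_mxEl ?row_mxEr.
move=> [hx hy] i; case: (fintype.splitP i) => j ij.
  have -> : i = lshift n j by exact/val_inj.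
  by rewrite row_mxEl; exact: hx.
have -> : i = rshift m j by exact/val_inj.
by rewrite row_mxEr; exact: hy.
Qed.

(** The norm is the sup norm, so balls are boxes, and an open set is the union of the countably many
    balls with rational center and radius 1/(k+1) that it contains. *)
Lemma open_measurable_row n (U : set 'rV[R]_n) : open U -> measurable U.
Proof.
move=> oU.
pose I := ('rV[rat]_n * nat)%type.
pose Bq (q : I) : set 'rV[R]_n := ball (map_mx (ratr : rat -> R) q.1 : 'rV[R]_n) (q.2.+1%:R^-1).
have mB q : measurable (Bq q).
  have -> : Bq q = box (fun i => ball (ratr (q.1 ord0 i) : R) (q.2.+1%:R^-1)).
    apply/seteqP; split=> x.
      by move=> [_ h] i; have := h ord0 i; rewrite mxE.
    by move=> h; split => [|i j]; rewrite ?invr_gt0// mxE ord1; exact: h.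
  by apply: measurable_box => i; exact: measurable_ball.
have -> : U = \bigcup_(q in [set q | Bq q `<=` U]) Bq q.
  apply/seteqP; split=> [x Ux|x [q]]; last exact.
  have [e e0 xeU] : exists2 e : R, 0 < e & ball x e `<=` U.
    by have /nbhs_ballP[e e0 ?] := oU _ Ux; exists e.
  (* Two radii 1/(k+1) fit into e: one for the distance from x to the rational center, one for the
     ball itself. *)
  pose k := Num.truncn (2 / e).
  have ke : 2 * k.+1%:R^-1 < e.
    by rewrite ltr_pdivrMr// mulrC -ltr_pdivrMr// truncnS_gt.
  have kp : 0 < k.+1%:R^-1 :> R by rewrite invr_gt0.
  have : forall i, exists q : rat, `|ratr q - x ord0 i| < k.+1%:R^-1.
    move=> i; have : x ord0 i - k.+1%:R^-1 < x ord0 i + k.+1%:R^-1 :> R.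
      by rewrite ltrBlDr -addrA ltrDl addr_gt0.
    move=> /rat_in_itvoo[q]; rewrite in_itv/= => /andP[h1 h2]; exists q.
    by rewrite ltr_distl h1.
  move=> /choice[f hf].
  exists (\row_i f i, k) => /=.
    move=> y [_ hy]; apply: xeU; split=> // i j; rewrite ord1.
    have := hy ord0 j; rewrite !mxE /ball/= => h.
    rewrite -(subrK (ratr (f j)) (x ord0 j)) -addrA (le_lt_trans (ler_normD _ _))//.
    by apply: lt_trans ke; rewrite mulr_natl mulr2n ltrD// distrC.
  by split=> // i j; rewrite ord1 !mxE; exact: hf.
rewrite bigcup_mkcond; apply: countable_bigcupT_measurable => [|q].
  exact: countableP.
by case: ifP.
Qed.

Lemma continuous_measurable_row n (f : 'rV[R]_n -> R) :
  continuous f -> measurable_fun [set: 'rV[R]_n] f.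
Proof.
move=> cf; apply: (measurability _ (RGenOInfty.measurableE R)) => //.
move=> _ [_ [a ->] <-]; rewrite setTI; apply: open_measurable_row.
by apply: open_comp => [x _|]; [exact: cf|exact: interval_open].
Qed.

Lemma ge0_integral_row_mx m n (f : 'rV[R]_(m + n) -> \bar R) :
  measurable_fun setT f -> (forall z, 0 <= f z)%E ->
  (\int[row_lebesgue R (m + n)]_z f z =
   \int[(row_lebesgue R m \x row_lebesgue R n)%E]_p f (row_mx p.1 p.2))%E.
Proof.
move=> mf f0; have mr := @measurable_row_mx m n.
rewrite -(@ge0_integral_pushforward _ _ _ _ _ _ mr _ setT f)//.
by apply: eq_measure_integral => A mA _; exact/esym/row_lebesgue_row_mx.
Qed.

Lemma tonelli_row m n (f : 'rV[R]_(m + n) -> \bar R) :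
  measurable_fun setT f -> (forall z, 0 <= f z)%E ->
  (\int[row_lebesgue R (m + n)]_z f z =
   \int[row_lebesgue R m]_x \int[row_lebesgue R n]_y f (row_mx x y))%E.
Proof.
move=> mf f0; rewrite ge0_integral_row_mx//.
rewrite (@fubini_tonelli1 _ _ _ _ _ _ _ (fun p => f (row_mx p.1 p.2)))//.
exact: (measurableT_comp mf (@measurable_row_mx m n)).
Qed.

Lemma ge0_integral_affine n (e : R) (c : 'rV[R]_n) (f : 'rV[R]_n -> \bar R) :
  0 < e -> measurable_fun setT f -> (forall z, 0 <= f z)%E ->
  (\int[row_lebesgue R n]_x f (e *: x + c)%R =
   (e ^- n)%:E * \int[row_lebesgue R n]_x f x)%E.
Proof.
move=> e0 mf f0; have ma := @measurable_row_affine n e c.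
rewrite -(@ge0_integral_pushforward _ _ _ _ _ _ ma (row_lebesgue R n) setT f)//.
have en0 : 0 <= e ^- n by rewrite invr_ge0 exprn_ge0// ltW.
rewrite -(@ge0_integral_mscale _ _ _ _ _ measurableT (NngNum en0) f)//.
by apply: eq_measure_integral => A mA _; exact: row_lebesgue_affine.
Qed.

End row_measure.

(** Read off the definition of the integral as a supremum over the simple functions below the
    integrand; applied later to inner integrals and to functions cut off to a set. *)
Lemma ge0_le_integral_nomeas d (T : measurableType d) (R : realType)
    (mu : {measure set T -> \bar R}) (D : set T) (f g : T -> \bar R) :
  (forall x, D x -> 0 <= f x)%E -> (forall x, D x -> f x <= g x)%E ->
  (\int[mu]_(x in D) f x <= \int[mu]_(x in D) g x)%E.
Proof.
move=> f0 fg; rewrite !ge0_integralE//; last first.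
  by move=> x Dx; exact: le_trans (f0 x Dx) (fg x Dx).
apply: le_ereal_sup => _ [h hf <-]; exists h => // x.
apply: le_trans (hf x) _; rewrite /patch; case: ifPn => // /set_mem; exact: fg.
Qed.

(** * Integrals of complex-valued functions *)

Section complex_modulus.
Variable R : realType.
Local Notation C := R[i].
Implicit Types z w : C.

Lemma cabs_ge0 z : 0 <= cabs z.
Proof. by case: z => a b; exact: sqrtr_ge0. Qed.

Lemma cabsM z w : cabs (z * w) = cabs z * cabs w.
Proof. exact: ComplexField.Normc.normcM. Qed.

Lemma cabsD z w : cabs (z + w) <= cabs z + cabs w.
Proof. exact: le_normcD. Qed.

Lemma cabsN z : cabs (- z) = cabs z.
Proof. exact: normcN. Qed.

Lemma cabsB z w : cabs (z - w) <= cabs z + cabs w.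
Proof. by rewrite -[cabs w]cabsN; exact: cabsD. Qed.

Lemma cabs_distC z w : cabs (z - w) = cabs (w - z).
Proof. by rewrite -cabsN opprB. Qed.

Lemma cabs0 : cabs (0 : C) = 0.
Proof. exact: ComplexField.Normc.normc0. Qed.

Lemma cabs1 : cabs (1 : C) = 1.
Proof. exact: ComplexField.Normc.normc1. Qed.

Lemma cabs_eq0 z : cabs z = 0 -> z = 0.
Proof. exact: ComplexField.Normc.eq0_normc. Qed.

Lemma cabs_conj z : cabs (conjc z) = cabs z.
Proof. by case: z => a b /=; rewrite sqrrN. Qed.

Lemma cabs_real (r : R) : cabs (r%:C)%C = `|r|.
Proof. by rewrite /= expr0n/= addr0 sqrtr_sqr. Qed.

Lemma cabs_i : cabs ('i%C : C) = 1.
Proof. by rewrite /= expr0n/= add0r expr1n sqrtr1. Qed.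

Lemma cabs_Re z : `|complex.Re z| <= cabs z.
Proof.
by case: z => a b /=; rewrite -sqrtr_sqr ler_wsqrtr// lerDl sqr_ge0.
Qed.

Lemma cabs_Im z : `|complex.Im z| <= cabs z.
Proof.
by case: z => a b /=; rewrite -sqrtr_sqr ler_wsqrtr// lerDr sqr_ge0.
Qed.

Lemma cabs_le_ReIm z : cabs z <= `|complex.Re z| + `|complex.Im z|.
Proof.
case: z => a b /=; rewrite -[leRHS]ger0_norm ?addr_ge0// -sqrtr_sqr ler_wsqrtr//.
rewrite sqrrD -[a ^+ 2]real_normK ?num_real// -[b ^+ 2]real_normK ?num_real//.
by rewrite lerD2r lerDl mulrn_wge0// mulr_ge0.
Qed.

Lemma ReD z w : complex.Re (z + w) = complex.Re z + complex.Re w.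
Proof. by case: z; case: w. Qed.
Lemma ImD z w : complex.Im (z + w) = complex.Im z + complex.Im w.
Proof. by case: z; case: w. Qed.
Lemma ReM z w : complex.Re (z * w) =
  complex.Re z * complex.Re w - complex.Im z * complex.Im w.
Proof. by case: z; case: w. Qed.
Lemma ImM z w : complex.Im (z * w) =
  complex.Re z * complex.Im w + complex.Im z * complex.Re w.
Proof. by case: z => a b; case: w. Qed.
Lemma ReN z : complex.Re (- z) = - complex.Re z. Proof. by case: z. Qed.
Lemma ImN z : complex.Im (- z) = - complex.Im z. Proof. by case: z. Qed.

Lemma complexP z w : complex.Re z = complex.Re w -> complex.Im z = complex.Im w ->
  z = w.
Proof. by case: z => a b; case: w => c d /= -> ->. Qed.

Lemma conjcM z w : conjc (z * w) = conjc z * conjc w.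
Proof. exact: rmorphM. Qed.
Lemma cabs_sqr z : (cabs z ^+ 2)%:C%C = z * conjc z.
Proof.
case: z => a b; apply: complexP => /=.
  by rewrite sqr_sqrtr ?addr_ge0 ?sqr_ge0//; ring.
by ring.
Qed.

Lemma cis0 : cis (0 : R) = 1.
Proof. by rewrite /cis cos0 sin0. Qed.

Lemma cisD (a b : R) : cis (a + b) = cis a * cis b.
Proof. by apply: complexP; rewrite ?ReM ?ImM/= ?cosD ?sinD//; ring. Qed.

Lemma cabs_cis (a : R) : cabs (cis a) = 1.
Proof. by rewrite /= cos2Dsin2 sqrtr1. Qed.

Lemma conj_cis (a : R) : conjc (cis a) = cis (- a).
Proof. by rewrite /cis /= cosN sinN. Qed.

End complex_modulus.

Section row_integral.
Variable R : realType.
Local Notation C := R[i].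

Definition L1 n (f : 'rV[R]_n -> R) := (RL R n).-integrable setT (EFin \o f).
Definition rint n (f : 'rV[R]_n -> R) : R := \int[RL R n]_x f x.
Definition mfun_row n (f : 'rV[R]_n -> R) := measurable_fun [set: 'rV[R]_n] f.

Lemma L1_mfun n (f : 'rV[R]_n -> R) : L1 f -> mfun_row f.
Proof. by move=> /integrableP[/measurable_EFinP]. Qed.

Lemma mfun_EFin n (f : 'rV[R]_n -> R) : mfun_row f ->
  measurable_fun setT (fun x => (f x)%:E).
Proof. by move=> mf; exact: (measurable_EFinP _ _).2. Qed.

Lemma mfun_norm n (f : 'rV[R]_n -> R) : mfun_row f -> mfun_row (fun x => `|f x|).
Proof. by move=> mf; exact: (measurableT_comp (@normr_measurable R setT)). Qed.

Lemma L1_le n (f g : 'rV[R]_n -> R) : mfun_row f -> L1 g ->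
  (forall x, `|f x| <= g x) -> L1 f.
Proof.
move=> mf ig fg; apply: le_integrable ig => //; first exact/measurable_EFinP.
by move=> x _ /=; rewrite lee_fin (le_trans (fg x))// ler_norm.
Qed.

Lemma L1D n (f g : 'rV[R]_n -> R) : L1 f -> L1 g -> L1 (fun x => f x + g x).
Proof. by move=> If Ig; exact: (integrableD measurableT If Ig). Qed.

Lemma L1Zl n (f : 'rV[R]_n -> R) c : L1 f -> L1 (fun x => c * f x).
Proof. by move=> If; exact: (integrableZl measurableT c If). Qed.

Lemma L1N n (f : 'rV[R]_n -> R) : L1 f -> L1 (fun x => - f x).
Proof. by move=> If; exact: (integrableN If). Qed.

Lemma rint_ge0 n (f : 'rV[R]_n -> R) : (forall x, 0 <= f x) -> 0 <= rint f.
Proof. by move=> f0; apply: Rintegral_ge0. Qed.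

Lemma L1_ge0_intE n (f : 'rV[R]_n -> R) : L1 f ->
  (rint f)%:E = (\int[RL R n]_x (f x)%:E)%E.
Proof. by move=> If; rewrite fineK//; exact: integrable_fin_num. Qed.

Lemma L1_of_lty n (f : 'rV[R]_n -> R) : mfun_row f -> (forall x, 0 <= f x) ->
  (\int[RL R n]_x (f x)%:E < +oo)%E -> L1 f.
Proof.
move=> mf f0 foo; apply/integrableP; split; first exact/measurable_EFinP.
by under eq_integral do rewrite /= ger0_norm//.
Qed.

Lemma ge0_int_le_rint n (f g : 'rV[R]_n -> R) : L1 g ->
  (forall x, 0 <= f x) -> (forall x, f x <= g x) ->
  (\int[RL R n]_x (f x)%:E <= (rint g)%:E)%E.
Proof.
move=> Ig f0 fg; rewrite L1_ge0_intE//; apply: ge0_le_integral_nomeas => x _.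
  by rewrite lee_fin.
by rewrite lee_fin.
Qed.

Lemma rint_le n (f g : 'rV[R]_n -> R) : L1 g -> (forall x, 0 <= f x) ->
  (forall x, f x <= g x) -> rint f <= rint g.
Proof.
move=> Ig f0 fg; have := ge0_int_le_rint Ig f0 fg.
have : (0 <= \int[RL R n]_x (f x)%:E)%E by apply: integral_ge0 => x _; rewrite lee_fin.
by rewrite /rint /Rintegral; case: (integral _ _ _).
Qed.

(** The positive and negative parts of [f] both have their integral in [0, rint g], so the
    difference is at most [rint g] in absolute value. *)
Lemma rint_norm_le n (f g : 'rV[R]_n -> R) : L1 g ->
  (forall x, `|f x| <= g x) -> `|rint f| <= rint g.
Proof.
move=> Ig fg; rewrite {1}/rint /Rintegral integralE.
have h1 : (\int[RL R n]_x ((fun x => (f x)%:E)^\+ x)%E <= (rint g)%:E)%E.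
  rewrite L1_ge0_intE//; apply: ge0_le_integral_nomeas => x _ //.
  rewrite funeposE -EFin_max lee_fin ge_max (le_trans (normr_ge0 _) (fg x)) andbT.
  exact: le_trans (ler_norm _) (fg x).
have h2 : (\int[RL R n]_x ((fun x => (f x)%:E)^\- x)%E <= (rint g)%:E)%E.
  rewrite L1_ge0_intE//; apply: ge0_le_integral_nomeas => x _ //.
  rewrite funenegE -EFinN -EFin_max lee_fin ge_max (le_trans (normr_ge0 _) (fg x)) andbT.
  by apply: le_trans (fg x); rewrite -normrN; exact: ler_norm.
have p1 : (0 <= \int[RL R n]_x ((fun x => (f x)%:E)^\+ x)%E)%E by exact: integral_ge0.
have p2 : (0 <= \int[RL R n]_x ((fun x => (f x)%:E)^\- x)%E)%E by exact: integral_ge0.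
move: h1 h2 p1 p2; case: (integral _ _ _) => [a| |]//.
case: (integral _ _ _) => [b| |]//; rewrite !lee_fin/= => *.
by rewrite ler_norml; apply/andP; split; lra.
Qed.

Lemma rintD n (f g : 'rV[R]_n -> R) : L1 f -> L1 g ->
  rint (fun x => f x + g x) = rint f + rint g.
Proof. by move=> If Ig; exact: RintegralD. Qed.

Lemma rintB n (f g : 'rV[R]_n -> R) : L1 f -> L1 g ->
  rint (fun x => f x - g x) = rint f - rint g.
Proof. by move=> If Ig; exact: RintegralB. Qed.

Lemma rintZl n (f : 'rV[R]_n -> R) c : L1 f -> rint (fun x => c * f x) = c * rint f.
Proof. by move=> If; exact: RintegralZl. Qed.

Lemma rintN n (f : 'rV[R]_n -> R) : L1 f -> rint (fun x => - f x) = - rint f.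
Proof.
move=> If; rewrite -mulN1r -rintZl//; congr rint; apply/funext => x.
by rewrite mulN1r.
Qed.

Lemma mfun_row_affine n (e : R) (c : 'rV[R]_n) (f : 'rV[R]_n -> R) :
  mfun_row f -> mfun_row (fun x => f (e *: x + c)).
Proof. by move=> mf; apply: (measurableT_comp mf); exact: measurable_row_affine. Qed.

Lemma L1_affine n (e : R) (c : 'rV[R]_n) (f : 'rV[R]_n -> R) : 0 < e ->
  L1 f -> L1 (fun x => f (e *: x + c)).
Proof.
move=> e0 If; have /integrableP[mf foo] := If; apply/integrableP; split.
  by apply/measurable_EFinP; apply: mfun_row_affine; exact: L1_mfun.
rewrite /= (@ge0_integral_affine _ _ e c (fun x => (`|f x|)%:E)%E)//.
  by rewrite lte_mul_pinfty// ?lee_fin ?invr_ge0 ?exprn_ge0// ltW.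
by apply: mfun_EFin; apply: mfun_norm; exact: L1_mfun.
Qed.

Lemma rint_affine n (e : R) (c : 'rV[R]_n) (f : 'rV[R]_n -> R) : 0 < e ->
  L1 f -> rint (fun x => f (e *: x + c)) = e ^- n * rint f.
Proof.
move=> e0 If; have /integrableP[mf _] := If.
have Ip := integrable_fin_num measurableT (integrable_funepos measurableT If).
have In := integrable_fin_num measurableT (integrable_funeneg measurableT If).
have Hp := @ge0_integral_affine R n e c ((EFin \o f)^\+)%E e0
  (measurable_funepos mf) (fun x => funepos_ge0 _ x).
have Hn := @ge0_integral_affine R n e c ((EFin \o f)^\-)%E e0
  (measurable_funeneg mf) (fun x => funeneg_ge0 _ x).
rewrite /rint /Rintegral integralE [in RHS]integralE.
transitivity (fine ((e ^- n)%:E * (\int[RL R n]_x (EFin \o f)^\+ x)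
  - (e ^- n)%:E * (\int[RL R n]_x (EFin \o f)^\- x))%E).
  rewrite -Hp -Hn; congr (fine (_ - _)); apply: eq_integral => x _.
    by rewrite !funeposE.
  by rewrite !funenegE.
by rewrite [in RHS]fineB// mulrBr fineB ?fin_numM// !fineM.
Qed.

Lemma L1_shift n (c : 'rV[R]_n) (f : 'rV[R]_n -> R) : L1 f -> L1 (fun x => f (x + c)).
Proof. by move=> /(L1_affine c ltr01); under eq_fun do rewrite scale1r. Qed.

Lemma rint_shift n (c : 'rV[R]_n) (f : 'rV[R]_n -> R) : L1 f ->
  rint (fun x => f (x + c)) = rint f.
Proof.
move=> If; have := rint_affine c ltr01 If.
by rewrite expr1n invr1 mul1r => <-; congr rint; apply/funext => x; rewrite scale1r.
Qed.

Lemma mfun_row_mx m n (f : 'rV[R]_(m + n) -> R) : mfun_row f ->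
  measurable_fun setT (fun p : 'rV[R]_m * 'rV[R]_n => f (row_mx p.1 p.2)).
Proof. by move=> mf; exact: (measurableT_comp mf (@measurable_row_mx R m n)). Qed.

Lemma mfun_row_mxr m n (f : 'rV[R]_(m + n) -> R) x : mfun_row f ->
  mfun_row (fun y => f (row_mx x y)).
Proof.
move=> mf.
exact: (measurableT_comp (mfun_row_mx mf) (pair1_measurable x)).
Qed.

Lemma mfun_row_mxl m n (f : 'rV[R]_(m + n) -> R) y : mfun_row f ->
  mfun_row (fun x => f (row_mx x y)).
Proof.
move=> mf.
exact: (measurableT_comp (mfun_row_mx mf) (pair2_measurable y)).
Qed.

(** Domination by a product g x * h y is the form in which Fubini is applied throughout: by Tonelli
    it gives integrability, and it makes every section integrable, not just almost every one. *)
Lemma L1_row_mx m n (f : 'rV[R]_(m + n) -> R) (g : 'rV[R]_m -> R)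
  (h : 'rV[R]_n -> R) : mfun_row f -> L1 g -> L1 h -> (forall x, 0 <= g x) ->
  (forall y, 0 <= h y) -> (forall x y, `|f (row_mx x y)| <= g x * h y) ->
  L1 f.
Proof.
move=> mf Ig Ih g0 h0 fgh; apply/integrableP; split; first exact/measurable_EFinP.
have mnf : measurable_fun setT (fun z => (`|f z|)%:E).
  by apply: mfun_EFin; exact: mfun_norm.
rewrite /= tonelli_row//.
apply: (@le_lt_trans _ _ (\int[RL R m]_x ((rint h)%:E * (g x)%:E))%E).
  apply: ge0_le_integral_nomeas => x _; first exact: integral_ge0.
  apply: (@le_trans _ _ (\int[RL R n]_y ((g x)%:E * (h y)%:E))%E).
    by apply: ge0_le_integral_nomeas => y _//=; rewrite lee_fin.
  rewrite ge0_integralZl_EFin// -?L1_ge0_intE// 1?muleC//.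
  - by move=> y _; rewrite lee_fin.
  - by have /integrableP[] := Ih.
rewrite ge0_integralZl_EFin// -?L1_ge0_intE// -?EFinM ?ltry//.
- by move=> x _; rewrite lee_fin.
- by have /integrableP[] := Ig.
- exact: rint_ge0.
Qed.

Section fubini.
Variables (m n : nat) (f : 'rV[R]_(m + n) -> R).
Variables (g : 'rV[R]_m -> R) (h : 'rV[R]_n -> R).
Hypotheses (mf : mfun_row f) (Ig : L1 g) (Ih : L1 h).
Hypotheses (g0 : forall x, 0 <= g x) (h0 : forall y, 0 <= h y).
Hypothesis fgh : forall x y, `|f (row_mx x y)| <= g x * h y.

Let If : L1 f. Proof. exact: (L1_row_mx mf Ig Ih). Qed.

Let f' (p : 'rV[R]_m * 'rV[R]_n) : \bar R := (f (row_mx p.1 p.2))%:E.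

Let If' : (RL R m \x RL R n)%E.-integrable setT f'.
Proof.
have mr := @measurable_row_mx R m n.
apply/integrableP; split; first by apply/measurable_EFinP; exact: mfun_row_mx.
rewrite -(@ge0_integral_row_mx _ _ _ (fun z => (`|f z|)%:E))//.
  by have /integrableP[] := If.
by apply: mfun_EFin; exact: mfun_norm.
Qed.

Let intf : (\int[RL R (m + n)]_z (f z)%:E = \int[(RL R m \x RL R n)%E]_p f' p)%E.
Proof.
have mr := @measurable_row_mx R m n.
have := @integral_pushforward _ _ _ _ _ _ mr (RL R m \x RL R n)%E setT
  (fun z => (f z)%:E).
move=> /(_ (mfun_EFin mf) If' measurableT) H; rewrite -[RHS]H.
by apply: eq_measure_integral => A mA _; exact/esym/row_lebesgue_row_mx.
Qed.

Lemma L1_fubini1 x : L1 (fun y => f (row_mx x y)).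
Proof.
by apply: (L1_le (mfun_row_mxr x mf) (L1Zl (g x) Ih)) => y; exact: fgh.
Qed.

Lemma L1_fubini2 y : L1 (fun x => f (row_mx x y)).
Proof.
apply: (L1_le (mfun_row_mxl y mf) (L1Zl (h y) Ig)) => x.
by rewrite mulrC; exact: fgh.
Qed.

Lemma mfun_fubini2 : mfun_row (fun y => rint (fun x => f (row_mx x y))).
Proof.
apply/measurable_EFinP; have := measurable_fubini_G If'.
by congr measurable_fun; apply/funext => x /=; rewrite L1_ge0_intE//; exact: L1_fubini2.
Qed.

Lemma rint_fubini1 : rint f = rint (fun x => rint (fun y => f (row_mx x y))).
Proof.
rewrite {1}/rint /Rintegral intf -integral12_prod_meas1//.
congr fine; apply: eq_integral => x _.
by rewrite L1_ge0_intE//; exact: L1_fubini1.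
Qed.

Lemma rint_fubini2 : rint f = rint (fun y => rint (fun x => f (row_mx x y))).
Proof.
rewrite {1}/rint /Rintegral intf -integral21_prod_meas1//.
congr fine; apply: eq_integral => x _.
by rewrite L1_ge0_intE//; exact: L1_fubini2.
Qed.

End fubini.

Lemma rint_dominated n (f_ : nat -> 'rV[R]_n -> R) (f g : 'rV[R]_n -> R) :
  (forall k, mfun_row (f_ k)) -> L1 g ->
  (forall x, f_ k x @[k --> \oo] --> f x) ->
  (forall k x, `|f_ k x| <= g x) ->
  rint (f_ k) @[k --> \oo] --> rint f.
Proof.
move=> mf Ig ff fg.
have mlim : mfun_row f by apply: (measurable_fun_cvg mf) => x _; exact: ff.
have If : L1 f.
  apply: (L1_le mlim Ig) => x.
  have /cvg_lim <-// : `|f_ k x| @[k --> \oo] --> `|f x| by apply: cvg_norm; exact: ff.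
  apply: limr_le; last by apply: nearW => k; exact: fg.
  by apply/cvg_ex; exists `|f x|; apply: cvg_norm; exact: ff.
apply: fine_cvg; rewrite -/(rint f) L1_ge0_intE//.
apply: (@dominated_cvg _ _ _ (RL R n) _ measurableT
  (fun k x => (f_ k x)%:E) _ (EFin \o g)) => //.
- by move=> k; exact: mfun_EFin.
- by move=> x _; apply: cvg_EFin; [exact: nearW|exact: ff].
- by move=> k x _; rewrite /= lee_fin.
Qed.

End row_integral.

Section complex_integral.
Variable R : realType.
Local Notation C := R[i].

Definition cmeas n (f : 'rV[R]_n -> C) :=
  mfun_row (fun x => complex.Re (f x)) /\ mfun_row (fun x => complex.Im (f x)).

Definition cL1 n (f : 'rV[R]_n -> C) :=
  cmeas f /\ exists2 g : 'rV[R]_n -> R, L1 g & forall x, cabs (f x) <= g x.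

Lemma mfun_cst n (c : R) : mfun_row (fun _ : 'rV[R]_n => c).
Proof. exact: measurable_cst. Qed.

Lemma mfunD n (f g : 'rV[R]_n -> R) : mfun_row f -> mfun_row g ->
  mfun_row (fun x => f x + g x).
Proof. by move=> mf mg; exact: measurable_funD. Qed.

Lemma mfunM n (f g : 'rV[R]_n -> R) : mfun_row f -> mfun_row g ->
  mfun_row (fun x => f x * g x).
Proof. by move=> mf mg; exact: measurable_funM. Qed.

Lemma mfunN n (f : 'rV[R]_n -> R) : mfun_row f -> mfun_row (fun x => - f x).
Proof. by move=> mf; exact: measurable_funN. Qed.

Lemma mfun_comp n (h : R -> R) (f : 'rV[R]_n -> R) : continuous h -> mfun_row f ->
  mfun_row (fun x => h (f x)).
Proof.
by move=> ch mf; apply: (measurableT_comp _ mf); exact: continuous_measurable_fun.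
Qed.

Lemma mfun_cabs n (f : 'rV[R]_n -> C) : cmeas f -> mfun_row (fun x => cabs (f x)).
Proof.
move=> [mr mi]; have -> : (fun x => cabs (f x)) = (fun x =>
    Num.sqrt (complex.Re (f x) * complex.Re (f x) + complex.Im (f x) * complex.Im (f x))).
  by apply/funext => x; case: (f x).
apply: mfun_comp; first exact: sqrt_continuous.
by apply: mfunD; apply: mfunM.
Qed.

Lemma cmeas_cst n (c : C) : cmeas (fun _ : 'rV[R]_n => c).
Proof. by split; exact: mfun_cst. Qed.

Lemma cmeasD n (f g : 'rV[R]_n -> C) : cmeas f -> cmeas g -> cmeas (fun x => f x + g x).
Proof.
move=> [f1 f2] [g1 g2]; split.
  by under eq_fun do rewrite ReD; exact: mfunD.
by under eq_fun do rewrite ImD; exact: mfunD.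
Qed.

Lemma cmeasM n (f g : 'rV[R]_n -> C) : cmeas f -> cmeas g -> cmeas (fun x => f x * g x).
Proof.
move=> [f1 f2] [g1 g2]; split.
  under eq_fun do rewrite ReM; apply: mfunD; first exact: mfunM.
  by apply: mfunN; exact: mfunM.
by under eq_fun do rewrite ImM; apply: mfunD; exact: mfunM.
Qed.

Lemma cmeas_conj n (f : 'rV[R]_n -> C) : cmeas f -> cmeas (fun x => conjc (f x)).
Proof.
move=> [f1 f2]; split.
  by apply: eq_measurable_fun f1 => x _; case: (f x).
by apply: eq_measurable_fun (mfunN f2) => x _; case: (f x).
Qed.

Lemma cmeas_real n (f : 'rV[R]_n -> R) : mfun_row f -> cmeas (fun x => (f x)%:C%C).
Proof. by move=> mf; split => //; exact: mfun_cst. Qed.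

Lemma cmeas_cis n (f : 'rV[R]_n -> R) : mfun_row f -> cmeas (fun x => cis (f x)).
Proof.
by move=> mf; split; apply: mfun_comp => //; [exact: continuous_cos|exact: continuous_sin].
Qed.

Lemma cmeas_affine n (e : R) (c : 'rV[R]_n) (f : 'rV[R]_n -> C) : cmeas f ->
  cmeas (fun x => f (e *: x + c)).
Proof.
move=> [mr mi]; split.
  exact: (mfun_row_affine e c mr).
exact: (mfun_row_affine e c mi).
Qed.

Lemma cmeas_mxr m n (f : 'rV[R]_(m + n) -> C) x : cmeas f ->
  cmeas (fun y => f (row_mx x y)).
Proof.
move=> [mr mi]; split; [exact: (mfun_row_mxr x mr)|exact: (mfun_row_mxr x mi)].
Qed.

Lemma cmeas_mxl m n (f : 'rV[R]_(m + n) -> C) y : cmeas f ->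
  cmeas (fun x => f (row_mx x y)).
Proof.
move=> [mr mi]; split; [exact: (mfun_row_mxl y mr)|exact: (mfun_row_mxl y mi)].
Qed.

Lemma cL1_Re n (f : 'rV[R]_n -> C) : cL1 f -> L1 (fun x => complex.Re (f x)).
Proof.
by move=> [[m1 m2] [g Ig fg]]; apply: (L1_le m1 Ig) => x; exact: le_trans (cabs_Re _) (fg x).
Qed.

Lemma cL1_Im n (f : 'rV[R]_n -> C) : cL1 f -> L1 (fun x => complex.Im (f x)).
Proof.
by move=> [[m1 m2] [g Ig fg]]; apply: (L1_le m2 Ig) => x; exact: le_trans (cabs_Im _) (fg x).
Qed.

Lemma cL1_cabs n (f : 'rV[R]_n -> C) : cL1 f -> L1 (fun x => cabs (f x)).
Proof.
move=> [m [g Ig fg]]; apply: (L1_le (mfun_cabs m) Ig) => x.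
by rewrite ger0_norm ?cabs_ge0.
Qed.

Lemma cL1_le n (f : 'rV[R]_n -> C) g : cmeas f -> L1 g ->
  (forall x, cabs (f x) <= g x) -> cL1 f.
Proof. by move=> mf Ig fg; split=> //; exists g. Qed.

Lemma cL1D n (f g : 'rV[R]_n -> C) : cL1 f -> cL1 g -> cL1 (fun x => f x + g x).
Proof.
move=> [m1 [h1 I1 l1]] [m2 [h2 I2 l2]]; apply: (cL1_le (cmeasD m1 m2) (L1D I1 I2)) => x.
exact: le_trans (cabsD _ _) (lerD (l1 x) (l2 x)).
Qed.

Lemma cL1Zl n (c : C) (f : 'rV[R]_n -> C) : cL1 f -> cL1 (fun x => c * f x).
Proof.
move=> [m1 [h1 I1 l1]]; apply: (@cL1_le _ _ (fun x => cabs c * h1 x)).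
- by apply: cmeasM => //; exact: cmeas_cst.
- exact: L1Zl.
move=> x; by rewrite cabsM ler_wpM2l ?cabs_ge0.
Qed.

Lemma cL1_conj n (f : 'rV[R]_n -> C) : cL1 f -> cL1 (fun x => conjc (f x)).
Proof.
move=> [m1 [h1 I1 l1]]; apply: (cL1_le (cmeas_conj m1) I1) => x.
by rewrite cabs_conj.
Qed.

Lemma cintegralD n (f g : 'rV[R]_n -> C) : cL1 f -> cL1 g ->
  cintegral (fun x => f x + g x) = cintegral f + cintegral g.
Proof.
move=> If Ig; apply: complexP; rewrite ?ReD ?ImD /=.
  rewrite -[RHS](rintD (cL1_Re If) (cL1_Re Ig)); congr rint.
  by apply/funext => x; rewrite ReD.
rewrite -[RHS](rintD (cL1_Im If) (cL1_Im Ig)); congr rint.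
by apply/funext => x; rewrite ImD.
Qed.

Lemma cintegralZl n (c : C) (f : 'rV[R]_n -> C) : cL1 f ->
  cintegral (fun x => c * f x) = c * cintegral f.
Proof.
move=> If; have I1 := cL1_Re If; have I2 := cL1_Im If.
apply: complexP; rewrite ?ReM ?ImM /= -/(rint _) -/(rint _) -/(rint _).
  rewrite -(rintZl _ I1) -(rintZl _ I2) -rintB; [|exact: L1Zl..].
  by congr rint; apply/funext => x; rewrite ReM.
rewrite -(rintZl _ I1) -(rintZl _ I2) -rintD; [|exact: L1Zl..].
by congr rint; apply/funext => x; rewrite ImM.
Qed.

Lemma cintegral_conj n (f : 'rV[R]_n -> C) : cL1 f ->
  cintegral (fun x => conjc (f x)) = conjc (cintegral f).
Proof.
move=> If; apply: complexP => /=.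
  by congr rint; apply/funext => x; case: (f x).
rewrite -/(rint _) -/(rint _) -(rintN (cL1_Im If)).
by congr rint; apply/funext => x; case: (f x).
Qed.

(** Real and imaginary parts are bounded separately, which gives 2 instead of the sharp constant 1.
    This is the origin of most factors 2 below. *)
Lemma cintegral_norm_le n (f : 'rV[R]_n -> C) (g : 'rV[R]_n -> R) : L1 g ->
  (forall x, cabs (f x) <= g x) -> cabs (cintegral f) <= 2 * rint g.
Proof.
move=> Ig fg; apply: le_trans (cabs_le_ReIm _) _ => /=.
rewrite -/(rint _) -/(rint _) mulr_natl mulr2n; apply: lerD.
  by apply: rint_norm_le => // x; exact: le_trans (cabs_Re _) (fg x).
by apply: rint_norm_le => // x; exact: le_trans (cabs_Im _) (fg x).
Qed.

Lemma cintegral_sum n (I : Type) (r : seq I) (f : I -> 'rV[R]_n -> C) :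
  (forall i, cL1 (f i)) ->
  cL1 (fun x => \sum_(i <- r) f i x) /\
  cintegral (fun x => \sum_(i <- r) f i x) = \sum_(i <- r) cintegral (f i).
Proof.
move=> If; elim: r => [|i r [IH1 IH2]].
  have E : (fun x : 'rV[R]_n => \sum_(i <- [::]) f i x) = (fun=> 0).
    by apply/funext => x; rewrite big_nil.
  have I0 : L1 (fun _ : 'rV[R]_n => (0 : R)) by exact: integrable0.
  rewrite E big_nil; split.
    by apply: (@cL1_le _ _ (fun=> 0)) => [||x]//; [exact: cmeas_cst|rewrite cabs0].
  by rewrite /cintegral /Rintegral/= integral0.
have E : (fun x => \sum_(j <- i :: r) f j x) = (fun x => f i x + \sum_(j <- r) f j x).
  by apply/funext => x; rewrite big_cons.
rewrite E big_cons -IH2; split; first exact: cL1D.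
exact: cintegralD.
Qed.

Lemma cL1_affine n (e : R) (c : 'rV[R]_n) (f : 'rV[R]_n -> C) : 0 < e -> cL1 f ->
  cL1 (fun x => f (e *: x + c)).
Proof.
move=> e0 [m1 [h1 I1 l1]].
by apply: (cL1_le (cmeas_affine e c m1) (L1_affine c e0 I1)) => x.
Qed.

Lemma cintegral_affine n (e : R) (c : 'rV[R]_n) (f : 'rV[R]_n -> C) : 0 < e -> cL1 f ->
  cintegral (fun x => f (e *: x + c)) = (e ^- n)%:C%C * cintegral f.
Proof.
move=> e0 If; apply: complexP; rewrite ?ReM ?ImM /= !mul0r ?subr0 ?addr0.
  exact: (rint_affine c e0 (cL1_Re If)).
exact: (rint_affine c e0 (cL1_Im If)).
Qed.

Lemma cL1_shift n (c : 'rV[R]_n) (f : 'rV[R]_n -> C) : cL1 f -> cL1 (fun x => f (x + c)).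
Proof. by move=> /(cL1_affine c ltr01); under eq_fun do rewrite scale1r. Qed.

Lemma cintegral_shift n (c : 'rV[R]_n) (f : 'rV[R]_n -> C) : cL1 f ->
  cintegral (fun x => f (x + c)) = cintegral f.
Proof.
move=> If; have := cintegral_affine c ltr01 If.
rewrite expr1n invr1 mul1r => <-; congr cintegral; apply/funext => x.
by rewrite scale1r.
Qed.

Section cfubini.
Variables (m n : nat) (f : 'rV[R]_(m + n) -> C).
Variables (g : 'rV[R]_m -> R) (h : 'rV[R]_n -> R).
Hypotheses (mf : cmeas f) (Ig : L1 g) (Ih : L1 h).
Hypotheses (g0 : forall x, 0 <= g x) (h0 : forall y, 0 <= h y).
Hypothesis fgh : forall x y, cabs (f (row_mx x y)) <= g x * h y.

Let fgh1 x y : `|complex.Re (f (row_mx x y))| <= g x * h y.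
Proof. exact: le_trans (cabs_Re _) (fgh x y). Qed.
Let fgh2 x y : `|complex.Im (f (row_mx x y))| <= g x * h y.
Proof. exact: le_trans (cabs_Im _) (fgh x y). Qed.

Lemma cmeas_fubini2 : cmeas (fun y => cintegral (fun x => f (row_mx x y))).
Proof.
by case: (mf) => m1 m2; split; [exact: (mfun_fubini2 m1 Ig Ih)|exact: (mfun_fubini2 m2 Ig Ih)].
Qed.

Lemma cfubini1 : cintegral f = cintegral (fun x => cintegral (fun y => f (row_mx x y))).
Proof.
case: (mf) => m1 m2; apply: complexP.
  exact: (rint_fubini1 m1 Ig Ih).
exact: (rint_fubini1 m2 Ig Ih).
Qed.

Lemma cfubini2 : cintegral f = cintegral (fun y => cintegral (fun x => f (row_mx x y))).
Proof.
case: (mf) => m1 m2; apply: complexP.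
  exact: (rint_fubini2 m1 Ig Ih).
exact: (rint_fubini2 m2 Ig Ih).
Qed.

End cfubini.

Definition ccvg (u : nat -> C) (l : C) :=
  (complex.Re (u k) @[k --> \oo] --> complex.Re l) /\
  (complex.Im (u k) @[k --> \oo] --> complex.Im l).

Lemma ccvg_uniq (u : nat -> C) (l l' : C) : ccvg u l -> ccvg u l' -> l = l'.
Proof.
by move=> [a1 a2] [b1 b2]; apply: complexP; [exact: cvg_unique a1 b1|exact: cvg_unique a2 b2].
Qed.

Lemma ccvgM (u v : nat -> C) l l' : ccvg u l -> ccvg v l' -> ccvg (fun k => u k * v k) (l * l').
Proof.
move=> [a1 a2] [b1 b2]; split.
  rewrite ReM; under eq_fun do rewrite ReM.
  by apply: cvgB; apply: cvgM.
rewrite ImM; under eq_fun do rewrite ImM.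
by apply: cvgD; apply: cvgM.
Qed.

Lemma ccvg_cst l : ccvg (fun=> l) l.
Proof. by split; exact: cvg_cst. Qed.

Lemma cintegral_dominated n (f_ : nat -> 'rV[R]_n -> C) (f : 'rV[R]_n -> C) g :
  (forall k, cmeas (f_ k)) -> L1 g ->
  (forall x, ccvg (fun k => f_ k x) (f x)) ->
  (forall k x, cabs (f_ k x) <= g x) ->
  ccvg (fun k => cintegral (f_ k)) (cintegral f).
Proof.
move=> mf Ig ff fg; split.
  apply: (rint_dominated (fun k => (mf k).1) Ig) => [x|k x]; first by case: (ff x).
  exact: le_trans (cabs_Re _) (fg k x).
apply: (rint_dominated (fun k => (mf k).2) Ig) => [x|k x]; first by case: (ff x).
exact: le_trans (cabs_Im _) (fg k x).
Qed.

End complex_integral.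

(** * The Japanese bracket *)

Section japanese_bracket.
Variable R : realType.
Local Notation C := R[i].

Section dot.
Variable n : nat.
Implicit Types x y z : 'rV[R]_n.

Lemma dotC x y : dot x y = dot y x.
Proof. by apply: eq_bigr => i _; rewrite mulrC. Qed.

Lemma dotDl x y z : dot (x + y) z = dot x z + dot y z.
Proof. by rewrite -big_split; apply: eq_bigr => i _; rewrite mxE mulrDl. Qed.

Lemma dotDr x y z : dot z (x + y) = dot z x + dot z y.
Proof. by rewrite dotC dotDl !(dotC z). Qed.

Lemma dotZl c x y : dot (c *: x) y = c * dot x y.
Proof. by rewrite mulr_sumr; apply: eq_bigr => i _; rewrite mxE mulrA. Qed.

Lemma dotZr c x y : dot x (c *: y) = c * dot x y.
Proof. by rewrite dotC dotZl dotC. Qed.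

Lemma dotNl x y : dot (- x) y = - dot x y.
Proof. by rewrite -scaleN1r dotZl mulN1r. Qed.

Lemma dotNr x y : dot x (- y) = - dot x y.
Proof. by rewrite dotC dotNl dotC. Qed.

Lemma dotBl x y z : dot (x - y) z = dot x z - dot y z.
Proof. by rewrite dotDl dotNl. Qed.

Lemma dotBr x y z : dot z (x - y) = dot z x - dot z y.
Proof. by rewrite dotDr dotNr. Qed.

Lemma dot0l x : dot 0 x = 0.
Proof. by rewrite /dot big1// => i _; rewrite mxE mul0r. Qed.

Lemma dot_ge0 x : 0 <= dot x x.
Proof. by apply: sumr_ge0 => i _; rewrite -expr2 sqr_ge0. Qed.

Lemma dot_delta x i : dot x (delta_mx ord0 i) = x ord0 i.
Proof.
rewrite /dot (bigD1 i)//= mxE !eqxx mulr1 big1 ?addr0// => j ji.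
by rewrite mxE (negbTE ji) mulr0.
Qed.

Lemma euclid_sqr x : euclid x ^+ 2 = dot x x.
Proof. by rewrite sqr_sqrtr ?dot_ge0. Qed.

Lemma jap_sqr x : japanese x ^+ 2 = 1 + dot x x.
Proof. by rewrite sqr_sqrtr euclid_sqr// addr_ge0 ?dot_ge0. Qed.

Lemma jap_gt0 x : 0 < japanese x.
Proof. by rewrite sqrtr_gt0 euclid_sqr ltr_pwDl ?dot_ge0. Qed.

Lemma jap_ge0 x : 0 <= japanese x. Proof. exact/ltW/jap_gt0. Qed.

Lemma jap_le x y : dot x x <= dot y y -> japanese x <= japanese y.
Proof. by move=> h; rewrite ler_wsqrtr// lerD2l !euclid_sqr. Qed.

Lemma jap_le_sqr x (r : R) : 0 <= r -> 1 + dot x x <= r ^+ 2 -> japanese x <= r.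
Proof. by move=> r0 h; rewrite -(@ler_pXn2r _ 2)// ?nnegrE ?jap_ge0// jap_sqr. Qed.

Lemma jap_ge_sqr x (r : R) : 0 <= r -> r ^+ 2 <= 1 + dot x x -> r <= japanese x.
Proof. by move=> r0 h; rewrite -(@ler_pXn2r _ 2)// ?nnegrE ?jap_ge0// jap_sqr. Qed.

Lemma jap_ge1 x : 1 <= japanese x.
Proof. by apply: jap_ge_sqr => //; rewrite expr1n lerDl dot_ge0. Qed.

Lemma japX_ge1 x k : 1 <= japanese x ^+ k.
Proof. by rewrite exprn_ege1// jap_ge1. Qed.

Lemma japX_gt0 x k : 0 < japanese x ^+ k.
Proof. by rewrite exprn_gt0// jap_gt0. Qed.

Lemma japX_ge0 x k : 0 <= japanese x ^+ k.
Proof. by rewrite exprn_ge0// jap_ge0. Qed.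

Lemma japX_le x k l : (k <= l)%N -> japanese x ^+ k <= japanese x ^+ l.
Proof. by move=> kl; rewrite ler_weXn2l// jap_ge1. Qed.

Lemma japV_ge0 x k : 0 <= japanese x ^- k.
Proof. by rewrite invr_ge0 japX_ge0. Qed.

Lemma japV_le1 x k : japanese x ^- k <= 1.
Proof. by rewrite invf_le1 ?japX_gt0// japX_ge1. Qed.

Lemma japV_le x k l : (k <= l)%N -> japanese x ^- l <= japanese x ^- k.
Proof. by move=> kl; rewrite lef_pV2 ?posrE ?japX_gt0// japX_le. Qed.

Lemma japN x : japanese (- x) = japanese x.
Proof. by rewrite /japanese /euclid dotNl dotNr opprK. Qed.

Lemma jap_distC x y : japanese (x - y) = japanese (y - x).
Proof. by rewrite -japN opprB. Qed.

Lemma jap0 : japanese (0 : 'rV[R]_n) = 1.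
Proof. by rewrite /japanese euclid_sqr dot0l addr0 sqrtr1. Qed.

Lemma coord_le_jap x i : `|x ord0 i| <= japanese x.
Proof.
apply: jap_ge_sqr => //; rewrite real_normK ?num_real// ler_wpDl//.
by rewrite /dot (bigD1 i)//= -expr2 lerDl sumr_ge0// => j _; rewrite -expr2 sqr_ge0.
Qed.

Lemma dotD_le x y : dot (x + y) (x + y) <= 2 * dot x x + 2 * dot y y.
Proof.
rewrite /dot !mulr_sumr -big_split/=; apply: ler_sum => i _; rewrite !mxE.
have := sqr_ge0 (x ord0 i - y ord0 i); nra.
Qed.

Lemma japD x y : japanese (x + y) <= 2 * (japanese x * japanese y).
Proof.
apply: jap_le_sqr; first by rewrite !mulr_ge0 ?jap_ge0.
rewrite !exprMn !jap_sqr; have := dotD_le x y.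
have := dot_ge0 x; have := dot_ge0 y; set a := dot x x; set b := dot y y.
set c := dot _ _; move=> b0 a0 h; have := mulr_ge0 a0 b0; nra.
Qed.

Lemma japD_X x y k : japanese (x + y) ^+ k <= 2 ^+ k * (japanese x ^+ k * japanese y ^+ k).
Proof.
rewrite -!exprMn; apply: lerXn2r; rewrite ?nnegrE ?jap_ge0//.
  by rewrite !mulr_ge0 ?jap_ge0.
exact: japD.
Qed.

Lemma japDV x y k :
  japanese (x + y) ^- k <= 2 ^+ k * (japanese x ^- k * japanese y ^+ k).
Proof.
have := japD_X (x + y) (- y) k; rewrite addrK japN => h.
rewrite -[leLHS]mul1r ler_pdivrMr ?japX_gt0//.
have -> : 2 ^+ k * (japanese x ^- k * japanese y ^+ k) * japanese (x + y) ^+ k =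
   (2 ^+ k * (japanese (x + y) ^+ k * japanese y ^+ k)) / japanese x ^+ k by ring.
by rewrite ler_pdivlMr ?japX_gt0// mul1r.
Qed.

Lemma jap_scale (e : R) x : japanese (e *: x) <= (1 + `|e|) * japanese x.
Proof.
apply: jap_le_sqr; first by rewrite mulr_ge0 ?jap_ge0// addr_ge0.
rewrite exprMn jap_sqr dotZl dotZr sqrrD real_normK ?num_real// expr1n.
have := dot_ge0 x; have := normr_ge0 e; have := sqr_ge0 e.
move: `|e| (dot x x) => a b; nra.
Qed.

Lemma sum_le_jap x : 1 + \sum_(i < n) `|x ord0 i| <= n.+1%:R * japanese x.
Proof.
rewrite -natr1 mulrDl addrC mul1r lerD ?jap_ge1//.
rewrite mulr_natl -[X in _ *+ X]card_ord -sumr_const.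
by apply: ler_sum => i _; exact: coord_le_jap.
Qed.

Lemma jap_le_sum x : japanese x <= 1 + \sum_(i < n) `|x ord0 i|.
Proof.
have s0 : 0 <= \sum_(i < n) `|x ord0 i| by exact: sumr_ge0.
apply: jap_le_sqr; first by rewrite addr_ge0.
suff : dot x x <= (\sum_(i < n) `|x ord0 i|) ^+ 2 by nra.
rewrite expr2 mulr_suml; apply: ler_sum => i _.
rewrite -expr2 -[_ ^+ 2]real_normK ?num_real// expr2 ler_wpM2l//.
by rewrite (bigD1 i)//= lerDl sumr_ge0.
Qed.

Lemma mfun_coord i : mfun_row (fun x : 'rV[R]_n => x ord0 i).
Proof. exact: measurable_row_coor. Qed.

Lemma mfun_sum (I : Type) (r : seq I) (f : I -> 'rV[R]_n -> R) :
  (forall i, mfun_row (f i)) -> mfun_row (fun x => \sum_(i <- r) f i x).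
Proof.
move=> mf; elim: r => [|i r IH].
  by under eq_fun do rewrite big_nil; exact: mfun_cst.
by under eq_fun do rewrite big_cons; exact: mfunD.
Qed.

Lemma mfun_jap : mfun_row (@japanese R n).
Proof.
rewrite /japanese; under eq_fun do rewrite euclid_sqr.
apply: mfun_comp; first exact: sqrt_continuous.
apply: mfunD; first exact: mfun_cst.
by apply: mfun_sum => i; apply: mfunM; exact: mfun_coord.
Qed.

Lemma mfun_japV k : mfun_row (fun x : 'rV[R]_n => japanese x ^- k).
Proof.
have -> : (fun x : 'rV[R]_n => japanese x ^- k) = (fun x => (expR (ln (japanese x) * - k%:R))).
  apply/funext => x; rewrite mulrN expRN expRM_natr lnK//.
  by rewrite posrE jap_gt0.
apply: mfun_comp; first exact: continuous_expR.
apply: mfunM; last exact: mfun_cst.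
by apply: (measurableT_comp (@measurable_ln R)); exact: mfun_jap.
Qed.

End dot.

Lemma dot_row_mx m n (a c : 'rV[R]_m) (b d : 'rV[R]_n) :
  dot (row_mx a b) (row_mx c d) = dot a c + dot b d.
Proof.
rewrite /dot big_split_ord/=; congr (_ + _); apply: eq_bigr => i _.
  by rewrite !row_mxEl.
by rewrite !row_mxEr.
Qed.

Lemma jap_row_mxl m n (a : 'rV[R]_m) (b : 'rV[R]_n) : japanese a <= japanese (row_mx a b).
Proof.
apply: jap_le_sqr; first exact: jap_ge0.
by rewrite jap_sqr dot_row_mx lerD2l lerDl dot_ge0.
Qed.

Lemma jap_row_mxr m n (a : 'rV[R]_m) (b : 'rV[R]_n) : japanese b <= japanese (row_mx a b).
Proof.
apply: jap_le_sqr; first exact: jap_ge0.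
by rewrite jap_sqr dot_row_mx lerD2l lerDr dot_ge0.
Qed.

Lemma jap_row_mx m n (a : 'rV[R]_m) (b : 'rV[R]_n) :
  japanese (row_mx a b) <= japanese a * japanese b.
Proof.
apply: jap_le_sqr; first by rewrite mulr_ge0 ?jap_ge0.
rewrite exprMn !jap_sqr dot_row_mx; have := mulr_ge0 (dot_ge0 a) (dot_ge0 b); nra.
Qed.

(** Half of the exponent is spent on each block: decay in the pair becomes the product domination
    that Fubini asks for. *)
Lemma row_mx_japV m n (a : 'rV[R]_m) (b : 'rV[R]_n) k :
  japanese (row_mx a b) ^- (k + k) <= japanese a ^- k * japanese b ^- k.
Proof.
rewrite exprD invfM; apply: ler_pM; rewrite ?japV_ge0// lef_pV2 ?posrE ?japX_gt0//;
  apply: lerXn2r; rewrite ?nnegrE ?jap_ge0//.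
  exact: jap_row_mxl.
exact: jap_row_mxr.
Qed.

Lemma prod_le_jap n (x : 'rV[R]_n) :
  \prod_(i < n) (1 + x ord0 i ^+ 2) <= japanese x ^+ (2 * n).
Proof.
rewrite exprM -[X in _ <= _ ^+ X]card_ord -prodr_const; apply: ler_prod => i _.
rewrite addr_ge0 ?sqr_ge0//= jap_sqr lerD2l /dot (bigD1 i)//= -expr2 lerDl.
by apply: sumr_ge0 => j _; rewrite -expr2 sqr_ge0.
Qed.

Lemma integral_oneDsqr_lty :
  (\int[@lebesgue_measure R]_t ((1 + t ^+ 2)^-1)%:E < +oo)%E.
Proof.
rewrite ge0_symfun_integralT//=.
- rewrite (_ : [set x | _] = `[0, +oo[%classic); last first.
    by apply/seteqP; split => x/=; rewrite in_itv/= andbT.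
  have := @integral0y_oneDsqr R; rewrite /oneDsqr => ->.
  by rewrite -EFinM ltry.
- by move=> x; rewrite invr_ge0 addr_ge0 ?sqr_ge0.
- exact: continuous_oneDsqrV.
- by move=> x/=; rewrite sqrrN.
Qed.

Lemma integral_prod_lty n :
  (\int[RL R n]_x (\prod_(i < n) (1 + x ord0 i ^+ 2)^-1)%:E < +oo)%E.
Proof.
have mP k : mfun_row (fun x : 'rV[R]_k => \prod_(i < k) (1 + x ord0 i ^+ 2)^-1).
  have -> : (fun x : 'rV[R]_k => \prod_(i < k) (1 + x ord0 i ^+ 2)^-1) =
      (fun x => expR (- \sum_(i < k) ln (1 + x ord0 i ^+ 2))).
    apply/funext => x; rewrite expRN expR_sum -prodfV; apply: eq_bigr => i _.
    by rewrite lnK// posrE ltr_pwDl ?sqr_ge0.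
  apply: mfun_comp; first exact: continuous_expR.
  apply: mfunN; apply: mfun_sum => i.
  apply: (measurableT_comp (@measurable_ln R)); apply: mfunD; first exact: mfun_cst.
  by apply: measurable_funX; exact: mfun_coord.
have P0 k (x : 'rV[R]_k) : 0 <= \prod_(i < k) (1 + x ord0 i ^+ 2)^-1.
  by apply: prodr_ge0 => i _; rewrite invr_ge0 addr_ge0 ?sqr_ge0.
elim: n => [|n IH].
  under eq_integral do rewrite big_ord0.
  by rewrite integral_cst//= diracT mul1e ltry.
have mc := @measurable_row_cons R n.
have := @ge0_integral_pushforward _ _ _ _ R _ mc (lebesgue_measure \x RL R n)%E setT
  (fun x => (\prod_(i < n.+1) (1 + x ord0 i ^+ 2)^-1)%:E) measurableT
  (mfun_EFin (mP n.+1)) (fun y _ => P0 n.+1 y).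
move=> H; rewrite [ltLHS](_ : _ = (\int[(lebesgue_measure \x RL R n)%E]_p
   ((1 + p.1 ^+ 2)^-1 * \prod_(i < n) (1 + p.2 ord0 i ^+ 2)^-1)%:E)%E); last first.
  transitivity (\int[(lebesgue_measure \x RL R n)%E]_p
     (\prod_(i < n.+1) (1 + (row_cons p) ord0 i ^+ 2)^-1)%:E)%E; first exact: H.
  apply: eq_integral => -[r x] _; rewrite big_ord_recl/=; congr (_ * _)%:E.
    have := congr1 (fun p => p.1) (row_consK (r, x)); by rewrite /row_uncons/= => ->.
  apply: eq_bigr => i _.
  have := congr1 (fun p : measurableTypeR R * 'rV[R]_n => p.2 ord0 i) (row_consK (r, x)).
  by rewrite /row_uncons/= mxE => ->.
have m1 : measurable_fun [set: measurableTypeR R] (fun t : measurableTypeR R => (1 + t ^+ 2)^-1 : R).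
  by apply: (@continuous_measurable_fun R (fun t => (oneDsqr t)^-1)); exact: continuous_oneDsqrV.
rewrite fubini_tonelli1//; last 2 first.
- apply/measurable_EFinP; apply: measurable_funM.
    exact: (measurableT_comp m1 measurable_fst).
  exact: (measurableT_comp (mP n) measurable_snd).
- by move=> p; rewrite lee_fin mulr_ge0// invr_ge0 addr_ge0 ?sqr_ge0.
rewrite /fubini_F/=.
rewrite [ltLHS](_ : _ = \int[lebesgue_measure]_t (((1 + t ^+ 2)^-1)%:E *
    \int[RL R n]_x (\prod_(i < n) (1 + x ord0 i ^+ 2)^-1)%:E))%E; last first.
  apply: eq_integral => t _; under eq_integral do rewrite EFinM.
  rewrite ge0_integralZl_EFin//.
  - by move=> x _; rewrite lee_fin; exact: P0.
  - exact: mfun_EFin.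
  - by rewrite invr_ge0 addr_ge0 ?sqr_ge0.
rewrite ge0_integralZr//; last 3 first.
- exact/measurable_EFinP.
- by move=> t _; rewrite lee_fin invr_ge0 addr_ge0 ?sqr_ge0.
- by apply: integral_ge0 => x _; rewrite lee_fin.
apply: lte_mul_pinfty => //.
- by apply: integral_ge0 => t _; rewrite lee_fin invr_ge0 addr_ge0 ?sqr_ge0.
- rewrite ge0_fin_numE; first exact: integral_oneDsqr_lty.
  by apply: integral_ge0 => t _; rewrite lee_fin invr_ge0 addr_ge0 ?sqr_ge0.
Qed.

(** The exponent 2n comes from <x>^(2n) >= prod (1 + x_i^2), which reduces the integral to a product
    of copies of int dt / (1 + t^2). *)
Lemma L1_jap n N : (2 * n <= N)%N -> L1 (fun x : 'rV[R]_n => japanese x ^- N).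
Proof.
move=> nN; apply: L1_of_lty; first exact: mfun_japV.
  by move=> x; exact: japV_ge0.
apply: le_lt_trans (integral_prod_lty n).
apply: ge0_le_integral_nomeas => x _; rewrite lee_fin ?japV_ge0//.
apply: le_trans (japV_le x nN) _; rewrite prodfV lef_pV2 ?posrE ?japX_gt0 ?prod_le_jap//.
by apply: prodr_gt0 => i _; rewrite ltr_pwDl ?sqr_ge0.
Qed.

End japanese_bracket.

(** * Smooth functions *)

Section partial_derivatives.
Variable R : realType.
Local Notation C := R[i].
Local Notation e_ i := (delta_mx ord0 i).

Definition rder n (f : 'rV[R]_n -> R) (i : 'I_n) (x : 'rV[R]_n) (d : R) :=
  is_derive x (e_ i) (f : _ -> R^o) (d : R^o).

Section real_continuity.
Variable T : topologicalType.
Implicit Types f g : T -> R.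

Lemma contD f g : continuous f -> continuous g -> continuous (fun x => f x + g x).
Proof. by move=> cf cg x; exact: (@cvgD R R^o _ _ _ _ _ _ _ (cf x) (cg x)). Qed.

Lemma contM f g : continuous f -> continuous g -> continuous (fun x => f x * g x).
Proof. by move=> cf cg x; exact: (@cvgM R _ _ _ _ _ _ _ (cf x) (cg x)). Qed.

Lemma contN f : continuous f -> continuous (fun x => - f x).
Proof. by move=> cf x; exact: (@cvgN R R^o _ _ _ _ _ (cf x)). Qed.

Lemma contB f g : continuous f -> continuous g -> continuous (fun x => f x - g x).
Proof. by move=> cf cg; exact: contD cf (contN cg). Qed.

Lemma cont_cst (c : R) : continuous (fun _ : T => c).
Proof. exact: cst_continuous. Qed.

Lemma cont_sum (I : Type) (r : seq I) (f : I -> T -> R) :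
  (forall i, continuous (f i)) -> continuous (fun x => \sum_(i <- r) f i x).
Proof.
move=> cf; elim: r => [|i r IH].
  by under eq_fun do rewrite big_nil; exact: cont_cst.
by under eq_fun do rewrite big_cons; exact: contD.
Qed.

Lemma cont_compR (h : R -> R) f : continuous h -> continuous f ->
  continuous (fun x => h (f x)).
Proof. by move=> ch cf x; exact: (@continuous_comp _ _ _ f h x (cf x) (ch _)). Qed.

End real_continuity.

Lemma is_derive_ext (V W : normedModType R) (f g : V -> W) x v d d' :
  is_derive x v f d -> (forall y, f y = g y) -> d = d' -> is_derive x v g d'.
Proof. by move=> h /funext <- <-. Qed.

(** Both sides have the same difference quotient. Through this, one-variable calculus (mean value
    theorem, chain rule, differentiation under the integral) reaches partial derivatives. *)
Lemma line_derive (V : normedModType R) (f : V -> R^o) (x e : V) (t : R) (d : R^o) :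
  is_derive (x + t *: e) e f d <->
  is_derive (t : R^o) (1 : R^o) (fun s : R^o => f (x + s *: e)) d.
Proof.
pose u := fun h : R => h^-1 *: ((f \o shift (x + t *: e)) (h *: e) - f (x + t *: e)).
have uE : u = (fun h : R => h^-1 *: (((fun s : R^o => f (x + s *: e)) \o shift (t : R^o))
    (h *: (1 : R^o)) - f (x + t *: e))).
  apply/funext => h; rewrite /u /=; congr (_ *: (f _ - _)).
  have -> : h *: (1 : R^o) = h by exact: mulr1.
  by rewrite scalerDl addrCA.
by split=> -[h1 h2]; split; move: h1 h2; rewrite /derivable /derive -/u ?uE.
Qed.

Lemma rder_line n (f : 'rV[R]_n -> R) i x t d :
  rder f i (x + t *: e_ i) d <-> is_derive t (1 : R) (fun s => f (x + s *: e_ i)) d.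
Proof. exact: (@line_derive _ f x (e_ i) t d). Qed.

Lemma rder_line0 n (f : 'rV[R]_n -> R) i x d :
  rder f i x d <-> is_derive (0 : R) (1 : R) (fun s => f (x + s *: e_ i)) d.
Proof. by rewrite -rder_line scale0r addr0. Qed.

Lemma rder_uniq n (f : 'rV[R]_n -> R) i x d d' : rder f i x d -> rder f i x d' -> d = d'.
Proof. by move=> [_ <-] [_ <-]. Qed.

Definition cder n (f : 'rV[R]_n -> C) i x (v : C) :=
  rder (fun y => complex.Re (f y)) i x (complex.Re v) /\
  rder (fun y => complex.Im (f y)) i x (complex.Im v).

Lemma cder_pderiv n (f : 'rV[R]_n -> C) i x v : cder f i x v -> pderiv i f x = v.
Proof. by case: v => a b [[_ h1] [_ h2]]; rewrite /pderiv h1 h2. Qed.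

Lemma cder_cst n (c : C) i x : cder (fun _ : 'rV[R]_n => c) i x 0.
Proof. by split; exact: is_derive_cst. Qed.

Lemma cder_add n (f g : 'rV[R]_n -> C) i x a b : cder f i x a -> cder g i x b ->
  cder (fun y => f y + g y) i x (a + b).
Proof.
move=> [f1 f2] [g1 g2]; split.
  rewrite ReD; rewrite /rder; under eq_fun do rewrite ReD.
  exact: (is_deriveD f1 g1).
rewrite ImD; rewrite /rder; under eq_fun do rewrite ImD.
exact: (is_deriveD f2 g2).
Qed.

Lemma rder_mul n (f g : 'rV[R]_n -> R) i x a b : rder f i x a -> rder g i x b ->
  rder (fun y => f y * g y) i x (a * g x + f x * b).
Proof.
move=> f1 g1; apply: is_derive_ext (is_deriveM f1 g1) _ _ => //.
by rewrite /GRing.scale/= addrC [g x * a]mulrC.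
Qed.

Lemma cder_mul n (f g : 'rV[R]_n -> C) i x a b : cder f i x a -> cder g i x b ->
  cder (fun y => f y * g y) i x (a * g x + f x * b).
Proof.
move=> [f1 f2] [g1 g2]; split.
  rewrite ReD !ReM; rewrite /rder; under eq_fun do rewrite ReM.
  by apply: is_derive_ext (is_deriveB (rder_mul f1 g1) (rder_mul f2 g2)) _ _ => //; ring.
rewrite ImD !ImM; rewrite /rder; under eq_fun do rewrite ImM.
by apply: is_derive_ext (is_deriveD (rder_mul f1 g2) (rder_mul f2 g1)) _ _ => //; ring.
Qed.

Lemma cder_conj n (f : 'rV[R]_n -> C) i x a : cder f i x a ->
  cder (fun y => conjc (f y)) i x (conjc a).
Proof.
move=> [f1 f2]; split.
  have -> : complex.Re (conjc a) = complex.Re a by case: (a).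
  by have -> : (fun y => complex.Re (conjc (f y))) = (fun y => complex.Re (f y))
    by apply/funext => y; case: (f y).
have -> : complex.Im (conjc a) = - complex.Im a by case: (a).
have -> : (fun y => complex.Im (conjc (f y))) = (fun y => - complex.Im (f y))
  by apply/funext => y; case: (f y).
exact: is_deriveN.
Qed.

Definition ccont n (f : 'rV[R]_n -> C) :=
  continuous (fun x => complex.Re (f x) : R^o) /\
  continuous (fun x => complex.Im (f x) : R^o).

Lemma ccont_meas n (f : 'rV[R]_n -> C) : ccont f -> cmeas f.
Proof. by move=> [c1 c2]; split; exact: continuous_measurable_row. Qed.

Lemma ccont_cst n (c : C) : ccont (fun _ : 'rV[R]_n => c).
Proof. by split; exact: cst_continuous. Qed.

Lemma ccont_add n (f g : 'rV[R]_n -> C) : ccont f -> ccont g -> ccont (fun x => f x + g x).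
Proof.
move=> [f1 f2] [g1 g2]; split.
  have -> : (fun x => complex.Re (f x + g x)) = (fun x => complex.Re (f x) + complex.Re (g x))
    by apply/funext => x; rewrite ReD.
  exact: contD.
have -> : (fun x => complex.Im (f x + g x)) = (fun x => complex.Im (f x) + complex.Im (g x))
  by apply/funext => x; rewrite ImD.
exact: contD.
Qed.

Lemma ccont_mul n (f g : 'rV[R]_n -> C) : ccont f -> ccont g -> ccont (fun x => f x * g x).
Proof.
move=> [f1 f2] [g1 g2]; split.
  have -> : (fun x => complex.Re (f x * g x)) = (fun x => complex.Re (f x) * complex.Re (g x)
      - complex.Im (f x) * complex.Im (g x)) by apply/funext => x; rewrite ReM.
  by apply: contB; apply: contM.
have -> : (fun x => complex.Im (f x * g x)) = (fun x => complex.Re (f x) * complex.Im (g x)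
    + complex.Im (f x) * complex.Re (g x)) by apply/funext => x; rewrite ImM.
by apply: contD; apply: contM.
Qed.

Lemma ccont_conj n (f : 'rV[R]_n -> C) : ccont f -> ccont (fun x => conjc (f x)).
Proof.
move=> [f1 f2]; split.
  by have -> : (fun y => complex.Re (conjc (f y))) = (fun y => complex.Re (f y))
    by apply/funext => y; case: (f y).
have -> : (fun y => complex.Im (conjc (f y))) = (fun y => - complex.Im (f y))
  by apply/funext => y; case: (f y).
exact: contN.
Qed.

Lemma ccont_comp m n (f : 'rV[R]_n -> C) (A : 'rV[R]_m -> 'rV[R]_n) : continuous A ->
  ccont f -> ccont (fun x => f (A x)).
Proof.
move=> cA [f1 f2]; split=> x.
  by apply: (@continuous_comp _ _ _ A (fun y => complex.Re (f y) : R^o)); [exact: cA|exact: f1].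
by apply: (@continuous_comp _ _ _ A (fun y => complex.Im (f y) : R^o)); [exact: cA|exact: f2].
Qed.

Lemma row_continuous m n (A : 'rV[R]_m -> 'rV[R]_n) :
  (forall j, continuous (fun x => A x ord0 j)) -> continuous A.
Proof.
move=> cA x U [P hP PU]; apply: (@filterS _ _ _ [set y | forall j, P ord0 j (A y ord0 j)]).
  by move=> y hy; apply: PU => i j; rewrite ord1; exact: hy.
by apply: (@filter_forall _ _ (fun j y => P ord0 j (A y ord0 j)) (nbhs x)) => j; apply: cA; exact: hP.
Qed.

(* Affine maps sending each coordinate direction to a multiple of a coordinate
   direction: the only changes of variables that are differentiated. *)
Definition coordmap m n (A : 'rV[R]_m -> 'rV[R]_n) (c : 'I_m -> R) (s : 'I_m -> 'I_n) :=
  forall x t i, A (x + t *: e_ i) = A x + (t * c i) *: e_ (s i).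

Lemma coordmap_continuous m n A c s : @coordmap m n A c s -> continuous A.
Proof.
(* Moving from 0 to x one coordinate at a time shows that A is affine in the coordinates. *)
move=> HA; have AE x : A x = A 0 + \sum_(i < m) (x ord0 i * c i) *: e_ (s i).
  rewrite {1}(row_sum_delta x); elim: (index_enum _) => [|i r IH].
    by rewrite !big_nil addr0.
  by rewrite !big_cons addrC HA IH -addrA [_ + _ *: _]addrC.
apply: row_continuous => j.
have -> : (fun x => A x ord0 j) = (fun x => A 0 ord0 j +
    \sum_(i < m) x ord0 i * (c i * (e_ (s i) : 'rV[R]_n) ord0 j)).
  apply/funext => x; rewrite AE mxE summxE; congr (_ + _).
  by apply: eq_bigr => i _; rewrite mxE mulrA.
apply: contD; first exact: cont_cst.
apply: cont_sum => i; apply: contM; last exact: cont_cst.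
exact: coord_continuous.
Qed.

Lemma rder_comp m n A c s (f : 'rV[R]_n -> R) i x d : @coordmap m n A c s ->
  rder f (s i) (A x) d -> rder (fun y => f (A y)) i x (c i * d).
Proof.
move=> HA /rder_line0 h; apply/rder_line0.
have -> : (fun t => f (A (x + t *: e_ i))) =
  (fun t => f (A x + t *: e_ (s i))) \o (fun t => t * c i).
  by apply/funext => t /=; rewrite HA.
have h0 : is_derive (0 * c i : R) (1 : R) (fun t => f (A x + t *: e_ (s i))) d.
  by rewrite mul0r.
have h1 : is_derive (0 : R) (1 : R) (fun t : R => t * c i) (c i).
  apply: is_derive_ext (@is_deriveM _ _ id (cst (c i)) (0 : R) (1 : R) _ _
    (is_derive_id _ _) (is_derive_cst _ _ _)) _ _ => //.
  by rewrite /GRing.scale/= mulr0 add0r mulr1.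
by rewrite mulrC; exact: is_derive1_comp.
Qed.

Lemma cder_comp m n A c s (f : 'rV[R]_n -> C) i x d : @coordmap m n A c s ->
  cder f (s i) (A x) d -> cder (fun y => f (A y)) i x ((c i)%:C%C * d).
Proof.
move=> HA [h1 h2]; split.
  by rewrite ReM/= mul0r subr0; apply: (rder_comp (f := fun y => complex.Re (f y)) HA).
by rewrite ImM/= mul0r addr0; apply: (rder_comp (f := fun y => complex.Im (f y)) HA).
Qed.

(** The stages of [smooth]. Closure under products and compositions goes by induction on k, since
    the derivative of a product contains factors of which only order k is available at that
    stage. *)
Fixpoint Ck n (k : nat) (f : 'rV[R]_n -> C) : Prop :=
  if k is k'.+1 then
    [/\ ccont f, forall i x, cder f i x (pderiv i f x) & forall i, Ck k' (pderiv i f)]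
  else ccont f.

Lemma Ck_pred n k (f : 'rV[R]_n -> C) : Ck k.+1 f -> Ck k f.
Proof.
elim: k f => [f []//|k IH f [h1 h2 h3]]; split => // i.
by apply: IH; exact: h3.
Qed.

Lemma smoothP n (f : 'rV[R]_n -> C) : smooth f <-> forall k, Ck k f.
Proof.
split=> [sf k|h].
  elim: k f sf => [|k IH] f sf; first by have [? ?] := sf [::].
  have [h1 h2 h3] := sf [::]; split=> //.
    by move=> i x; have [d1 d2] := h3 i x; exact: conj (DeriveDef d1 erefl) (DeriveDef d2 erefl).
  (* [foldr] applies the last index of the sequence first, hence [rcons] for the innermost
     derivative. *)
  move=> i; apply: IH => s; have := sf (rcons s i).
  by rewrite foldr_rcons.
move=> s; elim/last_ind: s f h => [|s i IH] f h.
  have [[h1 h2] h3 _] := h 1%N; split=> [||i x]; [exact: h1|exact: h2|].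
  by have [[d1 _] [d2 _]] := h3 i x; exact: conj d1 d2.
by rewrite foldr_rcons; apply: IH => k; have [_ _] := h k.+1; exact.
Qed.

Lemma pderivE n (f g : 'rV[R]_n -> C) i : (forall x, cder f i x (g x)) -> pderiv i f = g.
Proof. by move=> h; apply/funext => x; exact: cder_pderiv. Qed.

Lemma CkS n k (f : 'rV[R]_n -> C) (g : 'I_n -> 'rV[R]_n -> C) : ccont f ->
  (forall i x, cder f i x (g i x)) -> (forall i, Ck k (g i)) -> Ck k.+1 f.
Proof.
move=> cf fg kg; have E i : pderiv i f = g i by exact: pderivE.
by split=> // [i x|i]; rewrite E.
Qed.

Lemma Ck_cst n k (c : C) : Ck k (fun _ : 'rV[R]_n => c).
Proof.
elim: k c => [|k IH] c; first exact: ccont_cst.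
apply: (CkS (g := fun _ _ => 0)) => [|i x|i]; [exact: ccont_cst|exact: cder_cst|exact: IH].
Qed.

Lemma Ck_add n k (f g : 'rV[R]_n -> C) : Ck k f -> Ck k g -> Ck k (fun x => f x + g x).
Proof.
elim: k f g => [|k IH] f g; first exact: ccont_add.
move=> [f1 f2 f3] [g1 g2 g3].
apply: (CkS (g := fun i x => pderiv i f x + pderiv i g x)) => [|i x|i].
- exact: ccont_add.
- exact: cder_add.
- by apply: IH; [exact: f3|exact: g3].
Qed.

Lemma Ck_mul n k (f g : 'rV[R]_n -> C) : Ck k f -> Ck k g -> Ck k (fun x => f x * g x).
Proof.
elim: k f g => [|k IH] f g; first exact: ccont_mul.
move=> fk gk; case: (fk) => f1 f2 f3; case: (gk) => g1 g2 g3.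
apply: (CkS (g := fun i x => pderiv i f x * g x + f x * pderiv i g x)) => [|i x|i].
- exact: ccont_mul.
- exact: cder_mul.
- by apply: Ck_add; apply: IH; [exact: f3|exact: Ck_pred|exact: Ck_pred|exact: g3].
Qed.

Lemma Ck_conj n k (f : 'rV[R]_n -> C) : Ck k f -> Ck k (fun x => conjc (f x)).
Proof.
elim: k f => [|k IH] f; first exact: ccont_conj.
move=> [f1 f2 f3]; apply: (CkS (g := fun i x => conjc (pderiv i f x))) => [|i x|i].
- exact: ccont_conj.
- exact: cder_conj.
- by apply: IH; exact: f3.
Qed.

Lemma Ck_comp m n A c s k (f : 'rV[R]_n -> C) : @coordmap m n A c s -> Ck k f ->
  Ck k (fun x => f (A x)).
Proof.
move=> HA; have cA := coordmap_continuous HA.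
elim: k f => [|k IH] f; first exact: ccont_comp.
move=> [f1 f2 f3].
apply: (CkS (g := fun i x => (c i)%:C%C * pderiv (s i) f (A x))) => [|i x|i].
- exact: ccont_comp.
- exact: (cder_comp HA).
- by apply: Ck_mul; [exact: Ck_cst|apply: IH; exact: f3].
Qed.

(** A bootstrap: the derivatives are q f, so order k of f gives order k + 1. It covers exponentials,
    real and imaginary, of smooth functions. *)
Lemma Ck_logder n k (f : 'rV[R]_n -> C) (q : 'I_n -> 'rV[R]_n -> C) : ccont f ->
  (forall i x, cder f i x (q i x * f x)) -> (forall i k, Ck k (q i)) -> Ck k f.
Proof.
move=> cf fq kq; elim: k => [//|k IH].
by apply: (CkS (g := fun i x => q i x * f x)) => // i; exact: Ck_mul.
Qed.

Section smooth.
Variable n : nat.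
Implicit Types f g : 'rV[R]_n -> C.

Lemma smooth_cont f : smooth f -> ccont f.
Proof. by move=> /smoothP /(_ 0%N). Qed.

Lemma smooth_meas f : smooth f -> cmeas f.
Proof. by move=> /smooth_cont; exact: ccont_meas. Qed.

Lemma smooth_cder f i x : smooth f -> cder f i x (pderiv i f x).
Proof. by move=> /smoothP /(_ 1%N) []. Qed.

Lemma smooth_pderiv f i : smooth f -> smooth (pderiv i f).
Proof. by move=> /smoothP h; apply/smoothP => k; have [_ _] := h k.+1; exact. Qed.

Lemma smooth_cst (c : C) : smooth (fun _ : 'rV[R]_n => c).
Proof. by apply/smoothP => k; exact: Ck_cst. Qed.

Lemma smooth_add f g : smooth f -> smooth g -> smooth (fun x => f x + g x).
Proof. by move=> /smoothP hf /smoothP hg; apply/smoothP => k; exact: Ck_add. Qed.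

Lemma smooth_mul f g : smooth f -> smooth g -> smooth (fun x => f x * g x).
Proof. by move=> /smoothP hf /smoothP hg; apply/smoothP => k; exact: Ck_mul. Qed.

Lemma smooth_conj f : smooth f -> smooth (fun x => conjc (f x)).
Proof. by move=> /smoothP hf; apply/smoothP => k; exact: Ck_conj. Qed.

Lemma smooth_sum (I : Type) (r : seq I) (f : I -> 'rV[R]_n -> C) :
  (forall i, smooth (f i)) -> smooth (fun x => \sum_(i <- r) f i x).
Proof.
move=> hf; elim: r => [|i r IH].
  have -> : (fun x => \sum_(i <- [::]) f i x) = (fun=> 0)
    by apply/funext => x; rewrite big_nil.
  exact: smooth_cst.
have -> : (fun x => \sum_(j <- i :: r) f j x) = (fun x => f i x + \sum_(j <- r) f j x)
  by apply/funext => x; rewrite big_cons.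
by apply: smooth_add; [exact: hf|exact: IH].
Qed.

Lemma pderiv_add f g i : smooth f -> smooth g ->
  pderiv i (fun x => f x + g x) = (fun x => pderiv i f x + pderiv i g x).
Proof. by move=> sf sg; apply: pderivE => x; apply: cder_add; exact: smooth_cder. Qed.

Lemma pderiv_mul f g i : smooth f -> smooth g ->
  pderiv i (fun x => f x * g x) = (fun x => pderiv i f x * g x + f x * pderiv i g x).
Proof. by move=> sf sg; apply: pderivE => x; apply: cder_mul; exact: smooth_cder. Qed.

Lemma pderiv_cst (c : C) i : pderiv i (fun _ : 'rV[R]_n => c) = (fun=> 0).
Proof. by apply: pderivE => x; exact: cder_cst. Qed.

Lemma pderiv_cmul (c : C) f i : smooth f ->
  pderiv i (fun x => c * f x) = (fun x => c * pderiv i f x).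
Proof.
move=> sf; rewrite (pderiv_mul _ (@smooth_cst c) sf).
by apply/funext => x; rewrite pderiv_cst mul0r add0r.
Qed.

Lemma pderiv_conj f i : smooth f ->
  pderiv i (fun x => conjc (f x)) = (fun x => conjc (pderiv i f x)).
Proof. by move=> sf; apply: pderivE => x; apply: cder_conj; exact: smooth_cder. Qed.

Lemma smooth_logder f (q : 'I_n -> 'rV[R]_n -> C) : ccont f ->
  (forall i x, cder f i x (q i x * f x)) -> (forall i, smooth (q i)) -> smooth f.
Proof.
move=> cf fq sq; apply/smoothP => k; apply: (@Ck_logder n k f q cf fq) => i k'.
by have /smoothP := sq i; exact.
Qed.

End smooth.

Lemma smooth_comp m n A c s (f : 'rV[R]_n -> C) : @coordmap m n A c s -> smooth f ->
  smooth (fun x => f (A x)).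
Proof. by move=> HA /smoothP hf; apply/smoothP => k; exact: (Ck_comp HA). Qed.

Lemma pderiv_comp m n A c s (f : 'rV[R]_n -> C) i : @coordmap m n A c s -> smooth f ->
  pderiv i (fun x => f (A x)) = (fun x => (c i)%:C%C * pderiv (s i) f (A x)).
Proof. by move=> HA sf; apply: pderivE => x; apply: (cder_comp HA); exact: smooth_cder. Qed.

End partial_derivatives.

Opaque smooth.

(** * Jets *)

Section jets.
Variable R : realType.
Local Notation C := R[i].
Local Notation e_ i := (delta_mx ord0 i).

(* The sum of the absolute values of all iterated partial derivatives of order
   at most [k], counted with multiplicities that make [jet_mul] hold with
   constant one. *)
Fixpoint jet n (k : nat) (f : 'rV[R]_n -> C) (x : 'rV[R]_n) : R :=
  if k is k'.+1 then jet k' f x + \sum_(i < n) jet k' (pderiv i f) x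
  else cabs (f x).

Lemma jet_ge0 n k (f : 'rV[R]_n -> C) x : 0 <= jet k f x.
Proof.
elim: k f => [|k IH] f /=; first exact: cabs_ge0.
by rewrite addr_ge0// sumr_ge0.
Qed.

Lemma jet_leS n k (f : 'rV[R]_n -> C) x : jet k f x <= jet k.+1 f x.
Proof. by rewrite /= lerDl sumr_ge0// => i _; exact: jet_ge0. Qed.

Lemma jet_le n k l (f : 'rV[R]_n -> C) x : (k <= l)%N -> jet k f x <= jet l f x.
Proof.
move=> /subnK <-; elim: (l - k)%N => [//|j IH].
exact: le_trans IH (jet_leS _ _ _).
Qed.

Lemma cabs_le_jet n k (f : 'rV[R]_n -> C) x : cabs (f x) <= jet k f x.
Proof. exact: (@jet_le n 0 k). Qed.

Lemma jet_pderiv n k (f : 'rV[R]_n -> C) i x : jet k (pderiv i f) x <= jet k.+1 f x.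
Proof.
rewrite /= (bigD1 i)//= addrCA lerDl addr_ge0 ?jet_ge0// sumr_ge0// => j _.
exact: jet_ge0.
Qed.

Lemma jet_foldr n (s : seq 'I_n) (f : 'rV[R]_n -> C) x :
  cabs (foldr (@pderiv R n) f s x) <= jet (size s) f x.
Proof.
elim/last_ind: s f => [//|s i IH] f.
by rewrite foldr_rcons size_rcons; apply: le_trans (IH _) (jet_pderiv _ _ _ _).
Qed.

(** Unfolding [jet k] produces (n+1)^k terms, each an iterated derivative of order at most k. *)
Lemma jet_le_foldr n k (f : 'rV[R]_n -> C) x B :
  (forall s, (size s <= k)%N -> cabs (foldr (@pderiv R n) f s x) <= B) ->
  jet k f x <= n.+1%:R ^+ k * B.
Proof.
elim: k f => [|k IH] f h; first by rewrite expr0 mul1r; exact: (h [::]).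
have h1 : jet k f x <= n.+1%:R ^+ k * B.
  by apply: IH => s sk; apply: h; exact: leqW.
rewrite /= exprSr; move: h1; set K := n.+1%:R ^+ k => h1.
have -> : K * n.+1%:R * B = K * B + K * \sum_(i < n) B.
  by rewrite sumr_const card_ord -mulr_natl -natr1; ring.
rewrite lerD// mulr_sumr; apply: ler_sum => i _; apply: IH => s sk.
by rewrite -foldr_rcons; apply: h; rewrite size_rcons.
Qed.

Lemma jet_add n k (f g : 'rV[R]_n -> C) x : smooth f -> smooth g ->
  jet k (fun y => f y + g y) x <= jet k f x + jet k g x.
Proof.
elim: k f g => [|k IH] f g sf sg; first exact: cabsD.
rewrite /= addrACA; apply: lerD; first exact: IH.
rewrite -big_split/=; apply: ler_sum => i _; rewrite (pderiv_add i sf sg).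
by apply: IH; exact: smooth_pderiv.
Qed.

Lemma jet_mul n k (f g : 'rV[R]_n -> C) x : smooth f -> smooth g ->
  jet k (fun y => f y * g y) x <= jet k f x * jet k g x.
Proof.
elim: k f g => [|k IH] f g sf sg; first by rewrite /= cabsM.
have pf i := @smooth_pderiv _ _ f i sf; have pg i := @smooth_pderiv _ _ g i sg.
have h i : jet k (pderiv i (fun y => f y * g y)) x <=
    jet k (pderiv i f) x * jet k g x + jet k f x * jet k (pderiv i g) x.
  rewrite (pderiv_mul i sf sg); apply: le_trans (jet_add k x _ _) _.
  - exact: smooth_mul (pf i) sg.
  - exact: smooth_mul sf (pg i).
  - by apply: lerD; [exact: IH (pf i) sg|exact: IH sf (pg i)].
rewrite /= mulrDl !mulrDr -addrA; apply: lerD; first exact: IH.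
apply: le_trans (ler_sum _ (fun i _ => h i)) _; rewrite big_split/= -mulr_suml -mulr_sumr.
(* The only term of the expanded product left over is the product of the two sums over derivatives,
   which is nonnegative. *)
rewrite [leRHS]addrA [leLHS]addrC lerDl mulr_ge0// sumr_ge0// => i _; exact: jet_ge0.
Qed.

Lemma jet_cst n k (c : C) x : jet k (fun _ : 'rV[R]_n => c) x = cabs c.
Proof.
elim: k c => [//|k IH] c; rewrite /= IH big1 ?addr0// => i _.
by rewrite pderiv_cst IH cabs0.
Qed.

Lemma jet_cmul n k (c : C) (f : 'rV[R]_n -> C) x : smooth f ->
  jet k (fun y => c * f y) x = cabs c * jet k f x.
Proof.
elim: k f => [|k IH] f sf; first by rewrite /= cabsM.
rewrite /= mulrDr mulr_sumr (IH f sf); congr (_ + _); apply: eq_bigr => i _.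
by rewrite (pderiv_cmul c i sf); apply: IH; exact: smooth_pderiv.
Qed.

Lemma jet_conj n k (f : 'rV[R]_n -> C) x : smooth f ->
  jet k (fun y => conjc (f y)) x = jet k f x.
Proof.
elim: k f => [|k IH] f sf; first by rewrite /= cabs_conj.
rewrite /= (IH f sf); congr (_ + _); apply: eq_bigr => i _.
by rewrite (pderiv_conj i sf); apply: IH; exact: smooth_pderiv.
Qed.

Lemma jet_comp m n A c s k (f : 'rV[R]_n -> C) x : @coordmap R m n A c s -> smooth f ->
  jet k (fun y => f (A y)) x <= (1 + \sum_(i < m) `|c i|) ^+ k * jet k f (A x).
Proof.
move=> HA; set S := 1 + _.
have S1 : 1 <= S by rewrite lerDl sumr_ge0.
elim: k f => [|k IH] f sf; first by rewrite mul1r.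
rewrite exprSr -mulrA.
have Sk0 : 0 <= S ^+ k by rewrite exprn_ge0// (le_trans ler01 S1).
apply: (@le_trans _ _ (S ^+ k * (jet k f (A x) + \sum_(i < m) `|c i| * jet k (pderiv (s i) f) (A x)))).
  rewrite /= mulrDr; apply: lerD; first exact: IH.
  rewrite mulr_sumr; apply: ler_sum => i _.
  rewrite (pderiv_comp _ HA sf) jet_cmul; last first.
    by apply: (smooth_comp HA); exact: smooth_pderiv.
  rewrite cabs_real mulrCA; apply: ler_wpM2l => //.
  by apply: IH; exact: smooth_pderiv.
rewrite ler_wpM2l// /S mulrDl mul1r lerD ?jet_leS// mulr_suml.
by apply: ler_sum => i _; rewrite ler_wpM2l//; exact: jet_pderiv.
Qed.

(** Passing from order k to k + 1 adds the jets of the products q_i f, that is, multiplies by at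
    most 1 plus the sum of the jets of the q_i. *)
Lemma jet_logder n k (f : 'rV[R]_n -> C) (q : 'I_n -> 'rV[R]_n -> C) x : ccont f ->
  (forall i x, cder f i x (q i x * f x)) -> (forall i, smooth (q i)) ->
  jet k f x <= cabs (f x) * (1 + \sum_(i < n) jet k (q i) x) ^+ k.
Proof.
move=> cf fq sq; have sf := smooth_logder cf fq sq.
have T0 j : 0 <= \sum_(i < n) jet j (q i) x by apply: sumr_ge0 => i _; exact: jet_ge0.
have Tle j : \sum_(i < n) jet j (q i) x <= \sum_(i < n) jet j.+1 (q i) x.
  by apply: ler_sum => i _; exact: jet_leS.
elim: k => [|k IH]; first by rewrite mulr1.
have h : jet k.+1 f x <= jet k f x * (1 + \sum_(i < n) jet k (q i) x).
  rewrite /= mulrDr mulr1 lerD// mulr_sumr; apply: ler_sum => i _.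
  by rewrite (pderivE (fq i)) mulrC; apply: jet_mul; [exact: sq|exact: sf].
apply: le_trans h _; rewrite exprSr mulrA; apply: ler_pM.
- exact: jet_ge0.
- by rewrite addr_ge0.
- apply: le_trans IH _; rewrite ler_wpM2l ?cabs_ge0//.
  by apply: lerXn2r; rewrite ?nnegrE ?addr_ge0// lerD2l.
- by rewrite lerD2l.
Qed.

Lemma mfun_jet n k (f : 'rV[R]_n -> C) : smooth f -> mfun_row (jet k f).
Proof.
elim: k f => [|k IH] f sf.
  by apply: mfun_cabs; exact: smooth_meas.
apply: mfunD; first exact: IH.
by apply: mfun_sum => i; apply: IH; exact: smooth_pderiv.
Qed.

(** * Mean value theorem and symmetry of mixed derivatives *)

Section mean_value.
Variable n : nat.
Implicit Types f : 'rV[R]_n -> R.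

Lemma MVT_line f i x (h : R) (df : 'rV[R]_n -> R) : (forall y, rder f i y (df y)) ->
  exists2 t, (0 <= t <= h) || (h <= t <= 0) &
    f (x + h *: e_ i) - f x = h * df (x + t *: e_ i).
Proof.
move=> hf; pose g (s : R) := f (x + s *: e_ i).
have dg (s : R) : is_derive (s : R) (1 : R) g (df (x + s *: e_ i)) by apply/rder_line.
have cg (a b : R) : {within `[a, b], continuous g}.
  apply: derivable_within_continuous => s _.
  by have [] := dg s.
have g0 : g 0 = f x by rewrite /g scale0r addr0.
case: (ltgtP h 0) => [h0|h0|->].
- have [c] := @MVT R g (fun s => df (x + s *: e_ i)) _ _ h0 (fun s _ => dg s) (cg _ _).
  rewrite in_itv/= g0 => /andP[c1 c2] E; exists c; first by rewrite (ltW c1) (ltW c2) orbT.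
  by rewrite -/(g h) -opprB E sub0r mulrN opprK mulrC.
- have [c] := @MVT R g (fun s => df (x + s *: e_ i)) _ _ h0 (fun s _ => dg s) (cg _ _).
  rewrite in_itv/= g0 => /andP[c1 c2] E; exists c; first by rewrite (ltW c1) (ltW c2).
  by rewrite -/(g h) E subr0 mulrC.
- by exists 0; rewrite ?lexx// scale0r addr0 subrr mul0r.
Qed.

Lemma double_difference f i j x (h : R) (df ddf : 'rV[R]_n -> R) :
  (forall y, rder f i y (df y)) -> (forall y, rder df j y (ddf y)) ->
  exists t s, [/\ `|t| <= `|h|, `|s| <= `|h| &
    f (x + h *: e_ j + h *: e_ i) - f (x + h *: e_ i) - (f (x + h *: e_ j) - f x)
    = h * (h * ddf (x + t *: e_ i + s *: e_ j))].
Proof.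
move=> hf hdf.
pose g y := f (y + h *: e_ j) - f y.
have HT : coordmap (fun y : 'rV[R]_n => y + h *: e_ j) (fun=> 1) id.
  by move=> y t k; rewrite mulr1 addrAC.
have dg y : rder g i y (df (y + h *: e_ j) - df y).
  apply: is_deriveB; last exact: hf.
  by rewrite -[df _]mul1r; apply: (rder_comp (f := f) HT); exact: hf.
have [t t0 Et] := MVT_line x h dg.
have [s s0 Es] := MVT_line (x + t *: e_ i) h hdf.
exists t, s; split.
- by case/orP: t0 => /andP[a b]; [rewrite !ger0_norm// (le_trans a b)|
    rewrite !ler0_norm// ?lerN2// (le_trans a b)].
- by case/orP: s0 => /andP[a b]; [rewrite !ger0_norm// (le_trans a b)|
    rewrite !ler0_norm// ?lerN2// (le_trans a b)].
- rewrite -Es -Et /g [x + h *: e_ j + _]addrAC; ring.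
Qed.

(** The second difference in [double_difference] is symmetric in i and j, and equals h^2 times
    either mixed derivative at a point close to x. Continuity of both then identifies them at x. *)
Lemma Clairaut_real f i j (di dj dij dji : 'rV[R]_n -> R) :
  (forall y, rder f i y (di y)) -> (forall y, rder f j y (dj y)) ->
  (forall y, rder di j y (dij y)) -> (forall y, rder dj i y (dji y)) ->
  continuous dij -> continuous dji -> dij = dji.
Proof.
move=> hi hj hij hji cij cji; apply/funext => x; apply/eqP; rewrite -subr_eq0 -normr_le0.
apply/ler_addgt0Pr => e e0; rewrite add0r.
have e20 : 0 < e / 2 by rewrite divr_gt0.
have /cvgrPdist_lt /(_ _ e20) /nbhs_ballP[d1 d10 H1] := cij x.
have /cvgrPdist_lt /(_ _ e20) /nbhs_ballP[d2 d20 H2] := cji x.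
(* The intermediate points are displaced by at most h in each of two directions, so 2h stays below
   both radii. *)
pose h := Num.min d1 d2 / 3.
have m0 : 0 < Num.min d1 d2 by rewrite lt_min; apply/andP; split.
have h0 : 0 < h by rewrite divr_gt0.
have [t [s [ht hs E1]]] := double_difference x h hi hij.
have [t' [s' [ht' hs' E2]]] := double_difference x h hj hji.
have E : dij (x + t *: e_ i + s *: e_ j) = dji (x + t' *: e_ j + s' *: e_ i).
  have : h * (h * dij (x + t *: e_ i + s *: e_ j)) = h * (h * dji (x + t' *: e_ j + s' *: e_ i)).
    rewrite -E1 -E2 [x + h *: e_ i + _]addrAC; ring.
  by move=> /(mulfI (lt0r_neq0 h0)) /(mulfI (lt0r_neq0 h0)).
have near a b (a' b' : 'I_n) dd : `|a| <= `|h| -> `|b| <= `|h| -> Num.min d1 d2 <= dd ->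
    ball x dd (x + a *: e_ a' + b *: e_ b').
  move=> ha hb hdd; split; first exact: lt_le_trans m0 hdd.
  move=> u v; rewrite /ball/= !mxE -addrA opprD addrA subrr add0r normrN.
  apply: le_lt_trans (ler_normD _ _) _; rewrite !normrM.
  have b1 : forall (p q : bool), `|((p && q)%:R : R)| <= 1 by case; case; rewrite /= ?normr0 ?normr1.
  apply: lt_le_trans hdd; apply: (@le_lt_trans _ _ (`|h| + `|h|)).
    by apply: lerD; apply: le_trans (ler_pM _ _ _ (b1 _ _)) _; rewrite ?mulr1.
  by rewrite gtr0_norm// /h; move: m0; lra.
have l1 : Num.min d1 d2 <= d1 by rewrite ge_min lexx.
have l2 : Num.min d1 d2 <= d2 by rewrite ge_min lexx orbT.
have a1 := H1 _ (near _ _ _ _ _ ht hs l1).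
have a2 := H2 _ (near _ _ _ _ _ ht' hs' l2).
rewrite -(subrK (dij (x + t *: e_ i + s *: e_ j)) (dij x)) -addrA {2}E.
apply: le_trans (ler_normD _ _) _; rewrite [e]splitr lerD// ltW//.
by rewrite distrC.
Qed.

Lemma Clairaut (f : 'rV[R]_n -> C) i j : smooth f ->
  pderiv i (pderiv j f) = pderiv j (pderiv i f).
Proof.
move=> sf; have sj := smooth_pderiv j sf; have si := smooth_pderiv i sf.
have [c1 c2] := smooth_cont (smooth_pderiv i sj).
have [c3 c4] := smooth_cont (smooth_pderiv j si).
have hR (g : 'rV[R]_n -> C) k (sg : smooth g) y := (smooth_cder k y sg).1.
have hI (g : 'rV[R]_n -> C) k (sg : smooth g) y := (smooth_cder k y sg).2.
have ER := Clairaut_real (hR f j sf) (hR f i sf) (hR _ i sj) (hR _ j si) c1 c3.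
have EI := Clairaut_real (hI f j sf) (hI f i sf) (hI _ i sj) (hI _ j si) c2 c4.
apply/funext => x; apply: complexP.
  exact: (f_equal (fun g : 'rV[R]_n -> R => g x) ER).
exact: (f_equal (fun g : 'rV[R]_n -> R => g x) EI).
Qed.

End mean_value.

Lemma smooth_foldr n (f : 'rV[R]_n -> C) s : smooth f -> smooth (foldr (@pderiv R n) f s).
Proof. by move=> sf; elim: s => [//|i s IH] /=; exact: smooth_pderiv. Qed.

Lemma foldr_pderiv_perm n (f : 'rV[R]_n -> C) s t : smooth f -> perm_eq s t ->
  foldr (@pderiv R n) f s = foldr (@pderiv R n) f t.
Proof.
move=> sf; have mv i s1 s2 : foldr (@pderiv R n) f (s1 ++ i :: s2) =
    foldr (@pderiv R n) f (i :: s1 ++ s2).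
  elim: s1 => [//|j s1 IH] /=; rewrite IH/=; apply: Clairaut; exact: smooth_foldr.
elim: s t => [|i s IH] t; first by case: t => [//|j t] /perm_size.
move=> p; have it : i \in t by rewrite -(perm_mem p) mem_head.
case/splitPr: it p => t1 t2; rewrite perm_sym perm_catC/= perm_cons perm_catC perm_sym => p.
by rewrite mv/= (IH _ p).
Qed.

Definition index_of n (s : seq 'I_n) : {ffun 'I_n -> nat} := [ffun i => count_mem i s].

Lemma mderivE n (al : {ffun 'I_n -> nat}) (f : 'rV[R]_n -> C) :
  mderiv al f = foldr (@pderiv R n) f (flatten [seq nseq (al i) i | i <- enum 'I_n]).
Proof.
rewrite /mderiv; elim: (enum _) => [//|i r IH] /=; rewrite foldr_cat IH.
by elim: (al i) => [//|k IH'] /=; rewrite IH'.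
Qed.

(** The Schwartz and Shubin bounds speak of [mderiv], which takes derivatives in the order of the
    indices, while jets run over all words of indices. Symmetry of mixed derivatives connects the
    two. *)
Lemma mderiv_index n (s : seq 'I_n) (f : 'rV[R]_n -> C) : smooth f ->
  mderiv (index_of s) f = foldr (@pderiv R n) f s.
Proof.
move=> sf; rewrite mderivE; apply: foldr_pderiv_perm => //.
apply/allP => i _ /=; rewrite count_flatten -map_comp sumnE big_map big_enum/=.
rewrite (bigD1 i)//= count_nseq/= eqxx mul1n ffunE big1 ?addn0// => j ji.
by rewrite count_nseq/= (negbTE ji).
Qed.

Lemma jet_mderiv n (al : {ffun 'I_n -> nat}) (f : 'rV[R]_n -> C) x :
  cabs (mderiv al f x) <= jet (mlength al) f x.
Proof.
rewrite mderivE; apply: le_trans (jet_foldr _ _ _) _; rewrite size_flatten /shape.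
rewrite -map_comp sumnE big_map big_enum/= /mlength.
by under eq_bigr do rewrite /= size_nseq.
Qed.

(* Coordinatewise mean value inequality: only points whose coordinates lie
   between those of [x] and [y] matter. *)
Definition between n (x y z : 'rV[R]_n) := forall i : 'I_n,
  (x ord0 i <= z ord0 i <= y ord0 i) || (y ord0 i <= z ord0 i <= x ord0 i).

Lemma lipschitz_real n (f : 'rV[R]_n -> R) (df : 'I_n -> 'rV[R]_n -> R) x y B :
  (forall i z, rder f i z (df i z)) ->
  (forall i z, between x y z -> `|df i z| <= B) ->
  `|f y - f x| <= B * \sum_(i < n) `|y ord0 i - x ord0 i|.
Proof.
move=> hf hB.
(* A path from x to y that replaces one coordinate at a time: [H k] has the first k coordinates of
   y. *)
pose H k : 'rV[R]_n := \row_i (if (i < k)%N then y ord0 i else x ord0 i).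
have H0 : H 0%N = x by apply/rowP => i; rewrite mxE.
have Hn : H n = y by apply/rowP => i; rewrite mxE ltn_ord.
rewrite -{1}Hn -{1}H0 -(@telescope_sumr _ 0 n (fun k => f (H k)))// big_mkord.
apply: le_trans (ler_norm_sum _ _ _) _; rewrite mulr_sumr; apply: ler_sum => i _.
have HS : H i.+1 = H i + (y ord0 i - x ord0 i) *: e_ i.
  apply/rowP => j; rewrite !mxE eqxx/= ltnS leq_eqVlt.
  case: (eqVneq j i) => [->|ji]; first by rewrite eqxx/= ltnn mulr1 addrC subrK.
  by rewrite mulr0 addr0 -val_eqE in ji *; rewrite (negbTE ji).
have [t ht] := MVT_line (H i) (y ord0 i - x ord0 i) (hf i); rewrite -HS => ->.
rewrite normrM mulrC ler_wpM2r//; apply: hB => j; rewrite !mxE eqxx/=.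
case: (eqVneq j i) => [->|ji]; last first.
  by rewrite mulr0 addr0; case: ifP; rewrite !lexx ?orbT//= => _;
    case: (leP (x ord0 j) (y ord0 j)) => // /ltW ->.
by rewrite ltnn mulr1; case/orP: ht => /andP[h1 h2]; apply/orP; [left|right]; lra.
Qed.

Lemma lipschitz n (f : 'rV[R]_n -> C) x y B : smooth f ->
  (forall i z, between x y z -> cabs (pderiv i f z) <= B) ->
  cabs (f y - f x) <= 2 * (B * \sum_(i < n) `|y ord0 i - x ord0 i|).
Proof.
move=> sf hB; apply: le_trans (cabs_le_ReIm _) _; rewrite mulr_natl mulr2n.
rewrite ReD ImD ReN ImN; apply: lerD.
  apply: (@lipschitz_real _ (fun y => complex.Re (f y)) (fun i z => complex.Re (pderiv i f z))).
    by move=> i z; have [] := smooth_cder i z sf.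
  by move=> i z bz; exact: le_trans (cabs_Re _) (hB i z bz).
apply: (@lipschitz_real _ (fun y => complex.Im (f y)) (fun i z => complex.Im (pderiv i f z))).
  by move=> i z; have [] := smooth_cder i z sf.
by move=> i z bz; exact: le_trans (cabs_Im _) (hB i z bz).
Qed.

Lemma jap_between n (x y z : 'rV[R]_n) : between x y z ->
  japanese z <= japanese x * japanese y.
Proof.
move=> b; apply: jap_le_sqr; first by rewrite mulr_ge0 ?jap_ge0.
rewrite exprMn !jap_sqr; have h : dot z z <= dot x x + dot y y.
  rewrite /dot -big_split/=; apply: ler_sum => i _; move: (b i).
  move: (x ord0 i) (y ord0 i) (z ord0 i) => p q r hr.
    have sq (a c : R) : 0 <= a -> a <= c -> a * a <= c * c by move=> a0 ac; exact: ler_pM.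
    have p0 := sqr_ge0 p; have q0 := sqr_ge0 q; rewrite !expr2 in p0 q0.
    have [r0|r0] := leP 0 r; case/orP: hr => /andP[h1 h2].
    - by have := sq _ _ r0 h2; lra.
    - by have := sq _ _ r0 h2; lra.
    - by have := sq (- r) (- p); rewrite !mulrNN; lra.
    - by have := sq (- r) (- q); rewrite !mulrNN; lra.
have := mulr_ge0 (dot_ge0 x) (dot_ge0 y); nra.
Qed.

Lemma between_row_mx m n (x y : 'rV[R]_m) (v w : 'rV[R]_n) z :
  between (row_mx x v) (row_mx y w) z ->
  exists a b, [/\ z = row_mx a b, between x y a & between v w b].
Proof.
move=> h; exists (lsubmx z), (rsubmx z); split.
- by rewrite hsubmxK.
- by move=> i; have := h (lshift n i); rewrite !row_mxEl mxE.
- by move=> i; have := h (rshift m i); rewrite !row_mxEr mxE.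
Qed.

Lemma between_refl n (x z : 'rV[R]_n) : between x x z -> z = x.
Proof.
move=> h; apply/rowP => i; apply/eqP; rewrite eq_le.
by have := h i; rewrite orbb andbC.
Qed.

End jets.

(** * Differentiation under the integral *)

Section parametric_integral.
Variable R : realType.
Local Notation C := R[i].
Local Notation e_ i := (delta_mx ord0 i).

Lemma le_of_eq (x y : R) : x = y -> x <= y.
Proof. by move=> ->. Qed.

Lemma continuous_jap n : continuous (@japanese R n).
Proof.
have -> : @japanese R n = (fun x => Num.sqrt (1 + \sum_(i < n) x ord0 i * x ord0 i)).
  by apply/funext => x; rewrite /japanese euclid_sqr.
apply: cont_compR; first exact: sqrt_continuous.
apply: contD; first exact: cont_cst.
by apply: cont_sum => i; apply: contM; exact: coord_continuous.
Qed.

Lemma contX (T : topologicalType) (f : T -> R) k : continuous f -> continuous (fun x => f x ^+ k).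
Proof.
move=> cf; elim: k => [|k IH].
  by under eq_fun do rewrite expr0; exact: cont_cst.
by under eq_fun do rewrite exprS; exact: contM.
Qed.

Lemma ccont_of_bound n (f : 'rV[R]_n -> C) (h : 'rV[R]_n -> 'rV[R]_n -> R) :
  (forall y, continuous (h y)) -> (forall y, h y y = 0) ->
  (forall y y', cabs (f y' - f y) <= h y y') -> ccont f.
Proof.
move=> ch h0 fh.
have main (g : 'rV[R]_n -> R) : (forall y y', `|g y' - g y| <= h y y') -> continuous g.
  move=> gh y; apply/(@cvgrPdist_lt R R^o _ (nbhs (y : 'rV[R]_n)) _) => e e0.
  have /cvgrPdist_lt /(_ _ e0) := ch y y; rewrite h0; apply: filterS => y'.
  rewrite sub0r normrN distrC => hy; apply: le_lt_trans (gh y y') _.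
  exact: le_lt_trans (ler_norm _) hy.
split; apply: main => y y'.
  by rewrite -ReN -ReD; exact: le_trans (cabs_Re _) (fh y y').
by rewrite -ImN -ImD; exact: le_trans (cabs_Im _) (fh y y').
Qed.

Variables n p : nat.
Implicit Types (c : 'rV[R]_p -> C) (F : 'rV[R]_(n + p) -> C).

Definition param_integral c F (y : 'rV[R]_n) : C := cintegral (fun w => c w * F (row_mx y w)).

(** The majorant is integrable in w and locally uniform in y, and the condition passes to
    derivatives of F, so differentiation under the integral can be iterated. *)
Definition dominable c F := [/\ cmeas c, smooth F & forall k, exists K M,
  forall y w, cabs (c w) * jet k F (row_mx y w) <=
              K * japanese y ^+ M * japanese w ^- (2 * p)].

Lemma coordmap_mxl (w : 'rV[R]_p) :
  coordmap (fun y : 'rV[R]_n => row_mx y w) (fun=> 1) (fun i => lshift p i).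
Proof.
move=> y t i; rewrite mulr1; apply/rowP => j.
case: (split_ordP j) => k ->; rewrite [RHS]mxE ?row_mxEl ?row_mxEr !mxE.
  by rewrite eq_lshift.
by rewrite eq_rlshift andbF mulr0 addr0.
Qed.

Lemma dominable_pderiv c F i : dominable c F -> dominable c (pderiv i F).
Proof.
move=> [mc sF h]; split; [exact: mc|exact: smooth_pderiv|].
move=> k; have [K [M H]] := h k.+1; exists K, M => y w.
apply: le_trans (H y w); rewrite ler_wpM2l ?cabs_ge0//; exact: jet_pderiv.
Qed.

Lemma dominable_ge0 (K : R) M N : (forall (y : 'rV[R]_n) (w : 'rV[R]_p), 0 <= K * japanese y ^+ M * japanese w ^- N) ->
  0 <= K.
Proof. by move=> /(_ 0 0); rewrite !jap0 !expr1n invr1 !mulr1. Qed.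

Lemma param_integral_cmeas c F y : dominable c F -> cmeas (fun w => c w * F (row_mx y w)).
Proof.
move=> [mc sF h]; apply: cmeasM => //; apply: cmeas_mxr; exact: smooth_meas.
Qed.

Lemma param_integral_cL1 c F y : dominable c F -> cL1 (fun w => c w * F (row_mx y w)).
Proof.
move=> dF; have mm := param_integral_cmeas y dF; have [mc sF h] := dF.
have [K [M H]] := h 0%N.
apply: (cL1_le mm (L1Zl (K * japanese y ^+ M) (L1_jap R (leqnn _)))) => w.
by rewrite cabsM; exact: H.
Qed.

(** The mean value inequality in y, with its derivative bound integrated over w, gives a local
    Lipschitz estimate. *)
Lemma param_integral_ccont c F : dominable c F -> ccont (param_integral c F).
Proof.
move=> dF; have [mc sF h] := dF; have [K [M H]] := h 1%N.
have K0 : 0 <= K.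
  apply: (@dominable_ge0 K M (2 * p)) => y w; apply: le_trans (H y w).
  by rewrite mulr_ge0 ?cabs_ge0 ?jet_ge0.
pose A := rint (fun w : 'rV[R]_p => japanese w ^- (2 * p)).
apply: (@ccont_of_bound _ _ (fun y y' => (2 * (2 * K * A)) *
  ((japanese y * japanese y') ^+ M * \sum_(i < n) `|y' ord0 i - y ord0 i|))).
- move=> y; apply: contM; first exact: cont_cst.
  apply: contM; first by apply: contX; apply: contM; [exact: cont_cst|exact: continuous_jap].
  apply: cont_sum => i.
  have cn : continuous (fun x : R => `|x|) by exact: norm_continuous.
  apply: cont_compR; first exact: cn.
  by apply: contB; [exact: coord_continuous|exact: cont_cst].
- by move=> y; rewrite big1 ?mulr0// => i _; rewrite subrr normr0.
move=> y y'.
set S := \sum_(i < n) _.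
have S0 : 0 <= S by exact: sumr_ge0.
set J := (_ * _) ^+ M; have J0 : 0 <= J by rewrite exprn_ge0// mulr_ge0 ?jap_ge0.
have -> : param_integral c F y' - param_integral c F y =
    cintegral (fun w => c w * F (row_mx y' w) + (-1) * (c w * F (row_mx y w))).
  rewrite cintegralD; [|exact: param_integral_cL1|apply: cL1Zl; exact: param_integral_cL1].
  by rewrite cintegralZl ?mulN1r//; exact: param_integral_cL1.
have Ig : L1 (fun w : 'rV[R]_p => (2 * K * J * S) * japanese w ^- (2 * p)).
  by apply: L1Zl; exact: L1_jap.
apply: le_trans (cintegral_norm_le Ig _) _; last first.
  by rewrite rintZl ?L1_jap// -/A; apply: le_of_eq; ring.
move=> w; rewrite mulN1r.
pose G z := c w * F z.
have sG : smooth G by apply: smooth_mul; [exact: smooth_cst|exact: sF].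
have E := @lipschitz R _ G (row_mx y w) (row_mx y' w) (K * J * japanese w ^- (2 * p)) sG.
apply: le_trans (E _) _; last first.
  rewrite big_split_ord/= [X in _ * (_ * (_ + X))]big1 ?addr0; last first.
    by move=> i _; rewrite !row_mxEr subrr normr0.
  rewrite (_ : \sum_(i < n) _ = S); first by apply: le_of_eq; ring.
  by apply: eq_bigr => i _; rewrite !row_mxEl.
move=> i z /between_row_mx[a [b [-> hab /between_refl ->]]].
rewrite /G pderiv_cmul// cabsM.
apply: (@le_trans _ _ (K * japanese a ^+ M * japanese w ^- (2 * p))).
  apply: le_trans (H a w); rewrite ler_wpM2l ?cabs_ge0//.
  apply: le_trans (jet_pderiv 0 F i _); exact: cabs_le_jet.
rewrite ler_wpM2r ?japV_ge0// ler_wpM2l//; apply: lerXn2r.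
- by rewrite nnegrE jap_ge0.
- by rewrite nnegrE mulr_ge0 ?jap_ge0.
- exact: jap_between.
Qed.

Lemma under_rint (f df : R -> 'rV[R]_p -> R) (g : 'rV[R]_p -> R) :
  (forall t, mfun_row (f t)) -> L1 g ->
  (forall t w, -1 < t < 1 -> `|f t w| <= g w) ->
  (forall t w, is_derive (t : R) (1 : R) (fun s => f s w) (df t w)) ->
  (forall t w, -1 < t < 1 -> `|df t w| <= g w) ->
  is_derive (0 : R) (1 : R) (fun t => rint (f t)) (rint (df 0)).
Proof.
move=> mf Ig fg hd dg.
have I0 : (`]-1, 1[%classic : set R) 0 by rewrite /= in_itv/=; lra.
have intf : forall x, (`]-1, 1[%classic : set R) x ->
    (RL R p).-integrable setT (EFin \o f x).
  move=> x; rewrite /= in_itv/= => hx; apply: (L1_le (mf x) Ig) => w; exact: fg.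
have dE x w : partial1of2 f x w = df x w.
  by rewrite partial1of2E; have [_ ->] := hd x w.
have Gge0 w : 0 <= g w by apply: le_trans (normr_ge0 _) (fg 0 w _); lra.
have Gub : forall x y, (`]-1, 1[%classic : set R) x -> [set: 'rV[R]_p] y ->
    `|partial1of2 f x y| <= g y.
  by move=> x y; rewrite /= in_itv/= => hx _; rewrite dE; exact: dg.
have derf : forall x y, (`]-1, 1[%classic : set R) x -> [set: 'rV[R]_p] y ->
   derivable (f^~ y) x 1 by move=> x y _ _; have [] := hd x y.
have D := @derivable_under_integral R _ _ (RL R p) f setT measurableT 0 (-1) 1 I0 intf derf g Gge0 Ig Gub.
have E := @differentiation_under_integral R _ _ (RL R p) f setT measurableT 0 (-1) 1 I0 intf derf g Gge0 Ig Gub.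
apply: (DeriveDef (D : derivable (fun t => rint (f t)) 0 1)).
rewrite -derive1E [LHS]E; congr rint; apply/funext => w; exact: dE.
Qed.

Lemma param_integral_cder c F i y : dominable c F ->
  cder (param_integral c F) i y (param_integral c (pderiv (lshift p i) F) y).
Proof.
move=> dF; have [mc sF h] := dF; have [K [M H]] := h 1%N.
have K0 : 0 <= K.
  apply: (@dominable_ge0 K M (2 * p)) => y' w; apply: le_trans (H y' w).
  by rewrite mulr_ge0 ?cabs_ge0 ?jet_ge0.
(* <y + t e_i> <= 2 <y> <t e_i> and <t e_i> <= 2 for |t| < 1, which yields one majorant for all
   these t. *)
pose B := K * (2 * (japanese y * 2)) ^+ M.
have Ig : L1 (fun w : 'rV[R]_p => B * japanese w ^- (2 * p)).
  by apply: L1Zl; exact: L1_jap.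
have jB (t : R) : -1 < t < 1 -> japanese (y + t *: e_ i) <= 2 * (japanese y * 2).
  move=> ht; apply: le_trans (japD _ _) _; rewrite ler_wpM2l// ler_wpM2l ?jap_ge0//.
  apply: jap_le_sqr => //; rewrite dotZl dotZr dot_delta mxE !eqxx/=.
  have /andP[t1 t2] := ht; nra.
have HB (w : 'rV[R]_p) (t : R) : -1 < t < 1 -> K * japanese (y + t *: e_ i) ^+ M * japanese w ^- (2 * p)
    <= B * japanese w ^- (2 * p).
  move=> ht; rewrite ler_wpM2r ?japV_ge0// ler_wpM2l//; apply: lerXn2r.
  - by rewrite nnegrE jap_ge0.
  - by rewrite nnegrE !mulr_ge0 ?jap_ge0.
  - exact: jB.
pose G (t : R) w := c w * F (row_mx (y + t *: e_ i) w).
pose dG (t : R) w := c w * pderiv (lshift p i) F (row_mx (y + t *: e_ i) w).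
have bG (t : R) w : -1 < t < 1 -> cabs (G t w) <= B * japanese w ^- (2 * p).
  move=> ht.
  apply: le_trans _ (HB w t ht); apply: le_trans _ (H _ _); rewrite cabsM.
  by rewrite ler_wpM2l ?cabs_ge0//; exact: cabs_le_jet.
have bdG (t : R) w : -1 < t < 1 -> cabs (dG t w) <= B * japanese w ^- (2 * p).
  move=> ht; apply: le_trans _ (HB w t ht); apply: le_trans _ (H _ _); rewrite cabsM.
  rewrite ler_wpM2l ?cabs_ge0//; apply: le_trans (jet_pderiv 0 F _ _); exact: cabs_le_jet.
have mG t : cmeas (G t) by exact: param_integral_cmeas.
have dGG w t : cder (fun y => c w * F (row_mx y w)) i (y + t *: e_ i) (dG t w).
  have sF' : cder (fun y => F (row_mx y w)) i (y + t *: e_ i)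
      (1 * pderiv (lshift p i) F (row_mx (y + t *: e_ i) w)).
    exact: (cder_comp (coordmap_mxl w) (smooth_cder _ _ sF)).
  by have := cder_mul (cder_cst (c w) i (y + t *: e_ i)) sF'; rewrite mul0r add0r mul1r.
have y0 : y + 0 *: e_ i = y by rewrite scale0r addr0.
split; apply/rder_line0.
  have := @under_rint (fun t w => complex.Re (G t w)) (fun t w => complex.Re (dG t w))
    (fun w => B * japanese w ^- (2 * p)) (fun t => (mG t).1) Ig
    (fun t w ht => le_trans (cabs_Re _) (bG t w ht))
    (fun t w => (rder_line (fun y' => complex.Re (c w * F (row_mx y' w))) i y t _).1 (dGG w t).1)
    (fun t w ht => le_trans (cabs_Re _) (bdG t w ht)).
  by rewrite /dG y0.
have := @under_rint (fun t w => complex.Im (G t w)) (fun t w => complex.Im (dG t w))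
  (fun w => B * japanese w ^- (2 * p)) (fun t => (mG t).2) Ig
  (fun t w ht => le_trans (cabs_Im _) (bG t w ht))
  (fun t w => (rder_line (fun y' => complex.Im (c w * F (row_mx y' w))) i y t _).1 (dGG w t).2)
  (fun t w ht => le_trans (cabs_Im _) (bdG t w ht)).
by rewrite /dG y0.
Qed.

Lemma param_integral_smooth c F : dominable c F -> smooth (param_integral c F).
Proof.
move=> dF; apply/smoothP => k; elim: k F dF => [|k IH] F dF; first exact: param_integral_ccont.
apply: (CkS (g := fun i => param_integral c (pderiv (lshift p i) F))).
- exact: param_integral_ccont.
- by move=> i x; exact: param_integral_cder.
- by move=> i; apply: IH; exact: dominable_pderiv.
Qed.

Lemma pderiv_param_integral c F i : dominable c F ->
  pderiv i (param_integral c F) = param_integral c (pderiv (lshift p i) F).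
Proof. by move=> dF; apply: pderivE => x; exact: param_integral_cder. Qed.

Lemma L1_jet_param_integral c F k y : dominable c F ->
  L1 (fun w => cabs (c w) * jet k F (row_mx y w)).
Proof.
move=> [mc sF h]; have [K [M H]] := h k.
apply: (@L1_le R p _ (fun w => K * japanese y ^+ M * japanese w ^- (2 * p))).
- apply: mfunM; first exact: mfun_cabs.
  by apply: mfun_row_mxr; exact: mfun_jet.
- by apply: L1Zl; exact: L1_jap.
- by move=> w; rewrite ger0_norm ?mulr_ge0 ?cabs_ge0 ?jet_ge0.
Qed.

Lemma rint_sum q (I : Type) (r : seq I) (f : I -> 'rV[R]_q -> R) : (forall i, L1 (f i)) ->
  L1 (fun x => \sum_(i <- r) f i x) /\
  rint (fun x => \sum_(i <- r) f i x) = \sum_(i <- r) rint (f i).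
Proof.
move=> If; elim: r => [|i r [IH1 IH2]].
  have -> : (fun x : 'rV[R]_q => \sum_(i <- [::]) f i x) = (fun=> 0).
    by apply/funext => x; rewrite big_nil.
  by rewrite big_nil; split; [exact: integrable0|rewrite /rint /Rintegral integral0].
have -> : (fun x => \sum_(j <- i :: r) f j x) = (fun x => f i x + \sum_(j <- r) f j x).
  by apply/funext => x; rewrite big_cons.
by rewrite big_cons -IH2; split; [exact: L1D|exact: rintD].
Qed.

Lemma jet_param_integral c F k y : dominable c F ->
  jet k (param_integral c F) y <= 2 * rint (fun w => cabs (c w) * jet k F (row_mx y w)).
Proof.
elim: k F => [|k IH] F dF.
  apply: cintegral_norm_le; first exact: (L1_jet_param_integral 0 y dF).
  by move=> w; rewrite cabsM.
have dFi i := @dominable_pderiv c F i dF.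
have Ii i := L1_jet_param_integral k y (dFi i).
have [S1 S2] := rint_sum (index_enum 'I_n) (fun i => Ii (lshift p i)).
apply: (@le_trans _ _ (2 * rint (fun w => cabs (c w) * jet k F (row_mx y w) +
    \sum_(i < n) cabs (c w) * jet k (pderiv (lshift p i) F) (row_mx y w)))).
  rewrite rintD//; last exact: (L1_jet_param_integral k y dF).
  rewrite S2 mulrDr /=; apply: lerD; first exact: IH.
  rewrite mulr_sumr; apply: ler_sum => i _; rewrite (pderiv_param_integral i dF).
  exact: IH.
rewrite ler_wpM2l//; apply: rint_le.
- exact: L1_jet_param_integral.
- move=> w; rewrite addr_ge0 ?mulr_ge0 ?cabs_ge0 ?jet_ge0//.
  by apply: sumr_ge0 => i _; rewrite mulr_ge0 ?cabs_ge0 ?jet_ge0.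
- move=> w; rewrite -mulr_sumr -mulrDr ler_wpM2l ?cabs_ge0//= lerD2l.
  by rewrite big_split_ord/= lerDl sumr_ge0// => i _; exact: jet_ge0.
Qed.

End parametric_integral.

(** * Symbol classes and decay of the Fourier transform *)

Section symbol_classes.
Variable R : realType.
Local Notation C := R[i].
Local Notation e_ i := (delta_mx ord0 i).

Definition realC n (q : 'rV[R]_n -> R) : 'rV[R]_n -> C := fun x => (q x)%:C%C.

Section closure.
Variable n : nat.
Implicit Types f g : 'rV[R]_n -> C.

Definition polyjet f := smooth f /\ forall k, exists K M, forall x,
  jet k f x <= K * japanese x ^+ M.

Definition rapid f := smooth f /\ forall k N, exists K, forall x,
  jet k f x <= K * japanese x ^- N.

(** Enough decay for all derivatives to be integrable, hence for repeated integration by parts in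
    the Fourier integral. It is the form in which the phase-space function of the Weyl estimates is
    fed to [fourier_decay]. *)
Definition sdecay f := smooth f /\ forall k, exists K, forall x,
  jet k f x <= K * japanese x ^- (2 * n).

Lemma coef_ge0 (K r t : R) : 0 < t -> 0 <= r -> r <= K * t -> 0 <= K.
Proof. by move=> t0 r0 h; rewrite -(pmulr_lge0 _ t0) (le_trans r0 h). Qed.

Lemma bound_ge0 f k K (g : 'rV[R]_n -> R) : (forall x, 0 < g x) ->
  (forall x, jet k f x <= K * g x) -> 0 <= K.
Proof. by move=> g0 h; apply: (coef_ge0 (g0 0) (jet_ge0 k f 0)); exact: h. Qed.

Lemma polyjet_bound f k : polyjet f -> exists K M, 0 <= K /\ forall x,
  jet k f x <= K * japanese x ^+ M.
Proof.
move=> [_ /(_ k)[K [M h]]]; exists K, M; split => //.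
by apply: (bound_ge0 (g := fun x => japanese x ^+ M)) h => x; exact: japX_gt0.
Qed.

Lemma japV_gt0 m (x : 'rV[R]_m) N : 0 < japanese x ^- N.
Proof. by rewrite invr_gt0 japX_gt0. Qed.

Lemma rapid_bound f k N : rapid f -> exists K, 0 <= K /\ forall x,
  jet k f x <= K * japanese x ^- N.
Proof.
move=> [_ /(_ k N)[K h]]; exists K; split => //.
by apply: (bound_ge0 (g := fun x => japanese x ^- N)) h => x; exact: japV_gt0.
Qed.

Lemma rapid_sdecay f : rapid f -> sdecay f.
Proof. by move=> [sf h]; split => [|k]; [exact: sf|exact: h]. Qed.

Lemma rapid_polyjet f : rapid f -> polyjet f.
Proof.
move=> [sf h]; split => [|k]; first exact: sf.
by have [K H] := h k 0%N; exists K, 0%N => x; have := H x; rewrite !expr0 invr1.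
Qed.

Lemma polyjet_cst (c : C) : polyjet (fun=> c).
Proof.
split=> [|k]; first exact: smooth_cst.
by exists (cabs c), 0%N => x; rewrite jet_cst mulr1.
Qed.

Lemma polyjet_add f g : polyjet f -> polyjet g -> polyjet (fun x => f x + g x).
Proof.
move=> pf pg; split=> [|k]; first by apply: smooth_add; [exact: pf.1|exact: pg.1].
have [K [M [K0 H]]] := polyjet_bound k pf; have [K' [M' [K0' H']]] := polyjet_bound k pg.
exists (K + K'), (M + M')%N => x; apply: le_trans (jet_add k x pf.1 pg.1) _.
rewrite mulrDl; apply: lerD.
  by apply: le_trans (H x) _; rewrite ler_wpM2l// japX_le// leq_addr.
by apply: le_trans (H' x) _; rewrite ler_wpM2l// japX_le// leq_addl.
Qed.

Lemma polyjet_mul f g : polyjet f -> polyjet g -> polyjet (fun x => f x * g x).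
Proof.
move=> pf pg; split=> [|k]; first by apply: smooth_mul; [exact: pf.1|exact: pg.1].
have [K [M [K0 H]]] := polyjet_bound k pf; have [K' [M' [K0' H']]] := polyjet_bound k pg.
exists (K * K'), (M + M')%N => x; apply: le_trans (jet_mul k x pf.1 pg.1) _.
by rewrite exprD mulrACA; apply: ler_pM; rewrite ?jet_ge0.
Qed.

Lemma polyjet_conj f : polyjet f -> polyjet (fun x => conjc (f x)).
Proof.
move=> pf; split=> [|k]; first by apply: smooth_conj; exact: pf.1.
have [K [M [K0 H]]] := polyjet_bound k pf; exists K, M => x.
by rewrite jet_conj//; exact: pf.1.
Qed.

Lemma polyjet_sum (I : Type) (r : seq I) (f : I -> 'rV[R]_n -> C) :
  (forall i, polyjet (f i)) -> polyjet (fun x => \sum_(i <- r) f i x).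
Proof.
move=> pf; elim: r => [|i r IH].
  have -> : (fun x => \sum_(i <- [::]) f i x) = (fun=> 0)
    by apply/funext => x; rewrite big_nil.
  exact: polyjet_cst.
have -> : (fun x => \sum_(j <- i :: r) f j x) = (fun x => f i x + \sum_(j <- r) f j x)
  by apply/funext => x; rewrite big_cons.
exact: polyjet_add.
Qed.

Lemma rapid_mul f g : rapid f -> polyjet g -> rapid (fun x => f x * g x).
Proof.
move=> rf pg; split=> [|k N]; first by apply: smooth_mul; [exact: rf.1|exact: pg.1].
have [K' [M' [K0' H']]] := polyjet_bound k pg.
have [K [K0 H]] := rapid_bound k (N + M') rf.
exists (K * K') => x; apply: le_trans (jet_mul k x rf.1 pg.1) _.
have -> : K * K' * japanese x ^- N = (K * japanese x ^- (N + M')) * (K' * japanese x ^+ M').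
  by rewrite mulrACA exprD invfM divfK// gt_eqF// japX_gt0.
by apply: ler_pM; rewrite ?jet_ge0.
Qed.

Lemma rapid_mulr f g : polyjet f -> rapid g -> rapid (fun x => f x * g x).
Proof. by move=> pf rg; under eq_fun do rewrite mulrC; exact: rapid_mul. Qed.

Lemma rapid_conj f : rapid f -> rapid (fun x => conjc (f x)).
Proof.
move=> rf; split=> [|k N]; first by apply: smooth_conj; exact: rf.1.
have [K [K0 H]] := rapid_bound k N rf; exists K => x.
by rewrite jet_conj//; exact: rf.1.
Qed.

Lemma rapid_pderiv f i : rapid f -> rapid (pderiv i f).
Proof.
move=> [sf h]; split=> [|k N]; first exact: smooth_pderiv.
have [K H] := h k.+1 N; exists K => x; apply: le_trans (H x); exact: jet_pderiv.
Qed.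

Lemma sdecay_pderiv f i : sdecay f -> sdecay (pderiv i f).
Proof.
move=> [sf h]; split=> [|k]; first exact: smooth_pderiv.
have [K H] := h k.+1; exists K => x; apply: le_trans (H x); exact: jet_pderiv.
Qed.

Lemma jet_bound f (g : 'rV[R]_n -> R) : (forall x, 0 <= g x) ->
  (forall s, exists K, forall x, cabs (foldr (@pderiv R n) f s x) <= K * g x) ->
  forall k, exists K, forall x, jet k f x <= K * g x.
Proof.
move=> g0 h k; elim: k f h => [|k IH] f h; first exact: (h [::]).
have [K H] := IH f h.
have : forall i, exists Ki, forall x, jet k (pderiv i f) x <= Ki * g x.
  by move=> i; apply: IH => s; have := h (rcons s i); rewrite foldr_rcons.
move=> /choice[Ki Hi]; exists (K + \sum_(i < n) Ki i) => x.
by rewrite mulrDl mulr_suml /=; apply: lerD => //; apply: ler_sum => i _; exact: Hi.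
Qed.

Lemma rapidP f : schwartz f <-> rapid f.
Proof.
split=> [[sf h]|[sf h]]; split; try exact: sf.
  move=> k N; apply: jet_bound => [x|s]; first exact: japV_ge0.
  have [K H] := h N (index_of s); exists K => x.
  rewrite -(mderiv_index s sf) ler_pdivlMr ?japX_gt0// mulrC; exact: H.
move=> k al; have [K H] := h (mlength al) k; exists K => x.
rewrite mulrC -ler_pdivlMr ?japX_gt0//; apply: le_trans (H x); exact: jet_mderiv.
Qed.

Lemma rapid_cL1 f : rapid f -> cL1 f.
Proof.
move=> rf; have [K [_ H]] := rapid_bound 0 (2 * n) rf.
apply: (cL1_le (smooth_meas rf.1) (L1Zl K (L1_jap R (leqnn _)))); exact: H.
Qed.

End closure.

Lemma rder_chain n (h : R -> R) (q : 'rV[R]_n -> R) i x a d :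
  is_derive (q x : R) (1 : R) h a -> rder q i x d -> rder (fun y => h (q y)) i x (a * d).
Proof.
move=> hh /rder_line0 hq; apply/rder_line0.
have hh' : is_derive (q (x + 0 *: e_ i)) (1 : R) h a by rewrite scale0r addr0.
exact: (@is_derive1_comp R h (fun t => q (x + t *: e_ i)) 0 a d hh' hq).
Qed.

Lemma rder_realC n (q : 'rV[R]_n -> R) i x : smooth (realC q) ->
  exists2 d, pderiv i (realC q) x = d%:C%C & rder q i x d.
Proof.
move=> sq; have [h1 h2] := smooth_cder i x sq.
exists (complex.Re (pderiv i (realC q) x)) => //.
apply: complexP => //=; apply: rder_uniq h2 _.
exact: is_derive_cst.
Qed.

Lemma cis_cder n (q : 'rV[R]_n -> R) i x : smooth (realC q) ->
  cder (fun y => cis (q y)) i x (('i%C * pderiv i (realC q) x) * cis (q x)).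
Proof.
move=> sq; have [d E hd] := rder_realC i x sq; rewrite E; split.
  rewrite ReM [complex.Re ('i%C * _)]ReM ImM /=.
  have := rder_chain (is_derive_cos (q x)) hd.
  by congr is_derive; rewrite /=; ring.
rewrite ImM [complex.Re ('i%C * _)]ReM ImM /=.
have := rder_chain (is_derive_sin (q x)) hd.
by congr is_derive; rewrite /=; ring.
Qed.

Lemma expR_cder n (q : 'rV[R]_n -> R) i x : smooth (realC q) ->
  cder (realC (fun y => expR (q y))) i x (pderiv i (realC q) x * realC (fun y => expR (q y)) x).
Proof.
move=> sq; have [d E hd] := rder_realC i x sq; rewrite E; split.
  rewrite ReM /=; have := rder_chain (is_derive_expR (q x)) hd.
  by congr is_derive; rewrite /=; ring.
rewrite ImM /= mulr0 mul0r addr0; exact: is_derive_cst.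
Qed.

Lemma realC_cont n (q : 'rV[R]_n -> R) : smooth (realC q) -> continuous q.
Proof. by move=> /smooth_cont []. Qed.

Lemma cis_ccont n (q : 'rV[R]_n -> R) : continuous q -> ccont (fun y => cis (q y)).
Proof.
by move=> cq; split; apply: cont_compR => //; [exact: continuous_cos|exact: continuous_sin].
Qed.

Lemma smooth_iq n (q : 'rV[R]_n -> R) i : smooth (realC q) ->
  smooth (fun x => 'i%C * pderiv i (realC q) x).
Proof.
by move=> sq; apply: smooth_mul; [exact: smooth_cst|exact: smooth_pderiv].
Qed.

Lemma smooth_cis n (q : 'rV[R]_n -> R) : smooth (realC q) -> smooth (fun y => cis (q y)).
Proof.
move=> sq; apply: smooth_logder (fun i x => cis_cder i x sq) (fun i => smooth_iq i sq).
apply: cis_ccont; exact: realC_cont.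
Qed.

Lemma jet_cis n (q : 'rV[R]_n -> R) k x : smooth (realC q) ->
  jet k (fun y => cis (q y)) x <= (1 + \sum_(i < n) jet k (pderiv i (realC q)) x) ^+ k.
Proof.
move=> sq; apply: le_trans (jet_logder k x _ (fun i x => cis_cder i x sq) (fun i => smooth_iq i sq)) _.
  by apply: cis_ccont; exact: realC_cont.
rewrite cabs_cis mul1r; apply: lerXn2r; rewrite ?nnegrE ?addr_ge0//.
- by apply: sumr_ge0 => i _; exact: jet_ge0.
- by apply: sumr_ge0 => i _; exact: jet_ge0.
- rewrite lerD2l; apply: ler_sum => i _.
  rewrite jet_cmul; last exact: smooth_pderiv.
  by rewrite cabs_i mul1r.
Qed.

Lemma smooth_expR n (q : 'rV[R]_n -> R) : smooth (realC q) ->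
  smooth (realC (fun y => expR (q y))).
Proof.
move=> sq; apply: smooth_logder (fun i x => expR_cder i x sq) (fun i => smooth_pderiv i sq).
split; last by apply: cont_cst.
apply: cont_compR; [exact: continuous_expR|exact: realC_cont].
Qed.

Lemma jet_expR n (q : 'rV[R]_n -> R) k x : smooth (realC q) ->
  jet k (realC (fun y => expR (q y))) x <=
  expR (q x) * (1 + \sum_(i < n) jet k (pderiv i (realC q)) x) ^+ k.
Proof.
move=> sq; apply: le_trans (jet_logder k x _ (fun i x => expR_cder i x sq) (fun i => smooth_pderiv i sq)) _.
  by have := smooth_cont (smooth_expR sq).
by rewrite cabs_real ger0_norm ?expR_ge0.
Qed.

Lemma polyjet_jetq n (q : 'rV[R]_n -> R) k : polyjet (realC q) ->
  exists K M, 0 <= K /\ forall x,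
    (1 + \sum_(i < n) jet k (pderiv i (realC q)) x) ^+ k <= K * japanese x ^+ M.
Proof.
move=> pq; have [K [M [K0 H]]] := polyjet_bound k.+1 pq.
exists ((1 + K) ^+ k), (M * k)%N; split; first by rewrite exprn_ge0// addr_ge0.
move=> x; rewrite exprM -exprMn; apply: lerXn2r; rewrite ?nnegrE.
- by rewrite addr_ge0// sumr_ge0// => i _; exact: jet_ge0.
- by rewrite mulr_ge0 ?japX_ge0// addr_ge0.
rewrite mulrDl mul1r; apply: lerD; first exact: japX_ge1.
apply: le_trans (H x); by rewrite /= lerDr jet_ge0.
Qed.

Lemma polyjet_cis n (q : 'rV[R]_n -> R) : polyjet (realC q) -> polyjet (fun y => cis (q y)).
Proof.
move=> pq; split=> [|k]; first by apply: smooth_cis; exact: pq.1.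
have [K [M [K0 H]]] := polyjet_jetq k pq; exists K, M => x.
by apply: le_trans (H x); apply: jet_cis; exact: pq.1.
Qed.

Definition coordC n (i : 'I_n) : 'rV[R]_n -> C := realC (fun x => x ord0 i).

Lemma coord_cder n (i j : 'I_n) x : cder (coordC i) j x ((i == j)%:R).
Proof.
split; last first.
  have -> : complex.Im ((i == j)%:R : C) = 0 by case: (i == j).
  exact: is_derive_cst.
have -> : complex.Re ((i == j)%:R : C) = (i == j)%:R by case: (i == j).
apply/rder_line0 => /=.
have -> : (fun t : R => (x + t *: e_ j : 'rV[R]_n) ord0 i) = (fun t => x ord0 i + t * (i == j)%:R).
  by apply/funext => t; rewrite !mxE eqxx.
have h := @is_deriveM _ _ id (cst ((i == j)%:R : R)) (0 : R) (1 : R) _ _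
    (is_derive_id _ _) (is_derive_cst _ _ _).
apply: is_derive_ext (is_deriveD (is_derive_cst (x ord0 i) _ _) h) _ _ => //.
by rewrite /GRing.scale/= mulr0 !add0r mulr1.
Qed.

Lemma smooth_coord n (i : 'I_n) : smooth (coordC i).
Proof.
apply/smoothP => k; have cc : ccont (coordC i).
  split; [exact: coord_continuous|exact: cont_cst].
case: k => [//|k]; apply: (CkS (g := fun j _ => (i == j)%:R)) => // [j x|j].
  exact: coord_cder.
exact: Ck_cst.
Qed.

Lemma pderiv_coord n (i j : 'I_n) : pderiv j (coordC i) = (fun=> (i == j)%:R).
Proof. by apply: pderivE => x; exact: coord_cder. Qed.

Lemma jet_coord n (i : 'I_n) k x : jet k (coordC i) x <= k.+1%:R * japanese x.
Proof.
elim: k => [|k IH].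
  by rewrite mul1r /= expr0n/= addr0 sqrtr_sqr; exact: coord_le_jap.
rewrite /= -natr1 mulrDl mul1r; apply: lerD => //.
apply: le_trans (jap_ge1 x); rewrite (bigD1 i)//= pderiv_coord jet_cst eqxx cabs1.
rewrite big1 ?addr0// => j ji.
by rewrite pderiv_coord jet_cst eq_sym (negbTE ji) cabs0.
Qed.

Lemma polyjet_coord n (i : 'I_n) : polyjet (coordC i).
Proof.
split=> [|k]; first exact: smooth_coord.
by exists k.+1%:R, 1%N => x; rewrite expr1; exact: jet_coord.
Qed.

(** With [a] and [b] selecting two blocks of z this is a phase such as x . xi as a function of the
    whole row; with both the identity it is |z|^2. *)
Definition bilinear n d (a b : 'I_d -> 'I_n) (z : 'rV[R]_n) : R :=
  \sum_(i < d) z ord0 (a i) * z ord0 (b i).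

Lemma polyjet_bilinear n d (a b : 'I_d -> 'I_n) : polyjet (realC (bilinear a b)).
Proof.
have -> : realC (bilinear a b) = (fun z => \sum_(i < d) coordC (a i) z * coordC (b i) z).
  apply/funext => z; rewrite /realC /bilinear rmorph_sum; apply: eq_bigr => i _.
  by rewrite rmorphM.
by apply: polyjet_sum => i; apply: polyjet_mul; exact: polyjet_coord.
Qed.

Lemma realC_dotE n (eta : 'rV[R]_n) c :
  realC (fun x => c * dot x eta) = (fun x => \sum_(i < n) (c * eta ord0 i)%:C%C * coordC i x).
Proof.
apply/funext => x; rewrite /realC /dot mulr_sumr rmorph_sum; apply: eq_bigr => i _.
transitivity ((c * eta ord0 i * x ord0 i)%:C%C); first by congr (_%:C%C); ring.
exact: rmorphM.
Qed.

Lemma smooth_dot n (eta : 'rV[R]_n) c : smooth (realC (fun x => c * dot x eta)).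
Proof.
rewrite realC_dotE; apply: smooth_sum => i.
by apply: smooth_mul; [exact: smooth_cst|exact: smooth_coord].
Qed.

Lemma pderiv_dot n (eta : 'rV[R]_n) c i :
  pderiv i (realC (fun x => c * dot x eta)) = (fun=> (c * eta ord0 i)%:C%C).
Proof.
apply/funext => x; have [d E hd] := rder_realC i x (smooth_dot eta c).
rewrite E; congr (_%:C%C); apply: rder_uniq hd _; apply/rder_line0.
have -> : (fun t => c * dot (x + t *: e_ i) eta) = (fun t => c * dot x eta + t * (c * eta ord0 i)).
  by apply/funext => t; rewrite dotDl dotZl [dot (e_ i) _]dotC dot_delta; ring.
have h := @is_deriveM _ _ id (cst (c * eta ord0 i : R)) (0 : R) (1 : R) _ _
    (is_derive_id _ _) (is_derive_cst _ _ _).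
apply: is_derive_ext (is_deriveD (is_derive_cst (c * dot x eta) _ _) h) _ _ => //.
by rewrite /GRing.scale/= mulr0 !add0r mulr1.
Qed.

Definition fourier n (F : 'rV[R]_n -> C) (eta : 'rV[R]_n) : C :=
  cintegral (fun x => cis (- dot x eta) * F x).

Lemma cis_dotE n (eta : 'rV[R]_n) :
  (fun x => cis (- dot x eta)) = (fun x => cis (-1 * dot x eta)).
Proof. by apply/funext => x; rewrite mulN1r. Qed.

Lemma smooth_cisdot n (eta : 'rV[R]_n) : smooth (fun x => cis (- dot x eta)).
Proof. by rewrite cis_dotE; apply: smooth_cis; exact: smooth_dot. Qed.

Lemma jet_cisdot n (eta : 'rV[R]_n) k x :
  jet k (fun x => cis (- dot x eta)) x <= (1 + \sum_(i < n) `|eta ord0 i|) ^+ k.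
Proof.
rewrite cis_dotE; apply: le_trans (jet_cis k x (smooth_dot eta (-1))) _.
apply: le_of_eq; congr ((1 + _) ^+ _); apply: eq_bigr => i _.
by rewrite pderiv_dot jet_cst cabs_real mulN1r normrN.
Qed.

Lemma polyjet_cisdot n (eta : 'rV[R]_n) : polyjet (fun x => cis (- dot x eta)).
Proof.
split=> [|k]; first exact: smooth_cisdot.
by eexists _, 0%N => x; rewrite mulr1; exact: jet_cisdot.
Qed.

Lemma cis_dot_cder n (eta : 'rV[R]_n) i x :
  pderiv i (fun x => cis (- dot x eta)) x = - 'i%C * (eta ord0 i)%:C%C * cis (- dot x eta).
Proof.
rewrite cis_dotE (cder_pderiv (cis_cder i x (smooth_dot eta (-1)))) pderiv_dot.
rewrite !mulN1r; have -> : (- eta ord0 i)%:C%C = - (eta ord0 i)%:C%C :> C.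
  by apply: complexP => //=; rewrite oppr0.
by rewrite mulrN [in RHS]mulNr.
Qed.

Lemma sdecay_L1 n k (F : 'rV[R]_n -> C) : sdecay F -> L1 (jet k F).
Proof.
move=> [sF h]; have [K H] := h k.
apply: (L1_le (mfun_jet k sF) (L1Zl K (L1_jap R (leqnn (2 * n))))) => x.
by rewrite ger0_norm ?jet_ge0.
Qed.

Lemma sdecay_cL1 n (F : 'rV[R]_n -> C) : sdecay F -> cL1 F.
Proof.
move=> dF; have I := sdecay_L1 0 dF.
by apply: (cL1_le (smooth_meas dF.1) I) => x.
Qed.

Lemma sdecay_cisdot n (eta : 'rV[R]_n) F : sdecay F ->
  sdecay (fun x => cis (- dot x eta) * F x).
Proof.
move=> [sF h]; split=> [|k]; first by apply: smooth_mul; [exact: smooth_cisdot|exact: sF].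
have [K H] := h k; exists ((1 + \sum_(i < n) `|eta ord0 i|) ^+ k * K) => x.
apply: le_trans (jet_mul k x (smooth_cisdot eta) sF) _; rewrite -mulrA.
by apply: ler_pM; rewrite ?jet_ge0// jet_cisdot.
Qed.

Definition shear n (i : 'I_n) (z : 'rV[R]_(1 + n)) : 'rV[R]_n :=
  rsubmx z + (z ord0 (lshift n ord0)) *: e_ i.

Lemma coordmap_shear n (i : 'I_n) : coordmap (shear i) (fun=> 1)
  (fun k => match fintype.split k with inl _ => i | inr j => j end).
Proof.
move=> z t k; rewrite mulr1 /shear; case: (split_ordP k) => j ->; apply/rowP => l.
  rewrite [j]ord1 !mxE !eqxx/=.
  by rewrite mulr0 addr0 mulr1 mulrDl addrA.
rewrite !mxE !eqxx/=.
by rewrite mulr0 addr0 addrAC.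
Qed.

(* By translation invariance [t |-> int F (x + t e_i)] is constant; differentiate it. *)
Lemma cintegral_pderiv n (F : 'rV[R]_n -> C) i : sdecay F -> cintegral (pderiv i F) = 0.
Proof.
move=> dF; have [sF h] := dF.
pose G (z : 'rV[R]_(1 + n)) := F (shear i z).
have GE t (x : 'rV[R]_n) : G (row_mx t x) = F (x + t ord0 ord0 *: e_ i).
  by rewrite /G /shear row_mxKr row_mxEl.
have dG : dominable (fun=> 1) G.
  split; first exact: cmeas_cst.
    exact: (smooth_comp (coordmap_shear i)).
  move=> k; have [K H] := h k.
  have K0 : 0 <= K by apply: (bound_ge0 (g := fun x => japanese x ^- (2 * n))) H => x; exact: japV_gt0.
  exists ((1 + \sum_(j < 1 + n) `|1 : R|) ^+ k * (K * 2 ^+ (2 * n))), (2 * n)%N => t x.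
  rewrite cabs1 mul1r; apply: le_trans (jet_comp k _ (coordmap_shear i) sF) _.
  rewrite -2!mulrA ler_wpM2l ?exprn_ge0 ?addr_ge0 ?sumr_ge0//.
  apply: le_trans (H _) _; rewrite -mulrA ler_wpM2l//.
  rewrite /shear row_mxKr row_mxEl; apply: le_trans (japDV _ _ _) _.
  rewrite ler_wpM2l ?exprn_ge0// mulrC ler_wpM2r ?japV_ge0//.
  apply: lerXn2r; rewrite ?nnegrE ?jap_ge0//.
  apply: jap_le_sqr; first exact: jap_ge0.
  rewrite jap_sqr lerD2l dotZl dotZr dot_delta mxE !eqxx mulr1 /dot big_ord_recl big_ord0 addr0.
  by [].
have E : param_integral (fun=> 1) G = (fun=> cintegral F).
  apply/funext => t; rewrite /param_integral -(cintegral_shift (t ord0 ord0 *: e_ i) (sdecay_cL1 dF)).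
  by congr cintegral; apply/funext => x; rewrite mul1r GE.
have := pderiv_param_integral ord0 dG; rewrite E pderiv_cst => /(congr1 (fun g => g 0)).
rewrite /param_integral (pderiv_comp _ (coordmap_shear i) sF) (unsplitK (inl _ : 'I_1 + 'I_n)%type) => E'.
rewrite [RHS]E'; congr cintegral; apply/funext => x.
by rewrite !mul1r /shear row_mxKr row_mxEl mxE scale0r addr0.
Qed.

Lemma fourier_pderiv n (F : 'rV[R]_n -> C) i (eta : 'rV[R]_n) : sdecay F ->
  fourier (pderiv i F) eta = 'i%C * (eta ord0 i)%:C%C * fourier F eta.
Proof.
move=> dF; have d1 := sdecay_cisdot eta dF; have d2 := sdecay_cisdot eta (sdecay_pderiv i dF).
have := cintegral_pderiv i d1.
rewrite (pderiv_mul i (smooth_cisdot eta) dF.1).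
have -> : (fun x => pderiv i (fun y => cis (- dot y eta)) x * F x + cis (- dot x eta) * pderiv i F x) =
   (fun x => (- 'i%C * (eta ord0 i)%:C%C) * (cis (- dot x eta) * F x) + cis (- dot x eta) * pderiv i F x).
  by apply/funext => x; rewrite cis_dot_cder mulrA.
rewrite cintegralD; [|by apply: cL1Zl; exact: sdecay_cL1|exact: sdecay_cL1].
rewrite cintegralZl; last exact: sdecay_cL1.
move=> /eqP; rewrite addrC addr_eq0 => /eqP E; rewrite /fourier E.
by rewrite !mulNr opprK.
Qed.

Lemma cabs_fourier_pderiv n (F : 'rV[R]_n -> C) i (eta : 'rV[R]_n) : sdecay F ->
  cabs (fourier (pderiv i F) eta) = `|eta ord0 i| * cabs (fourier F eta).
Proof. by move=> dF; rewrite fourier_pderiv// !cabsM cabs_i mul1r cabs_real. Qed.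

(** The recursion of [jet] mirrors that of (1 + sum |eta_i|)^k: each factor |eta_i| is traded for
    one derivative by [fourier_pderiv]. *)
Lemma fourier_decay_sum n k (F : 'rV[R]_n -> C) (eta : 'rV[R]_n) : sdecay F ->
  (1 + \sum_(i < n) `|eta ord0 i|) ^+ k * cabs (fourier F eta) <= 2 * rint (jet k F).
Proof.
elim: k F => [|k IH] F dF.
  rewrite mul1r; apply: cintegral_norm_le; first exact: sdecay_L1.
  by move=> x; rewrite cabsM cabs_cis mul1r.
have [S1 S2] := rint_sum (index_enum 'I_n) (fun i => sdecay_L1 k (sdecay_pderiv i dF)).
rewrite [rint _](_ : _ = rint (fun x => jet k F x + \sum_(i < n) jet k (pderiv i F) x))//.
rewrite rintD//; last exact: sdecay_L1.
rewrite S2 exprSr -mulrA mulrDl mul1r !mulrDr; apply: lerD; first exact: IH.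
rewrite mulr_suml !mulr_sumr; apply: ler_sum => i _.
by rewrite -cabs_fourier_pderiv//; apply: IH; exact: sdecay_pderiv.
Qed.

Lemma fourier_decay n k (F : 'rV[R]_n -> C) (eta : 'rV[R]_n) g : sdecay F -> L1 g ->
  (forall x, jet k F x <= g x) -> cabs (fourier F eta) <= 2 * rint g * japanese eta ^- k.
Proof.
move=> dF Ig Fg; rewrite ler_pdivlMr ?japX_gt0// mulrC.
apply: le_trans (_ : (1 + \sum_(i < n) `|eta ord0 i|) ^+ k * cabs (fourier F eta) <= _).
  rewrite ler_wpM2r ?cabs_ge0//; apply: lerXn2r; rewrite ?nnegrE ?jap_ge0//.
    by rewrite addr_ge0// sumr_ge0.
  exact: jap_le_sum.
apply: le_trans (fourier_decay_sum k eta dF) _; rewrite ler_wpM2l//.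
by apply: rint_le => // x; exact: jet_ge0.
Qed.

End symbol_classes.

(** * Fourier inversion *)

Section fourier_inversion.
Variable R : realType.
Local Notation C := R[i].
Local Notation e_ i := (delta_mx ord0 i).

Lemma cmeas_comp m n (f : 'rV[R]_n -> C) (A : 'rV[R]_m -> 'rV[R]_n) :
  measurable_fun setT A -> cmeas f -> cmeas (fun x => f (A x)).
Proof. by move=> mA [m1 m2]; split; [exact: measurableT_comp m1 mA|exact: measurableT_comp m2 mA]. Qed.

Lemma measurable_lsubmx m n : measurable_fun setT (fun z : 'rV[R]_(m + n) => lsubmx z).
Proof.
by apply: measurable_fun_row => i; under eq_fun do rewrite mxE; exact: measurable_row_coor.
Qed.

Lemma measurable_rsubmx m n : measurable_fun setT (fun z : 'rV[R]_(m + n) => rsubmx z).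
Proof.
by apply: measurable_fun_row => i; under eq_fun do rewrite mxE; exact: measurable_row_coor.
Qed.

Lemma cmeas_lsub m n (f : 'rV[R]_m -> C) : cmeas f -> cmeas (fun z : 'rV[R]_(m + n) => f (lsubmx z)).
Proof. by apply: cmeas_comp; exact: measurable_lsubmx. Qed.

Lemma cmeas_rsub m n (f : 'rV[R]_n -> C) : cmeas f -> cmeas (fun z : 'rV[R]_(m + n) => f (rsubmx z)).
Proof. by apply: cmeas_comp; exact: measurable_rsubmx. Qed.

Lemma mfun_dot m n (A B : 'rV[R]_m -> 'rV[R]_n) :
  (forall i, mfun_row (fun z => A z ord0 i)) -> (forall i, mfun_row (fun z => B z ord0 i)) ->
  mfun_row (fun z => dot (A z) (B z)).
Proof. by move=> mA mB; apply: mfun_sum => i; apply: mfunM. Qed.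

Lemma mfun_lcoord m n i : mfun_row (fun z : 'rV[R]_(m + n) => (lsubmx z) ord0 i).
Proof. by under eq_fun do rewrite mxE; exact: measurable_row_coor. Qed.

Lemma mfun_rcoord m n i : mfun_row (fun z : 'rV[R]_(m + n) => (rsubmx z) ord0 i).
Proof. by under eq_fun do rewrite mxE; exact: measurable_row_coor. Qed.

Lemma rint_gt0 n (f : 'rV[R]_n -> R) x0 : L1 f -> continuous f -> (forall x, 0 <= f x) ->
  0 < f x0 -> 0 < rint f.
Proof.
move=> If cf f0 fx0.
have f20 : 0 < f x0 / 2 by rewrite divr_gt0.
have /cvgrPdist_lt /(_ _ f20) /nbhs_ballP[e e0' H] := cf x0.
have e0 : 0 < e by exact: e0'.
pose B := box (fun i => `[x0 ord0 i - e / 2, x0 ord0 i + e / 2]%classic : set (measurableTypeR R)).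
have mB : measurable B by apply: measurable_box => i; exact: measurable_itv.
have BE : RL R n B = (e ^+ n)%:E.
  rewrite [LHS]row_lebesgue_box; last by move=> i; exact: measurable_itv.
  rewrite (eq_bigr (fun=> e%:E)); last first.
    move=> i _; rewrite lebesgue_measure_itv/= lte_fin ifT; last by lra.
    by rewrite -EFinD; congr EFin; lra.
  by rewrite prodEFin prodr_const card_ord.
rewrite -lte_fin L1_ge0_intE//.
apply: (@lt_le_trans _ _ (\int[RL R n]_(x in B) (f x0 / 2)%:E)%E).
  by rewrite integral_cst//= BE -EFinM lte_fin mulr_gt0// exprn_gt0.
rewrite integral_mkcond; apply: ge0_le_integral_nomeas => x _.
  by rewrite patchE; case: ifP => // _; rewrite lee_fin ltW.
rewrite patchE; case: ifPn => [/set_mem Bx|_]; last by rewrite lee_fin.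
rewrite lee_fin; have : `|f x0 - f x| < f x0 / 2.
  apply: H; split => // u v; rewrite [u]ord1 /ball/= ltr_distl.
  by have := Bx v; rewrite /= in_itv/= => /andP[]; lra.
by rewrite ltr_distl => /andP[]; lra.
Qed.

Definition gauss n (x : 'rV[R]_n) : R := expR (- (dot x x / 2)).

Definition gaussq n (x : 'rV[R]_n) : R := - (dot x x / 2).

Lemma polyjet_gaussq n : polyjet (realC (@gaussq n)).
Proof.
have -> : realC (@gaussq n) = (fun x => (- 2^-1)%:C%C * realC (bilinear (n := n) (d := n) id id) x).
  apply/funext => x; rewrite /realC /gaussq -rmorphM; congr (_%:C%C).
  by rewrite mulNr mulrC.
by apply: polyjet_mul; [exact: polyjet_cst|exact: polyjet_bilinear].
Qed.

Lemma gauss_jap n (x : 'rV[R]_n) N : exists2 K, 0 <= K & forall x : 'rV[R]_n,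
  gauss x * japanese x ^+ N <= K.
Proof.
pose k := N.+1.
(* With t = <y>^2, exp(t/2) is the k-th power of exp(t/(2k)) >= t/(2k), so t^k exp(-t/2) <= (2k)^k.
   The factor exp(1/2) is the quotient of [gauss y] and exp(-t/2). *)
exists ((2 * k%:R) ^+ k * expR (2^-1)) => [|y]; first by rewrite mulr_ge0 ?expR_ge0 ?exprn_ge0.
have k0 : 0 < 2 * k%:R :> R by rewrite mulr_gt0.
apply: (@le_trans _ _ (gauss y * (japanese y ^+ 2) ^+ k)).
  by rewrite ler_wpM2l ?expR_ge0// -exprM japX_le// mul2n -addnn leqW// leq_addr.
rewrite jap_sqr; set t := 1 + dot y y.
have t0 : 0 <= t by rewrite addr_ge0 ?dot_ge0.
have h : t ^+ k <= (2 * k%:R) ^+ k * expR (t / 2).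
  have -> : expR (t / 2) = expR (t / (2 * k%:R)) ^+ k.
    rewrite -expRM_natl; congr expR; have : (k%:R : R) != 0 by rewrite pnatr_eq0.
    by move: (k%:R : R) => c c0; field.
  rewrite -exprMn; apply: lerXn2r; rewrite ?nnegrE ?mulr_ge0 ?expR_ge0 ?(ltW k0)//.
  rewrite mulrC -ler_pdivrMr//.
  apply: le_trans (expR_ge1Dx _); lra.
have -> : gauss y = expR (2^-1) * expR (- (t / 2)).
  by rewrite -expRD; congr expR; rewrite /t; lra.
apply: le_trans (_ : expR 2^-1 * expR (- (t / 2)) * ((2 * k%:R) ^+ k * expR (t / 2)) <= _).
  by rewrite ler_wpM2l ?mulr_ge0 ?expR_ge0.
apply: le_of_eq; have := expRxMexpNx_1 (t / 2).
move: (expR (t / 2)) (expR (- (t / 2))) (expR 2^-1) ((2 * k%:R) ^+ k) => a b c e ab.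
by transitivity (a * b * (c * e)); [ring|rewrite ab; ring].
Qed.

Lemma rapid_gauss n : rapid (realC (@gauss n)).
Proof.
have pq := @polyjet_gaussq n.
split=> [|k N]; first by apply: (@smooth_expR _ _ (@gaussq n)); exact: pq.1.
have [K [M [K0 H]]] := polyjet_jetq k pq.
have [K' K0' H'] := @gauss_jap n 0 (M + N).
exists (K' * K) => x; rewrite ler_pdivlMr ?japX_gt0//.
apply: le_trans (_ : gauss x * (K * japanese x ^+ M) * japanese x ^+ N <= _).
  rewrite ler_wpM2r ?japX_ge0//; apply: le_trans (jet_expR k x pq.1) _.
  by rewrite ler_wpM2l ?expR_ge0.
have -> : gauss x * (K * japanese x ^+ M) * japanese x ^+ N = gauss x * japanese x ^+ (M + N) * K.
  by rewrite exprD; ring.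
by rewrite ler_wpM2r.
Qed.

Lemma pderiv_gauss n i : pderiv i (realC (@gauss n)) =
  (fun x => - coordC i x * realC (@gauss n) x).
Proof.
apply: pderivE => x; have pq := @polyjet_gaussq n.
have := @expR_cder _ _ (@gaussq n) i x pq.1; congr cder; congr (_ * _).
have [d -> hd] := rder_realC i x pq.1; rewrite /coordC /realC -rmorphN; congr (_%:C%C).
apply: rder_uniq hd _; apply/rder_line0.
have -> : (fun t => gaussq (x + t *: e_ i)) =
  (fun t => - (dot x x / 2) + (t * (- x ord0 i) + (t * t) * (- 2^-1))).
  apply/funext => t; rewrite /gaussq !dotDl !dotDr !dotZl !dotZr [dot (e_ i) x]dotC !dot_delta.
  by rewrite mxE !eqxx mulr1; field.
have h1 := @is_deriveM _ _ id (cst (- x ord0 i : R)) (0 : R) (1 : R) _ _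
    (is_derive_id _ _) (is_derive_cst _ _ _).
have h2 := @is_deriveM _ _ id id (0 : R) (1 : R) _ _ (is_derive_id _ _) (is_derive_id _ _).
have h3 := is_deriveM h2 (is_derive_cst (- 2^-1 : R) (0 : R) (1 : R)).
apply: is_derive_ext (is_deriveD (is_derive_cst (- (dot x x / 2)) _ _) (is_deriveD h1 h3)) _ _ => //.
by rewrite /GRing.scale /cst /= ?(mul0r, mulr0, add0r, addr0, mulr1).
Qed.

Lemma bilinear_row_mx n (eta x : 'rV[R]_n) :
  bilinear (fun i => lshift n i) (fun i => rshift n i) (row_mx eta x) = dot x eta.
Proof. by apply: eq_bigr => i _; rewrite row_mxEl row_mxEr mulrC. Qed.

(** The variable eta is put in the first block, where [param_integral] differentiates; the Fourier
    transform is then an instance of it. *)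
Definition fourier_kernel n (z : 'rV[R]_(n + n)) : C :=
  conjc (cis (bilinear (fun i : 'I_n => lshift n i) (fun i => rshift n i) z)).

Lemma ftkerE n (eta x : 'rV[R]_n) : fourier_kernel (row_mx eta x) = cis (- dot x eta).
Proof. by rewrite /fourier_kernel conj_cis bilinear_row_mx. Qed.

Lemma polyjet_fourier_kernel n : polyjet (@fourier_kernel n).
Proof. by apply: polyjet_conj; apply: polyjet_cis; exact: polyjet_bilinear. Qed.

Lemma dominable_fourier n (F : 'rV[R]_n -> C) : rapid F -> dominable F (@fourier_kernel n).
Proof.
move=> rF; split; [exact: smooth_meas rF.1|exact: (polyjet_fourier_kernel n).1|move=> k].
have [K [M [K0 H]]] := polyjet_bound k (polyjet_fourier_kernel n).
have [K' [K0' H']] := rapid_bound 0 (2 * n + M) rF.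
exists (K' * K), M => eta x.
apply: le_trans (_ : (K' * japanese x ^- (2 * n + M)) * (K * (japanese eta * japanese x) ^+ M) <= _).
  apply: ler_pM; [exact: cabs_ge0|exact: jet_ge0|exact: H'|].
  apply: le_trans (H _) _; rewrite ler_wpM2l//; apply: lerXn2r.
  - by rewrite nnegrE jap_ge0.
  - by rewrite nnegrE mulr_ge0 ?jap_ge0.
  - exact: jap_row_mx.
apply: le_of_eq; rewrite exprD exprMn invfM.
have /gt_eqF xn0 := japX_gt0 x M.
rewrite [LHS](_ : _ = K' * K * japanese eta ^+ M * japanese x ^- (2 * n) *
   (japanese x ^- M * japanese x ^+ M)); last by ring.
by rewrite mulVf ?mulr1// xn0.
Qed.

Lemma fourier_param_integral n (F : 'rV[R]_n -> C) : fourier F = param_integral F (@fourier_kernel n).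
Proof.
by apply/funext => eta; congr cintegral; apply/funext => x; rewrite ftkerE mulrC.
Qed.

Lemma smooth_fourier n (F : 'rV[R]_n -> C) : rapid F -> smooth (fourier F).
Proof. by move=> rF; rewrite fourier_param_integral; apply: param_integral_smooth; exact: dominable_fourier. Qed.

Lemma pderiv_fourier_kernel n i : pderiv (lshift n i) (@fourier_kernel n) =
  (fun z => (- 'i%C * coordC (rshift n i) z) * fourier_kernel z).
Proof.
have pb := @polyjet_bilinear R (n + n) n (fun i => lshift n i) (fun i => rshift n i).
apply/funext => z; rewrite /fourier_kernel (pderiv_conj _ (smooth_cis pb.1)).
rewrite (cder_pderiv (cis_cder _ _ pb.1)) conjcM conjcM; congr (_ * _ * _).
  by apply: complexP => /=; rewrite ?oppr0.
have [d -> hd] := rder_realC (lshift n i) z pb.1.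
rewrite /coordC /realC; apply: complexP => /=; last by rewrite oppr0.
apply: rder_uniq hd _; apply/rder_line0.
have -> : (fun t => bilinear (fun i : 'I_n => lshift n i) (fun i => rshift n i) (z + t *: e_ (lshift n i)))
  = (fun t => bilinear (fun i : 'I_n => lshift n i) (fun i => rshift n i) z + t * z ord0 (rshift n i)).
  apply/funext => t; rewrite /bilinear.
  under eq_bigr => j _.
    rewrite !mxE eqxx/= eq_lshift eq_rlshift mulr0 addr0 mulrDl.
    over.
  rewrite big_split/=; congr (_ + _); rewrite (bigD1 i)//= eqxx mulr1 big1 ?addr0// => j ji.
  by rewrite (negbTE ji) mulr0 mul0r.
have h := @is_deriveM _ _ id (cst (z ord0 (rshift n i) : R)) (0 : R) (1 : R) _ _
    (is_derive_id _ _) (is_derive_cst _ _ _).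
apply: is_derive_ext (is_deriveD (is_derive_cst (bilinear (fun i : 'I_n => lshift n i) (fun i => rshift n i) z) _ _) h) _ _ => //.
by rewrite /GRing.scale/= mulr0 !add0r mulr1.
Qed.

Lemma pderiv_fourier n (F : 'rV[R]_n -> C) i eta : rapid F ->
  pderiv i (fourier F) eta = - 'i%C * fourier (fun x => coordC i x * F x) eta.
Proof.
move=> rF; rewrite fourier_param_integral (pderiv_param_integral i (dominable_fourier rF)) pderiv_fourier_kernel /param_integral /fourier.
rewrite -cintegralZl; last first.
  apply: rapid_cL1; apply: rapid_mulr; first exact: polyjet_cisdot.
  by apply: rapid_mulr => //; exact: polyjet_coord.
congr cintegral; apply/funext => x; rewrite ftkerE /coordC /realC row_mxEr.
ring.
Qed.

(* Equal to (2 pi)^(n/2); only its positivity matters here, so the value is not computed. *)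
Definition gauss_mass n : C := fourier (realC (@gauss n)) 0.

(** The Gaussian and its transform both solve d_i f = - x_i f. Multiplying the transform by [E], the
    reciprocal of the Gaussian, gives a function with zero gradient, hence a constant. *)
Lemma fourier_gauss n eta : fourier (realC (@gauss n)) eta = gauss_mass n * realC (@gauss n) eta.
Proof.
have rg := @rapid_gauss n; have pq := @polyjet_gaussq n.
have dft i x : pderiv i (fourier (realC (@gauss n))) x = - coordC i x * fourier (realC (@gauss n)) x.
  rewrite pderiv_fourier//.
  have -> : (fun x => coordC i x * realC (@gauss n) x) = (fun x => (-1) * pderiv i (realC (@gauss n)) x).
    by apply/funext => y; rewrite pderiv_gauss mulN1r mulNr opprK.
  have -> : fourier (fun x => -1 * pderiv i (realC (@gauss n)) x) x = - fourier (pderiv i (realC (@gauss n))) x.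
    rewrite /fourier -[RHS]mulN1r -cintegralZl; last first.
      by apply: sdecay_cL1; apply: sdecay_cisdot; apply: rapid_sdecay; exact: rapid_pderiv.
    by congr cintegral; apply/funext => y; rewrite mulrCA.
  rewrite (fourier_pderiv _ _ (rapid_sdecay rg)) mulrNN !mulrA.
  have -> : 'i%C * 'i%C = -1 :> C by rewrite -expr2 sqr_i.
  by rewrite mulN1r.
pose E (x : 'rV[R]_n) : R := expR (- gaussq x).
have sq : smooth (realC (fun x => - @gaussq n x)).
  have -> : realC (fun x => - @gaussq n x) = (fun x => (-1) * realC (@gaussq n) x).
    by apply/funext => x; apply: complexP; rewrite ?ReM ?ImM /=; ring.
  by apply: smooth_mul; [exact: smooth_cst|exact: pq.1].
have sE : smooth (realC E) by exact: smooth_expR.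
have dE i x : pderiv i (realC E) x = coordC i x * realC E x.
  have gE : (fun y => realC (@gauss n) y * realC E y) = (fun=> 1).
    apply/funext => y; apply: complexP; rewrite ?ReM ?ImM /=; last by ring.
    by rewrite mulr0 subr0 /gauss /E /gaussq opprK mulrC expRxMexpNx_1.
  have := congr1 (fun f => pderiv i f x) gE; rewrite pderiv_cst (pderiv_mul i rg.1 sE) pderiv_gauss.
  move=> /eqP; rewrite mulNr mulNr addrC subr_eq0 => /eqP E1.
  have gx : realC E x * realC (@gauss n) x = 1 by rewrite mulrC; exact: (congr1 (fun f => f x) gE).
  rewrite -[LHS]mul1r -{1}gx -mulrA E1.
  transitivity (coordC i x * realC E x * (realC E x * realC (@gauss n) x)); first by ring.
  by rewrite gx mulr1.
pose Phi x := fourier (realC (@gauss n)) x * realC E x.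
have sP : smooth Phi by apply: smooth_mul; [exact: smooth_fourier|exact: sE].
have dP i x : pderiv i Phi x = 0.
  by rewrite (pderiv_mul i (smooth_fourier rg) sE) dft dE; ring.
have PE : Phi eta = Phi 0.
  apply/eqP; rewrite -subr_eq0; apply/eqP; apply: cabs_eq0.
  apply/eqP; rewrite eq_le cabs_ge0 andbT.
  have := @lipschitz R n Phi 0 eta 0 sP; rewrite mul0r mulr0; apply => i z _.
  by rewrite dP cabs0.
have E0 : realC E 0 = 1 by rewrite /realC /E /gaussq dot0l mul0r !oppr0 expR0.
have gx : realC E eta * realC (@gauss n) eta = 1.
  apply: complexP; rewrite ?ReM ?ImM /=; last by ring.
  by rewrite mulr0 subr0 /gauss /E /gaussq opprK expRxMexpNx_1.
by rewrite -[LHS]mulr1 -gx mulrA -/(Phi eta) PE /Phi E0 mulr1.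
Qed.

Lemma gauss_mass_gt0 n : exists2 r : R, 0 < r & gauss_mass n = r%:C%C.
Proof.
have rg := @rapid_gauss n; have I := cL1_Re (rapid_cL1 rg).
exists (rint (@gauss n)).
  apply: (rint_gt0 (x0 := 0)) => //.
  - exact: realC_cont rg.1.
  - by move=> x; exact: expR_ge0.
  - exact: expR_gt0.
have E : (fun x => cis (- dot x 0) * realC (@gauss n) x) = realC (@gauss n).
  by apply/funext => x; rewrite dotC dot0l oppr0 cis0 mul1r.
by rewrite /gauss_mass /fourier E; apply: complexP => //=; rewrite /Rintegral integral0.
Qed.

Lemma eps_cvg0 : (k.+1%:R^-1 : R) @[k --> \oo] --> (0 : R).
Proof. exact: cvg_harmonic. Qed.

Section inversion.
Variables (n : nat) (f : 'rV[R]_n -> C) (B : R).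
Hypotheses (cf : ccont f) (If : cL1 f) (fB : forall x, cabs (f x) <= B).
Hypothesis Ift : cL1 (fourier f).
Variable x : 'rV[R]_n.

Let g := realC (@gauss n).
Let eps k : R := k.+1%:R^-1.
Let eps0 k : 0 < eps k. Proof. by rewrite invr_gt0. Qed.

Let L1g (e : R) : 0 < e -> L1 (fun xi : 'rV[R]_n => gauss (e *: xi)).
Proof.
move=> e0; have := L1_affine 0 e0 (cL1_Re (rapid_cL1 (@rapid_gauss n))).
by congr L1; apply/funext => y; rewrite /= addr0.
Qed.

Let F (e : R) (z : 'rV[R]_(n + n)) : C :=
  g (e *: lsubmx z) * cis (dot (x - rsubmx z) (lsubmx z)) * f (rsubmx z).

Let mF e : cmeas (F e).
Proof.
apply: cmeasM; last by apply: cmeas_rsub; exact: ccont_meas.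
apply: cmeasM.
  apply: (@cmeas_lsub n n (fun y => g (e *: y))).
  have := cmeas_affine e 0 (smooth_meas (@rapid_gauss n).1).
  by congr cmeas; apply/funext => y; rewrite addr0.
apply: cmeas_cis; apply: mfun_dot => i; last exact: mfun_lcoord.
under eq_fun do rewrite mxE [X in _ + X]mxE.
by apply: mfunD; [exact: mfun_cst|apply: mfunN; exact: mfun_rcoord].
Qed.

Let FB e xi y : cabs (F e (row_mx xi y)) <= gauss (e *: xi) * cabs (f y).
Proof.
rewrite /F row_mxKl row_mxKr !cabsM cabs_cis mulr1 cabs_real ger0_norm//.
exact: expR_ge0.
Qed.

(** The rescaled Gaussian transforms into one concentrated about x at scale e; the substitution y =
    e t + x removes the powers of e and leaves an average of f near x. *)
Let Ek (e : R) : 0 < e ->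
  cintegral (fun xi => g (e *: xi) * (cis (dot x xi) * fourier f xi)) =
  cintegral (fun t => gauss_mass n * (g t * f (e *: t + x))).
Proof.
move=> e0.
have If' := cL1_cabs If.
have g0 (xi : 'rV[R]_n) : 0 <= gauss (e *: xi) by exact: expR_ge0.
have f0 y : 0 <= cabs (f y) by exact: cabs_ge0.
have F1 := cfubini1 (mF e) (L1g e0) If' g0 f0 (FB e).
have F2 := cfubini2 (mF e) (L1g e0) If' g0 f0 (FB e).
rewrite [LHS](_ : _ = cintegral (F e)); last first.
  rewrite F1; congr cintegral; apply/funext => xi.
  rewrite mulrA /fourier -cintegralZl; last first.
    apply: (@cL1_le _ _ _ (fun y => cabs (f y))) => //.
      apply: cmeasM; last exact: ccont_meas.
      apply: cmeas_cis; apply: mfunN; apply: mfun_dot => i; [exact: mfun_coord|exact: mfun_cst].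
    by move=> y; rewrite cabsM cabs_cis mul1r.
  congr cintegral; apply/funext => y; rewrite /F row_mxKl row_mxKr dotBl cisD.
  by rewrite !mulrA.
rewrite F2.
have inner y : cintegral (fun xi => F e (row_mx xi y)) =
    (e ^- n)%:C%C * (gauss_mass n * (g (e^-1 *: (y - x)) * f y)).
  have -> : (fun xi => F e (row_mx xi y)) =
     (fun xi => (fun t => f y * (cis (- dot t (e^-1 *: (y - x))) * g t)) (e *: xi + 0)).
    apply/funext => xi; rewrite /F row_mxKl row_mxKr addr0.
    have -> : dot (e *: xi) (e^-1 *: (y - x)) = dot xi (y - x).
      by rewrite dotZl dotZr mulrA divff ?gt_eqF// mul1r.
    rewrite -dotNr opprB [dot xi _]dotC; ring.
  have I1 : cL1 (fun t => cis (- dot t (e^-1 *: (y - x))) * g t).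
    by apply: rapid_cL1; apply: rapid_mulr; [exact: polyjet_cisdot|exact: rapid_gauss].
  rewrite (cintegral_affine 0 e0 (cL1Zl (f y) I1)) (cintegralZl _ I1) -/(fourier _ _) fourier_gauss.
  congr (_ * _); rewrite -/g; ring.
rewrite (_ : (fun y => _) = (fun y => (e ^- n)%:C%C * (gauss_mass n * (g (e^-1 *: (y - x)) * f y)))); last first.
  by apply/funext => y; exact: inner.
have I2 : cL1 (fun y => gauss_mass n * (g (e^-1 *: (y - x)) * f y)).
  apply: cL1Zl; apply: (@cL1_le _ _ _ (fun y => cabs (f y))) => //.
    apply: cmeasM; last exact: ccont_meas.
    have := cmeas_affine e^-1 (- (e^-1 *: x)) (smooth_meas (@rapid_gauss n).1).
    by congr cmeas; apply/funext => y; rewrite -scalerBr.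
  move=> y; rewrite cabsM ler_piMl ?cabs_ge0// cabs_real ger0_norm ?expR_ge0//.
  rewrite -expR0 ler_expR oppr_le0 divr_ge0 ?dot_ge0//.
rewrite (cintegralZl _ I2) -(cintegral_affine x e0 I2); congr cintegral; apply/funext => t.
by rewrite addrK scalerA mulVf ?gt_eqF// scale1r.
Qed.

(* Insert the factor [gauss (eps * xi)], apply Fubini and let [eps] tend to 0 on both sides. *)
Theorem fourier_inversion :
  cintegral (fun xi => cis (dot x xi) * fourier f xi) = gauss_mass n * gauss_mass n * f x.
Proof.
have B0 : 0 <= B by apply: le_trans (fB 0); exact: cabs_ge0.
have gm : cmeas g by exact: smooth_meas (@rapid_gauss n).1.
have gle1 (t : 'rV[R]_n) : cabs (g t) <= 1.
  rewrite cabs_real ger0_norm ?expR_ge0// -expR0 ler_expR oppr_le0 divr_ge0 ?dot_ge0//.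
have [m1 m2] := Ift.
have mc : cmeas (fun xi => cis (dot x xi) * fourier f xi).
  apply: cmeasM => //; apply: cmeas_cis; apply: mfun_dot => i; [exact: mfun_cst|exact: mfun_coord].
have lim1 : ccvg (fun k => cintegral (fun xi => g (eps k *: xi) * (cis (dot x xi) * fourier f xi)))
    (cintegral (fun xi => cis (dot x xi) * fourier f xi)).
  apply: (cintegral_dominated (g := fun xi => cabs (fourier f xi))).
  - move=> k; apply: cmeasM => //; have := cmeas_affine (eps k) 0 gm.
    by congr cmeas; apply/funext => y; rewrite addr0.
  - exact: cL1_cabs.
  - move=> xi; rewrite -[X in ccvg _ X]mul1r; apply: ccvgM; last exact: ccvg_cst.
    split; last exact: cvg_cst.
    rewrite /g /realC /= /gauss.
    have -> : (fun k => expR (- (dot (eps k *: xi) (eps k *: xi) / 2))) =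
       (fun k => expR (- (eps k * (eps k * dot xi xi) / 2))).
      by apply/funext => k; rewrite dotZl dotZr.
    have h : - (eps k * (eps k * dot xi xi) / 2) @[k --> \oo] --> - (0 * (0 * dot xi xi) / 2).
      apply: (@cvgN R R^o); apply: cvgM; last exact: cvg_cst.
      apply: cvgM; first exact: eps_cvg0.
      by apply: cvgM; [exact: eps_cvg0|exact: cvg_cst].
    rewrite !mul0r oppr0 in h.
    suff h1 : expR (- (eps k * (eps k * dot xi xi) / 2)) @[k --> \oo] --> (1 : R) by exact: h1.
    rewrite -[X in _ --> X](@expR0 R); exact: (continuous_cvg _ (@continuous_expR R 0) h).
  - move=> k xi; rewrite !cabsM cabs_cis mul1r ler_piMl ?cabs_ge0//; exact: gle1.
have lim2 : ccvg (fun k => cintegral (fun t => gauss_mass n * (g t * f (eps k *: t + x))))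
    (cintegral (fun t => gauss_mass n * (g t * f x))).
  apply: (cintegral_dominated (g := fun t => (cabs (gauss_mass n) * B) * cabs (g t))).
  - move=> k; apply: cmeasM; first exact: cmeas_cst.
    by apply: cmeasM => //; apply: cmeas_affine; exact: ccont_meas.
  - by apply: L1Zl; apply: cL1_cabs; apply: rapid_cL1; exact: rapid_gauss.
  - move=> t; apply: ccvgM; first exact: ccvg_cst.
    apply: ccvgM; first exact: ccvg_cst.
    have h : (eps k *: t + x) @[k --> \oo] --> x.
      rewrite -[X in _ --> X]add0r -[X in X + _](scale0r t); apply: cvgD; last exact: cvg_cst.
      by apply: cvgZr_tmp; exact: eps_cvg0.
    by split; [exact: (continuous_cvg _ (cf.1 x) h)|exact: (continuous_cvg _ (cf.2 x) h)].
  - move=> k t; rewrite !cabsM -mulrA ler_wpM2l ?cabs_ge0// mulrC ler_wpM2r ?cabs_ge0//.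
have E : (fun k => cintegral (fun xi => g (eps k *: xi) * (cis (dot x xi) * fourier f xi))) =
  (fun k => cintegral (fun t => gauss_mass n * (g t * f (eps k *: t + x)))).
  by apply/funext => k; exact: Ek.
rewrite E in lim1; rewrite (ccvg_uniq lim1 lim2).
have rg := rapid_cL1 (@rapid_gauss n).
rewrite (_ : (fun t => _) = (fun t => (gauss_mass n * f x) * g t)); last by apply/funext => t; ring.
rewrite cintegralZl//.
have -> : cintegral g = gauss_mass n.
  rewrite /gauss_mass /fourier; congr cintegral; apply/funext => t.
  by rewrite dotC dot0l oppr0 cis0 mul1r.
by ring.
Qed.

End inversion.

End fourier_inversion.

(** * Short-time Fourier transform *)

Section time_frequency.
Variable R : realType.
Local Notation C := R[i].
Local Notation e_ i := (delta_mx ord0 i).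

Lemma japV_cancel n (x : 'rV[R]_n) M N :
  japanese x ^- (N + M) * japanese x ^+ M = japanese x ^- N.
Proof. by rewrite exprD invfM -mulrA mulVf ?mulr1// gt_eqF// japX_gt0. Qed.

Lemma jap_row_mxX m n (x : 'rV[R]_m) (y : 'rV[R]_n) M :
  japanese (row_mx x y) ^+ M <= japanese x ^+ M * japanese y ^+ M.
Proof.
rewrite -exprMn lerXn2r ?nnegrE ?jap_ge0 ?mulr_ge0 ?jap_ge0//; exact: jap_row_mx.
Qed.

Lemma jap_row_mxV m n (x : 'rV[R]_m) (y : 'rV[R]_n) M :
  japanese x ^- M * japanese y ^- M <= japanese (row_mx x y) ^- M.
Proof. by rewrite -invfM lef_pV2 ?posrE ?mulr_gt0 ?japX_gt0// jap_row_mxX. Qed.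

Lemma jap_lsubmx m n (z : 'rV[R]_(m + n)) : japanese (lsubmx z) <= japanese z.
Proof. by rewrite -{2}[z]hsubmxK jap_row_mxl. Qed.

Lemma jap_rsubmx m n (z : 'rV[R]_(m + n)) : japanese (rsubmx z) <= japanese z.
Proof. by rewrite -{2}[z]hsubmxK jap_row_mxr. Qed.

(* Peetre: decay in [x] and in [x - y] gives decay in [y]. *)
Lemma japV_mul n (x y : 'rV[R]_n) M N :
  japanese x ^- (M + N) * japanese (x - y) ^- N <=
  2 ^+ N * (japanese x ^- M * japanese y ^- N).
Proof.
have h : japanese (x - y) ^- N <= 2 ^+ N * (japanese y ^- N * japanese x ^+ N).
  rewrite jap_distC; apply: le_trans (japDV _ _ _) _; by rewrite japN.
apply: le_trans (ler_wpM2l (japV_ge0 _ _) h) _; apply: le_of_eq.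
by rewrite -[in RHS](japV_cancel x N M); ring.
Qed.

(** [param_integral] differentiates in its first block. The STFT is differentiated in w and the
    synthesis integral in y, so both orders of the blocks occur. *)
Definition swap_mx m n (z : 'rV[R]_(m + n)) : 'rV[R]_(n + m) :=
  row_mx (rsubmx z) (lsubmx z).

Lemma swap_row_mx m n (x : 'rV[R]_m) (y : 'rV[R]_n) : swap_mx (row_mx x y) = row_mx y x.
Proof. by rewrite /swap_mx row_mxKl row_mxKr. Qed.

Lemma coordmap_swap m n : coordmap (@swap_mx m n) (fun=> 1)
  (fun k => match fintype.split k with inl i => rshift n i | inr j => lshift m j end).
Proof.
move=> z t k; rewrite mulr1 /swap_mx; apply/rowP => l.
case: (split_ordP k) => i ->; case: (split_ordP l) => j ->;
  rewrite [RHS]mxE ?row_mxEl ?row_mxEr !mxE ?eqxx/=.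
- by rewrite eq_rlshift eq_lrshift.
- by rewrite eq_lshift eq_rshift.
- by rewrite eq_lshift eq_rshift.
- by rewrite eq_rlshift eq_lrshift.
Qed.

Variable d : nat.
Implicit Types (phi psi : 'rV[R]_d -> C) (w z : 'rV[R]_(d + d)) (x y : 'rV[R]_d).

(* Arguments in the order (w, y): [param_integral] differentiates in the first block. *)
Definition stft_kernel phi (z : 'rV[R]_((d + d) + d)) : C :=
  conjc (cis (bilinear (fun i => rshift (d + d) i) (fun i => lshift d (rshift d i)) z) *
         phi (rsubmx z - lsubmx (lsubmx z))).

Lemma tfjE phi w y : stft_kernel phi (row_mx w y) = conjc (time_freq phi w y).
Proof.
rewrite /stft_kernel /time_freq row_mxKl row_mxKr; congr (conjc (cis _ * _)).
by apply: eq_bigr => i _; rewrite row_mxEr row_mxEl mxE.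
Qed.

Lemma coordmap_stft_kernel : coordmap
  (fun z : 'rV[R]_((d + d) + d) => rsubmx z - lsubmx (lsubmx z))
  (fun k => match fintype.split k with
            | inl i => match fintype.split i with inl _ => -1 | inr _ => 0 end
            | inr _ => 1 end)
  (fun k => match fintype.split k with
            | inl i => match fintype.split i with inl j => j | inr j => j end
            | inr j => j end).
Proof.
move=> z t k; case: (split_ordP k) => i ->.
  case: (split_ordP i) => j ->; apply/rowP => l; rewrite !mxE !eqxx/=.
    by rewrite !eq_lshift eq_rlshift/= mulrN1 mulr0 addr0 opprD mulNr addrA.
  by rewrite eq_rlshift !mulr0 addr0 eq_lshift eq_lrshift/= mulr0 addr0 mul0r addr0.
apply/rowP => l; rewrite !mxE !eqxx/= mulr1 eq_rshift eq_lrshift/= mulr0 addr0.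
by rewrite addrAC.
Qed.

Let phase (z : 'rV[R]_((d + d) + d)) : C :=
  cis (bilinear (fun i => rshift (d + d) i) (fun i => lshift d (rshift d i)) z).

Let polyjet_phase : polyjet phase.
Proof. by apply: polyjet_cis; exact: polyjet_bilinear. Qed.

Lemma smooth_stft_kernel phi : smooth phi -> smooth (stft_kernel phi).
Proof.
move=> sp; apply: smooth_conj; apply: smooth_mul; first exact: polyjet_phase.1.
exact: smooth_comp coordmap_stft_kernel sp.
Qed.

(** Decay of phi (y - x) is turned into decay in y at the cost of powers of <x> <= <w>; the
    additional [M1] powers offset the growth of the phase in y. *)
Lemma stft_kernel_bound phi k N : rapid phi -> exists K M, 0 <= K /\ forall w y,
  jet k (stft_kernel phi) (row_mx w y) <= K * japanese w ^+ M * japanese y ^- N.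
Proof.
move=> rp.
have [K1 [M1 [K10 H1]]] := polyjet_bound k polyjet_phase.
have [K2 [K20 H2]] := rapid_bound k (N + M1) rp.
have sp := rp.1.
pose L : R := (1 + \sum_(i < d + d + d) `|match fintype.split i return R with
            | inl i => match fintype.split i with inl _ => -1 | inr _ => 0 end
            | inr _ => 1 end|) ^+ k.
have L0 : 0 <= L.
  by rewrite exprn_ge0// addr_ge0// sumr_ge0.
exists (K1 * (L * (K2 * 2 ^+ (N + M1)))), (M1 + (N + M1))%N; split.
  by rewrite mulr_ge0// mulr_ge0// mulr_ge0// exprn_ge0.
move=> w y; rewrite /stft_kernel jet_conj; last first.
  apply: smooth_mul; first exact: polyjet_phase.1.
  exact: smooth_comp coordmap_stft_kernel sp.
apply: le_trans (jet_mul _ _ _ _) _.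
- exact: polyjet_phase.1.
- exact: smooth_comp coordmap_stft_kernel sp.
apply: le_trans (_ : (K1 * (japanese w ^+ M1 * japanese y ^+ M1)) *
  (L * (K2 * (2 ^+ (N + M1) * (japanese y ^- (N + M1) * japanese w ^+ (N + M1))))) <= _).
  apply: ler_pM; [exact: jet_ge0|exact: jet_ge0| |].
    by apply: le_trans (H1 _) _; rewrite ler_wpM2l// jap_row_mxX.
  apply: le_trans (jet_comp _ _ coordmap_stft_kernel sp) _.
  apply: ler_wpM2l; first exact: L0.
  apply: le_trans (H2 _) _; rewrite ler_wpM2l//.
  rewrite row_mxKr row_mxKl; apply: le_trans (japDV _ _ _) _.
  rewrite japN ler_wpM2l ?exprn_ge0// ler_wpM2l ?japV_ge0//.
  by rewrite lerXn2r ?nnegrE ?jap_ge0// jap_lsubmx.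
apply: le_of_eq; rewrite -(japV_cancel y M1 N) [japanese w ^+ (M1 + _)]exprD; ring.
Qed.

Lemma rapid_shift phi (a : 'rV[R]_d) : rapid phi -> rapid (fun y => phi (y - a)).
Proof.
move=> rp.
have cm : coordmap (fun y : 'rV[R]_d => y - a) (fun=> 1) id.
  by move=> y t i; rewrite mulr1 addrAC.
split; first exact: smooth_comp cm rp.1.
move=> k N; have [K [K0 H]] := rapid_bound k N rp.
exists ((1 + \sum_(i < d) `|1 : R|) ^+ k * (K * (2 ^+ N * japanese a ^+ N))) => y.
apply: le_trans (jet_comp _ _ cm rp.1) _.
rewrite -mulrA ler_wpM2l ?exprn_ge0// ?addr_ge0 ?sumr_ge0//.
apply: le_trans (H _) _; rewrite -mulrA ler_wpM2l//.
by apply: le_trans (japDV _ _ _) _; rewrite japN; apply: le_of_eq; ring.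
Qed.

Lemma rapid_opp phi : rapid phi -> rapid (fun y => phi (- y)).
Proof.
move=> rp.
have cm : coordmap (fun y : 'rV[R]_d => - y) (fun=> -1) id.
  by move=> y t i; rewrite opprD mulrN1 scaleNr.
split; first exact: smooth_comp cm rp.1.
move=> k N; have [L H] := rp.2 k N.
exists ((1 + \sum_(i < d) `|-1 : R|) ^+ k * L) => y.
apply: le_trans (jet_comp _ _ cm rp.1) _.
rewrite -mulrA ler_wpM2l ?exprn_ge0 ?addr_ge0 ?sumr_ge0//.
by rewrite -(japN y).
Qed.

Lemma cis_dotN_E (xi : 'rV[R]_d) : (fun y => cis (dot y xi)) = (fun y => cis (- dot y (- xi))).
Proof. by apply/funext => y; rewrite dotNr opprK. Qed.

Lemma rapid_time_freq phi z : rapid phi -> rapid (time_freq phi z).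
Proof.
move=> rp; apply: rapid_mulr; last exact: rapid_shift.
rewrite cis_dotN_E; exact: polyjet_cisdot.
Qed.

Definition fun_stft phi (f : 'rV[R]_d -> C) w : C :=
  cintegral (fun y => f y * conjc (time_freq phi w y)).

Lemma fun_stft_stft phi f w : fun_stft phi f w = stft phi (distribution_of f) w.
Proof. by []. Qed.

Lemma fun_stft_param_integral phi f : fun_stft phi f = param_integral f (stft_kernel phi).
Proof. by apply/funext => w; congr cintegral; apply/funext => y; rewrite tfjE. Qed.

Lemma fun_stft_fourier phi f w : fun_stft phi f w =
  fourier (fun y => f y * conjc (phi (y - lsubmx w))) (rsubmx w).
Proof.
congr cintegral; apply/funext => y; rewrite /time_freq conjcM conj_cis; ring.
Qed.

Lemma jet_shift k phi (a x : 'rV[R]_d) : smooth phi ->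
  jet k (fun y => phi (y - a)) x = jet k phi (x - a).
Proof.
elim: k phi => [//|k IH] phi sp /=; congr (_ + _); first exact: IH.
have cm : coordmap (fun y : 'rV[R]_d => y - a) (fun=> 1) id.
  by move=> y t i; rewrite mulr1 addrAC.
apply: eq_bigr => i _; rewrite -IH; last exact: smooth_pderiv.
by rewrite (pderiv_comp i cm sp); congr jet; apply/funext => y; rewrite mul1r.
Qed.

(** Decay in the positions comes from the overlap of the two shifted windows, decay in the
    frequencies from the Fourier transform of their product, taken at the difference of the
    frequencies. *)
Lemma fun_stft_time_freq phi psi N : rapid phi -> rapid psi -> exists K, 0 <= K /\ forall z w,
  cabs (fun_stft phi (time_freq psi z) w) <= K * japanese (z - w) ^- N.
Proof.
move=> rp rq.
have [K1 [K10 H1]] := rapid_bound N (2 * d + N) rq.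
have [K2 [K20 H2]] := rapid_bound N N rp.
exists (2 * (K1 * K2 * 2 ^+ N * rint (fun y : 'rV[R]_d => japanese y ^- (2 * d)))); split.
  by rewrite !mulr_ge0 ?exprn_ge0// rint_ge0// => y; exact: japV_ge0.
move=> z w.
have -> : fun_stft phi (time_freq psi z) w =
   fourier (fun y => psi (y - lsubmx z) * conjc (phi (y - lsubmx w))) (rsubmx w - rsubmx z).
  rewrite fun_stft_fourier; congr cintegral; apply/funext => y; rewrite /time_freq dotBr.
  by rewrite opprB cisD; ring.
have rs := rapid_shift (lsubmx z) rq.
have rt := rapid_conj (rapid_shift (lsubmx w) rp).
pose D := K1 * K2 * 2 ^+ N * japanese (lsubmx z - lsubmx w) ^- N.
have Ig : L1 (fun y : 'rV[R]_d => D * japanese (y - lsubmx z) ^- (2 * d)).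
  by apply: L1Zl; apply: (@L1_shift _ _ (- lsubmx z) (fun y => japanese y ^- (2 * d))); exact: L1_jap.
apply: le_trans (fourier_decay (rsubmx w - rsubmx z) (k := N) _ Ig _) _.
- exact: rapid_sdecay (rapid_mul rs (rapid_polyjet rt)).
- move=> y; apply: le_trans (jet_mul _ _ rs.1 rt.1) _.
  rewrite jet_conj ?jet_shift; [|exact: rp.1|exact: rq.1|exact: (rapid_shift _ rp).1].
  apply: le_trans (_ : (K1 * japanese (y - lsubmx z) ^- (2 * d + N)) * (K2 * japanese (y - lsubmx w) ^- N) <= _).
    by apply: ler_pM; rewrite ?jet_ge0.
  have h := @japV_mul d (y - lsubmx z) (lsubmx w - lsubmx z) (2 * d) N.
  rewrite [X in japanese X ^- N](_ : _ = (y - lsubmx z) - (lsubmx w - lsubmx z)); last first.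
    by rewrite opprB addrA subrK.
  rewrite mulrACA; apply: le_trans (ler_wpM2l _ h) _; first exact: mulr_ge0.
  by rewrite [japanese (lsubmx w - _)]jap_distC; apply: le_of_eq; rewrite /D; ring.
rewrite rintZl; last by apply: (@L1_shift _ _ (- lsubmx z) (fun y => japanese y ^- (2 * d))); exact: L1_jap.
rewrite (@rint_shift _ _ (- lsubmx z) (fun y => japanese y ^- (2 * d))); last exact: L1_jap.
rewrite /D [japanese (rsubmx w - _)]jap_distC.
rewrite -{3}[z]hsubmxK -{3}[w]hsubmxK opp_row_mx add_row_mx.
set r := rint _; have r0 : 0 <= r by apply: rint_ge0 => y; exact: japV_ge0.
rewrite [X in X <= _](_ : _ = 2 * (K1 * K2 * 2 ^+ N * r) *
  (japanese (lsubmx z - lsubmx w) ^- N * japanese (rsubmx z - rsubmx w) ^- N)); last by ring.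
by rewrite ler_wpM2l ?jap_row_mxV// !mulr_ge0 ?exprn_ge0.
Qed.

Lemma dominable_stft_kernel phi f M (K : R) : rapid phi -> cmeas f -> 0 <= K ->
  (forall x, cabs (f x) <= K * japanese x ^+ M) -> dominable f (stft_kernel phi).
Proof.
move=> rp mf K0 Hf; split; [exact: mf|exact: smooth_stft_kernel rp.1|move=> k].
have [K1 [M1 [K10 H]]] := stft_kernel_bound k (2 * d + M) rp.
exists (K * K1), M1 => w y.
apply: le_trans (ler_pM _ _ (Hf y) (H w y)) _; rewrite ?cabs_ge0 ?jet_ge0//.
by rewrite -(japV_cancel y M (2 * d)); apply: le_of_eq; ring.
Qed.

Section stft_inversion.
Variables (phi f : 'rV[R]_d -> C) (K : R) (M : nat) (K' : R).
Hypotheses (rp : rapid phi) (cf : ccont f) (K0 : 0 <= K).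
Hypothesis fK : forall x, cabs (f x) <= K * japanese x ^+ M.
Hypothesis VK : forall w, cabs (fun_stft phi f w) <= K' * japanese w ^- (2 * d + 2 * d).

Let cV : cmeas (fun_stft phi f).
Proof.
rewrite fun_stft_param_integral; apply: smooth_meas; apply: param_integral_smooth.
exact: dominable_stft_kernel rp (ccont_meas cf) K0 fK.
Qed.

Let K'0 : 0 <= K'.
Proof. exact: (coef_ge0 (japV_gt0 0 _) (cabs_ge0 _) (VK 0)). Qed.

Lemma ccont_shift (a : 'rV[R]_d) : ccont (fun y => phi (y - a)).
Proof. exact: smooth_cont (rapid_shift a rp).1. Qed.

(** At fixed position w1 this is Fourier inversion for f times the conjugate of the shifted window;
    the assumed decay of the STFT makes the transform integrable. *)
Let inner x (w1 : 'rV[R]_d) :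
  cintegral (fun w2 : 'rV[R]_d => fun_stft phi f (row_mx w1 w2) * time_freq phi (row_mx w1 w2) x) =
  gauss_mass R d * gauss_mass R d * (f x * (conjc (phi (x - w1)) * phi (x - w1))).
Proof.
pose F y := f y * conjc (phi (y - w1)).
have cF : ccont F by apply: ccont_mul => //; apply: ccont_conj; exact: ccont_shift.
have FE (w2 : 'rV[R]_d) : fun_stft phi f (row_mx w1 w2) = fourier F w2 by rewrite fun_stft_fourier row_mxKl row_mxKr.
have [K1 [K10 H1]] := rapid_bound 0 (2 * d + M) (rapid_shift w1 rp).
have FB y : cabs (F y) <= K * K1 * japanese y ^- (2 * d).
  rewrite /F cabsM cabs_conj.
  apply: le_trans (ler_pM (cabs_ge0 _) (cabs_ge0 _) (fK y) (H1 y)) _.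
  by rewrite -(japV_cancel y M (2 * d)); apply: le_of_eq; ring.
have IF : cL1 F.
  split; first exact: ccont_meas.
  by exists (fun y => K * K1 * japanese y ^- (2 * d)) => //; apply: L1Zl; exact: L1_jap.
have Ift : cL1 (fourier F).
  split.
    have -> : fourier F = (fun w2 : 'rV[R]_d => fun_stft phi f (row_mx w1 w2)) by apply/funext => w2; rewrite FE.
    exact: cmeas_mxr.
  exists (fun w2 : 'rV[R]_d => K' * japanese w2 ^- (2 * d)); first by apply: L1Zl; exact: L1_jap.
  move=> w2; rewrite -FE; apply: le_trans (VK _) _; rewrite ler_wpM2l//.
  apply: le_trans (row_mx_japV _ _ _) _.
  by rewrite ler_piMl ?japV_ge0 ?japV_le1.
have FB' y : cabs (F y) <= K * K1.
  by apply: le_trans (FB y) _; rewrite ler_piMr ?japV_le1 ?mulr_ge0.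
have := fourier_inversion cF IF FB' Ift x; rewrite /F => inv.
transitivity (phi (x - w1) * cintegral (fun xi => cis (dot x xi) * fourier F xi)); last first.
  by rewrite inv; ring.
rewrite -cintegralZl; last first.
  have [m1 [g Ig gB]] := Ift; split.
    apply: cmeasM => //; apply: cmeas_cis; apply: mfun_dot => i; [exact: mfun_cst|exact: mfun_coord].
  by exists g => // xi; rewrite cabsM cabs_cis mul1r.
congr cintegral; apply/funext => w2; rewrite FE /time_freq row_mxKl row_mxKr; ring.
Qed.

(** Integrating [inner] over the position leaves the squared L^2 norm of the window. The function f
    may grow; absolute convergence comes from the exponent 2d + 2d in the decay of its STFT, half
    for each block of w. *)
Lemma stft_inversion x : cintegral (fun w => fun_stft phi f w * time_freq phi w x) =
  gauss_mass R d * gauss_mass R d *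
  cintegral (fun y => conjc (phi (- y)) * phi (- y)) * f x.
Proof.
have [K1 [K10 H1]] := rapid_bound 0 0 rp.
have phB y : cabs (phi y) <= K1 by have := H1 y; rewrite expr0 invr1 mulr1.
have mT : cmeas (fun w => time_freq phi w x).
  have -> : (fun w => time_freq phi w x) = (fun w => conjc (stft_kernel phi (row_mx w x))).
    by apply/funext => w; rewrite tfjE conjcK.
  by apply: cmeas_conj; apply: cmeas_mxl; apply: smooth_meas; exact: smooth_stft_kernel rp.1.
rewrite (@cfubini1 _ _ _ _ (fun w1 : 'rV[R]_d => K' * japanese w1 ^- (2 * d)) (fun w2 : 'rV[R]_d => K1 * japanese w2 ^- (2 * d))).
- under [X in cintegral X]eq_fun do rewrite inner mulrA.
  have sq : cL1 (fun w1 : 'rV[R]_d => conjc (phi (w1)) * phi (w1)).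
    by apply: rapid_cL1; apply: rapid_mul; [exact: rapid_conj|exact: rapid_polyjet].
  pose q (w1 : 'rV[R]_d) := conjc (phi (- w1)) * phi (- w1).
  have rN := rapid_opp rp.
  have Iq : cL1 q by apply: rapid_cL1; apply: rapid_mul; [exact: rapid_conj|exact: rapid_polyjet].
  rewrite cintegralZl; last first.
    have := cL1_shift (- x) Iq; congr cL1; apply/funext => w1; by rewrite /q opprB.
  have -> : (fun w1 : 'rV[R]_d => conjc (phi (x - w1)) * phi (x - w1)) = (fun y => q (y - x)).
    by apply/funext => w1; rewrite /q opprB.
  by rewrite cintegral_shift//; ring.
- exact: cmeasM.
- by apply: L1Zl; exact: L1_jap.
- by apply: L1Zl; exact: L1_jap.
- by move=> w1; rewrite mulr_ge0 ?japV_ge0.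
- by move=> w2; rewrite mulr_ge0 ?japV_ge0.
- move=> w1 w2; rewrite cabsM.
  apply: le_trans (ler_pM (cabs_ge0 _) (cabs_ge0 _) (VK _) (_ : _ <= K1)) _.
    by rewrite /time_freq cabsM cabs_cis mul1r.
  have := row_mx_japV w1 w2 (2 * d) => h.
  apply: le_trans (ler_wpM2r K10 (ler_wpM2l K'0 h)) _; apply: le_of_eq; ring.
Qed.

End stft_inversion.

(** Equal to (2 pi)^d times the squared L^2 norm of [phi]. The argument - y remains from x - w,
    because only a translation is substituted. *)
Definition window_const phi : C := gauss_mass R d * gauss_mass R d *
  cintegral (fun y => conjc (phi (- y)) * phi (- y)).

Lemma window_const_neq0 phi : rapid phi -> (exists x, phi x <> 0) -> window_const phi != 0.
Proof.
move=> rp [x0 px0].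
have [r r0 rE] := gauss_mass_gt0 R d.
have rn : gauss_mass R d != 0 by rewrite rE; apply/eqP => /(congr1 (@complex.Re R)) /= r00; rewrite r00 ltxx in r0.
rewrite mulf_neq0//; first by rewrite mulf_neq0.
apply/eqP => /(congr1 (@complex.Re R)); rewrite /cintegral /= => h.
have rN := rapid_opp rp.
have Iq : cL1 (fun y => conjc (phi (- y)) * phi (- y)).
  by apply: rapid_cL1; apply: rapid_mul; [exact: rapid_conj|exact: rapid_polyjet].
have qE y : complex.Re (conjc (phi (- y)) * phi (- y)) = cabs (phi (- y)) ^+ 2.
  by rewrite mulrC -cabs_sqr.
have : 0 < rint (fun y => complex.Re (conjc (phi (- y)) * phi (- y))).
  apply: (@rint_gt0 _ _ _ (- x0)).
  - exact: cL1_Re.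
  - have c1 := smooth_cont rN.1.
    exact: (ccont_mul (ccont_conj c1) c1).1.
  - by move=> y; rewrite qE sqr_ge0.
  - rewrite qE opprK exprn_gt0// lt_neqAle cabs_ge0 andbT.
    by apply/eqP => /esym /cabs_eq0.
by rewrite /rint h ltxx.
Qed.

End time_frequency.

(** * Tempered distributions and integrals *)

Section weak_integral.
Variable R : realType.
Local Notation C := R[i].
Local Notation e_ i := (delta_mx ord0 i).

Lemma eq0_of_le (x K : R) : (forall N : nat, (0 < N)%N -> `|x| <= K / N%:R) -> x = 0.
Proof.
move=> h; apply/eqP; rewrite -normr_eq0; apply/eqP/le_anti; rewrite normr_ge0 andbT.
rewrite leNgt; apply/negP => x0.
have K0 : 0 <= K by have := h 1%N isT; rewrite divr1; exact: le_trans.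
have /archi_boundP := divr_ge0 K0 (ltW x0); set N := Num.bound _ => hN.
have N0 : (0 : R) < N.+1%:R by rewrite ltr0n.
have := h N.+1 isT; rewrite ler_pdivlMr// leNgt => /negP; apply.
rewrite -ltr_pdivrMl// mulrC; apply: lt_trans hN _; by rewrite ltr_nat.
Qed.

(** [schwartz_norm] is a [sup], which has its meaning only for a nonempty bounded set; the pointwise
    hypothesis supplies the bound [B] for the set and hence for the norm. *)
Lemma tempered_bound n (u : functional R n) : tempered u ->
  exists k K, 0 <= K /\ forall f B, schwartz f ->
    (forall x, japanese x ^+ k * jet k f x <= B) -> cabs (u f) <= K * B.
Proof.
move=> [_ [k [K H]]]; exists k, `|K|; split => // f B sf fB.
apply: le_trans (H f sf) _; apply: le_trans (ler_norm _) _; rewrite normrM ler_wpM2l//.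
rewrite /schwartz_norm; set E := (X in sup X).
have ubE : ubound E B.
  move=> r [al [x [alk ->]]]; apply: le_trans (fB x); rewrite ler_wpM2l ?japX_ge0//.
  by apply: le_trans (jet_mderiv _ _ _) _; exact: jet_le.
pose al0 : {ffun 'I_n -> nat} := [ffun=> 0%N].
have E0 : E (japanese (0 : 'rV[R]_n) ^+ k * cabs (mderiv al0 f 0)).
  exists al0, 0; split => //; rewrite /mlength big1// => i _; by rewrite ffunE.
rewrite ger0_norm; first by apply: ge_sup => //; eexists; exact: E0.
apply: (@le_trans _ _ (japanese (0 : 'rV[R]_n) ^+ k * cabs (mderiv al0 f 0))).
  by rewrite mulr_ge0 ?japX_ge0 ?cabs_ge0.
by apply: ub_le_sup => //; exists B.
Qed.

Lemma schwartz0 n : schwartz (fun _ : 'rV[R]_n => 0 : C).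
Proof.
apply/rapidP; split; first exact: smooth_cst.
by move=> k N; exists 0 => x; rewrite jet_cst cabs0 mul0r.
Qed.

Lemma schwartz_lin n (c : C) (f g : 'rV[R]_n -> C) : schwartz f -> schwartz g ->
  schwartz (fun x => c * f x + g x).
Proof.
move=> /rapidP rf /rapidP rg; apply/rapidP.
have sc : smooth (fun x => c * f x) by apply: smooth_mul rf.1; exact: smooth_cst.
split; first by apply: smooth_add sc rg.1.
move=> k N; have [K1 H1] := rf.2 k N; have [K2 H2] := rg.2 k N.
exists (cabs c * K1 + K2) => x; apply: le_trans (jet_add _ _ sc rg.1) _.
rewrite mulrDl lerD// jet_cmul; last exact: rf.1.
by rewrite -mulrA ler_wpM2l ?cabs_ge0.
Qed.

Lemma foldr_pderiv_lin n (c : C) (f g : 'rV[R]_n -> C) s : smooth f -> smooth g ->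
  foldr (@pderiv R n) (fun x => c * f x + g x) s =
  (fun x => c * foldr (@pderiv R n) f s x + foldr (@pderiv R n) g s x).
Proof.
move=> sf sg; elim: s => [//|i s IH] /=; rewrite IH.
have s1 := smooth_foldr s sf; have s2 := smooth_foldr s sg.
rewrite pderiv_add; [|by apply: smooth_mul s1; exact: smooth_cst|exact: s2].
by rewrite (pderiv_cmul _ _ s1).
Qed.

Lemma foldr_pderivB n (f g : 'rV[R]_n -> C) s : smooth f -> smooth g ->
  foldr (@pderiv R n) (fun x => f x - g x) s =
  (fun x => foldr (@pderiv R n) f s x - foldr (@pderiv R n) g s x).
Proof.
move=> sf sg; have := foldr_pderiv_lin (-1) s sg sf.
rewrite (_ : (fun x => -1 * g x + f x) = (fun x => f x - g x)); last first.
  by apply/funext => x; rewrite mulN1r addrC.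
by move=> ->; apply/funext => x; rewrite mulN1r addrC.
Qed.

Lemma foldr_pderiv_sum n (I : Type) (r : seq I) (a : I -> C) (f : I -> 'rV[R]_n -> C) s :
  (forall i, smooth (f i)) ->
  foldr (@pderiv R n) (fun x => \sum_(i <- r) a i * f i x) s =
  (fun x => \sum_(i <- r) a i * foldr (@pderiv R n) (f i) s x).
Proof.
move=> sf; have sS r' : smooth (fun x => \sum_(i <- r') a i * f i x).
  by apply: smooth_sum => i; apply: smooth_mul (sf i); exact: smooth_cst.
elim: r => [|i r IH].
  have -> : (fun x : 'rV[R]_n => \sum_(i <- [::]) a i * f i x) = (fun=> 0).
    by apply/funext => x; rewrite big_nil.
  have -> : (fun x => \sum_(i <- [::]) a i * foldr (@pderiv R n) (f i) s x) = (fun=> 0).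
    by apply/funext => x; rewrite big_nil.
  by elim: s => [//|j s IH] /=; rewrite IH pderiv_cst.
have -> : (fun x => \sum_(j <- i :: r) a j * f j x) =
    (fun x => a i * f i x + \sum_(j <- r) a j * f j x).
  by apply/funext => x; rewrite big_cons.
rewrite foldr_pderiv_lin ?IH; [|exact: sf|exact: sS].
by apply/funext => x; rewrite big_cons.
Qed.

Lemma cintegralB n (f g : 'rV[R]_n -> C) : cL1 f -> cL1 g ->
  cL1 (fun x => f x - g x) /\ cintegral (fun x => f x - g x) = cintegral f - cintegral g.
Proof.
move=> If Ig; have In := cL1Zl (-1) Ig; have := conj (cL1D If In) (cintegralD If In).
rewrite cintegralZl// mulN1r.
by rewrite (_ : (fun x => f x + -1 * g x) = (fun x => f x - g x))//; apply/funext => x; rewrite mulN1r.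
Qed.

Section tempered_linear.
Variables (n : nat) (u : functional R n).
Hypothesis hu : tempered u.

Lemma tempered0 : u (fun=> 0) = 0.
Proof.
have := hu.1 (-1) _ _ (@schwartz0 n) (@schwartz0 n).
by rewrite mulN1r addNr mulN1r addNr.
Qed.

Lemma temperedB f g : schwartz f -> schwartz g -> u (fun x => f x - g x) = u f - u g.
Proof.
move=> sf sg; have := hu.1 (-1) _ _ sg sf; rewrite mulN1r addrC => <-.
by congr u; apply/funext => x; rewrite mulN1r addrC.
Qed.

Lemma schwartzB (f g : 'rV[R]_n -> C) : schwartz f -> schwartz g -> schwartz (fun x => f x - g x).
Proof.
move=> sf sg; have := schwartz_lin (-1) sg sf; congr schwartz; apply/funext => x.
by rewrite mulN1r addrC.
Qed.

Lemma tempered_sum (I : Type) (r : seq I) (a : I -> C) (f : I -> 'rV[R]_n -> C) :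
  (forall i, schwartz (f i)) ->
  schwartz (fun x => \sum_(i <- r) a i * f i x) /\
  u (fun x => \sum_(i <- r) a i * f i x) = \sum_(i <- r) a i * u (f i).
Proof.
move=> sf; elim: r => [|i r [IH1 IH2]].
  have -> : (fun x : 'rV[R]_n => \sum_(i <- [::]) a i * f i x) = (fun=> 0).
    by apply/funext => x; rewrite big_nil.
  by rewrite big_nil tempered0; split => //; exact: schwartz0.
have -> : (fun x => \sum_(j <- i :: r) a j * f j x) =
    (fun x => a i * f i x + \sum_(j <- r) a j * f j x).
  by apply/funext => x; rewrite big_cons.
split; first exact: schwartz_lin.
by rewrite hu.1// IH2 big_cons.
Qed.

End tempered_linear.

(** * Rounding to a finite grid *)

Section grid.
Variables (p N : nat).
Hypothesis N0 : (0 < N)%N.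

(* The finitely many grid points are j/N - N in each coordinate; points outside [-N, N] are
   clamped, which still moves [w] by at most <w>^2/N. *)
Definition grid_index (t : R) : 'I_(2 * N * N).+1 :=
  inord (minn (Num.truncn ((t + N%:R) * N%:R)) (2 * N * N)).

Definition grid_value (j : 'I_(2 * N * N).+1) : R := j%:R / N%:R - N%:R.

Lemma grid_indexE t : (grid_index t : nat) = minn (Num.truncn ((t + N%:R) * N%:R)) (2 * N * N).
Proof. by rewrite /grid_index inordK// ltnS geq_minr. Qed.

(** [grid_index] is monotone, so its level sets are intervals. *)
Lemma grid_index_measurable j :
  measurable ([set t | grid_index t = j] : set (measurableTypeR R)).
Proof.
apply: is_interval_measurable => x y /= xj yj t /andP[xt ty]; apply/val_inj/eqP.
have mono (a b : R) : a <= b -> (grid_index a <= grid_index b)%N.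
  move=> ab; rewrite !grid_indexE leq_min geq_minr andbT.
  apply: leq_trans (geq_minl _ _) _; apply: le_truncn.
  by rewrite ler_wpM2r ?lerD2r.
by rewrite eqn_leq -{1}yj -{1}xj !mono.
Qed.

(** Inside [-N, N] the spacing 1/N bounds the error; for |t| > N the clamped value is N or - N, and
    |t| - N <= |t| <= t^2 / N. *)
Lemma grid_close t : `|grid_value (grid_index t) - t| <= (1 + t ^+ 2) / N%:R.
Proof.
have N0' : 0 < N%:R :> R by rewrite ltr0n.
have N1' : 1 <= N%:R :> R by rewrite ler1n.
rewrite ler_pdivlMr// -[X in _ * X](gtr0_norm N0') -normrM mulrBl mulrBl.
rewrite divfK ?gt_eqF// grid_indexE.
set s := (t + N%:R) * N%:R.
have -> : forall m : nat, m%:R - N%:R * N%:R - t * N%:R = m%:R - s :> R.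
  by move=> m; rewrite /s; ring.
have t2 := sqr_ge0 t.
case: (ltP t (- N%:R)) => [tN|Nt].
  have s0 : s <= 0 by rewrite /s nmulr_rle0 ?ler0n//; lra.
  have tr0 : Num.truncn s = 0%N.
    by apply/eqP; rewrite -leqn0 -ltnS -[X in (X < _)%N]/(Num.truncn s) ltnS leqNgt truncn_gt0 -ltNge; lra.
  rewrite tr0 min0n sub0r normrN ler0_norm//.
  have : - s <= - t * N%:R by rewrite /s mulNr lerN2 ler_wpM2r// lerDl.
  have : - t * N%:R <= - t * - t by rewrite ler_wpM2l; lra.
  by nra.
have s0 : 0 <= s by rewrite mulr_ge0//; lra.
have /andP[h1 h2] := truncn_itv s0.
case: (leqP (Num.truncn s) (2 * N * N)) => h.
  by rewrite ler_norml; move: h2; rewrite -natr1; lra.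
have hs : (2 * N * N)%:R <= s by apply: le_trans h1; rewrite ler_nat ltnW.
rewrite ler_norml; have : t * N%:R <= t * t.
  rewrite !natrM in hs; have : N%:R <= t.
    by rewrite -(ler_pM2r N0') ; move: hs; rewrite /s; lra.
  by move=> Nt'; rewrite ler_wpM2l//; lra.
move: hs; rewrite !natrM /s; nra.
Qed.

Definition grid_cell (w : 'rV[R]_p) : {ffun 'I_p -> 'I_(2 * N * N).+1} :=
  [ffun i => grid_index (w ord0 i)].

Definition grid_point (j : {ffun 'I_p -> 'I_(2 * N * N).+1}) : 'rV[R]_p :=
  \row_i grid_value (j i).

Definition grid_round w := grid_point (grid_cell w).

Lemma grid_cell_measurable j : measurable [set w | grid_cell w = j].
Proof.
have -> : [set w | grid_cell w = j] = box (fun i => [set t | grid_index t = j i]).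
  apply/seteqP; split => w /= => [<- i|h]; first by rewrite /grid_cell ffunE.
  by apply/ffunP => i; rewrite /grid_cell ffunE; exact: h.
by apply: measurable_box => i; exact: grid_index_measurable.
Qed.

Lemma grid_round_close w i :
  `|(grid_round w) ord0 i - w ord0 i| <= japanese w ^+ 2 / N%:R.
Proof.
rewrite mxE ffunE; apply: le_trans (grid_close _) _.
rewrite ler_wpM2r ?invr_ge0// jap_sqr lerD2l /dot (bigD1 i)//= -expr2.
by rewrite lerDl sumr_ge0// => k _; rewrite -expr2 sqr_ge0.
Qed.

Lemma grid_round_jap w : japanese (grid_round w) <= (1 + 2 * p%:R) * japanese w ^+ 2.
Proof.
apply: le_trans (jap_le_sum _) _; rewrite mulrDl mul1r; apply: lerD; first exact: japX_ge1.
apply: le_trans (_ : \sum_(i < p) (2 * japanese w ^+ 2) <= _); last first.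
  by rewrite sumr_const card_ord -mulr_natr; apply: le_of_eq; ring.
apply: ler_sum => i _; rewrite -[X in `|X|](subrK (w ord0 i)).
apply: le_trans (ler_normD _ _) _; rewrite mulr_natl mulr2n; apply: lerD.
  apply: le_trans (grid_round_close _ _) _.
  by rewrite ler_piMr ?japX_ge0// invf_le1 ?ltr0n// ler1n.
apply: le_trans (coord_le_jap _ _) _.
by rewrite expr2 ler_peMl ?jap_ge0// jap_ge1.
Qed.

(** Rounding leaves finitely many values of [h], and [a j] is the integral of [c] over the cell of
    j; [h] is arbitrary, so the identity serves for the kernel, its derivatives and the values of u
    alike. *)
Lemma grid_sum (c : 'rV[R]_p -> C) : cL1 c -> forall h : 'rV[R]_p -> C,
  let a j := cintegral (fun w => c w * (grid_cell w == j)%:R) in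
  cL1 (fun w => c w * h (grid_round w)) /\
  \sum_j a j * h (grid_point j) = cintegral (fun w => c w * h (grid_round w)).
Proof.
move=> Ic h a.
have Ij j : cL1 (fun w => c w * (grid_cell w == j)%:R).
  have [mc [g Ig gB]] := Ic; split; last first.
    exists g => // w; apply: le_trans (gB w); rewrite cabsM.
    by case: (_ == _); rewrite ?cabs1 ?cabs0 ?mulr1 ?mulr0 ?cabs_ge0.
  apply: cmeasM => //.
  have -> : (fun w => (grid_cell w == j)%:R : C) = (fun w => (\1_[set w | grid_cell w = j] w)%:C%C).
    apply/funext => w; rewrite indicE; case: eqP => e; first by rewrite mem_set.
    by rewrite memNset.
  apply: cmeas_real; exact: measurable_indic (grid_cell_measurable j).
have Ihj j : cL1 (fun w => h (grid_point j) * (c w * (grid_cell w == j)%:R)) by exact: cL1Zl.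
have [S1 S2] := cintegral_sum (index_enum {ffun 'I_p -> 'I_(2 * N * N).+1}) Ihj.
have E : (fun w => \sum_j h (grid_point j) * (c w * (grid_cell w == j)%:R)) =
   (fun w => c w * h (grid_round w)).
  apply/funext => w; rewrite (bigD1 (grid_cell w))//= eqxx mulr1 big1 ?addr0 1?mulrC//.
  by move=> j /negPf; rewrite eq_sym => ->; rewrite !mulr0.
rewrite E in S1 S2; split => //; rewrite S2; apply: eq_bigr => j _.
by rewrite cintegralZl// mulrC.
Qed.

End grid.

(** * Tempered functionals under superposition integrals *)

Section kernels.
Variables (n p : nat).
Implicit Types (F : 'rV[R]_(n + p) -> C) (c : 'rV[R]_p -> C) (y : 'rV[R]_n) (w : 'rV[R]_p).

(** Schwartz in y with seminorms of polynomial growth in w: a tempered functional acting in y turns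
    such a kernel into a function of w of polynomial growth. *)
Definition rapid_kernel F := smooth F /\ forall k N, exists K M, 0 <= K /\ forall y w,
  jet k F (row_mx y w) <= K * japanese w ^+ M * japanese y ^- N.

Definition rapid_coef c := cmeas c /\ forall N, exists K, 0 <= K /\ forall w,
  cabs (c w) <= K * japanese w ^- N.

Lemma rapid_coef_cL1 c : rapid_coef c -> cL1 c.
Proof.
move=> [mc h]; have [K [K0 H]] := h (2 * p)%N.
by apply: (cL1_le mc (L1Zl K (L1_jap R (leqnn _)))).
Qed.

Lemma rapid_coef_mul c (h : 'rV[R]_p -> R) K M : rapid_coef c -> 0 <= K ->
  (forall w, h w <= K * japanese w ^+ M) -> exists K', 0 <= K' /\
  forall w, cabs (c w) * h w <= K' * K * japanese w ^- (2 * p).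
Proof.
move=> [mc /(_ (2 * p + M)%N)[K' [K'0 H]]] K0 hK; exists K'; split => // w.
apply: le_trans (ler_wpM2l (cabs_ge0 _) (hK w)) _.
apply: le_trans (ler_wpM2r _ (H w)) _; first by rewrite mulr_ge0 ?japX_ge0.
by rewrite -(japV_cancel w M (2 * p)); apply: le_of_eq; ring.
Qed.

Section with_kernel.
Variables (F : 'rV[R]_(n + p) -> C) (c : 'rV[R]_p -> C).
Hypotheses (kF : rapid_kernel F) (rc : rapid_coef c).

Lemma kernel_dominable : dominable c F.
Proof.
split; [exact: rc.1|exact: kF.1|move=> k].
have [K [M [K0 H]]] := kF.2 k 0%N.
have [K' [K'0 H']] := rapid_coef_mul rc K0 (fun w => lexx (K * japanese w ^+ M)).
exists (K' * K), 0%N => y w; rewrite expr0 mulr1; apply: le_trans (H' w).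
rewrite ler_wpM2l ?cabs_ge0//; apply: le_trans (H y w) _.
by rewrite expr0 invr1 mulr1.
Qed.

Lemma kernel_section w : rapid (fun y => F (row_mx y w)).
Proof.
split; first exact: smooth_comp (coordmap_mxl w) kF.1.
move=> k N; have [K [M [K0 H]]] := kF.2 k N.
exists ((1 + \sum_(i < n) `|1 : R|) ^+ k * (K * japanese w ^+ M)) => y.
apply: le_trans (jet_comp _ _ (coordmap_mxl w) kF.1) _.
by rewrite -mulrA ler_wpM2l// exprn_ge0// addr_ge0// sumr_ge0.
Qed.

Let G s := foldr (@pderiv R (n + p)) F (map (fun i : 'I_n => lshift p i) s).

Let sG s : smooth (G s). Proof. exact: smooth_foldr kF.1. Qed.

Lemma foldr_section s w :
  foldr (@pderiv R n) (fun y => F (row_mx y w)) s = (fun y => G s (row_mx y w)).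
Proof.
elim: s => [//|i s IH] /=; rewrite IH (pderiv_comp i (coordmap_mxl w) (sG s)).
by apply/funext => y; rewrite mul1r.
Qed.

Let dG s : dominable c (G s).
Proof. by elim: s => [|i s IH]; [exact: kernel_dominable|exact: dominable_pderiv]. Qed.

Lemma foldr_param_integral s : foldr (@pderiv R n) (param_integral c F) s = param_integral c (G s).
Proof. by elim: s => [//|i s IH] /=; rewrite IH (pderiv_param_integral i (dG s)). Qed.

Lemma rapid_param_integral : rapid (param_integral c F).
Proof.
split; first exact: param_integral_smooth kernel_dominable.
move=> k N; have [K [M [K0 H]]] := kF.2 k N.
have [K' [K'0 H']] := rapid_coef_mul rc K0 (fun w => lexx (K * japanese w ^+ M)).
pose r := rint (fun w : 'rV[R]_p => japanese w ^- (2 * p)).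
exists (2 * (K' * K * r)) => y; apply: le_trans (jet_param_integral _ _ kernel_dominable) _.
rewrite -[leRHS]mulrA; apply: ler_wpM2l => //.
rewrite [leRHS](_ : _ = rint (fun w : 'rV[R]_p => (K' * K * japanese y ^- N) * japanese w ^- (2 * p))); last first.
  by rewrite rintZl ?L1_jap// /r; ring.
apply: rint_le; first by apply: L1Zl; exact: L1_jap.
  by move=> w; rewrite mulr_ge0 ?cabs_ge0 ?jet_ge0.
move=> w; apply: le_trans (ler_wpM2l (cabs_ge0 _) (H y w)) _.
rewrite mulrA; apply: le_trans (ler_wpM2r (japV_ge0 _ _) (H' w)) _.
by apply: le_of_eq; ring.
Qed.

Let dist w w' := \sum_(i < p) `|w' ord0 i - w ord0 i|.

Let dist_ge0 w w' : 0 <= dist w w'. Proof. exact: sumr_ge0. Qed.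

(** The mean value inequality in w costs one derivative beyond the k in y, hence the bound on the
    jet of order k + 1. Taking all words [s] of length at most k gives the estimate in a Schwartz
    seminorm. *)
Lemma kernel_lipschitz k N : exists K M, 0 <= K /\ forall s y w w', (size s <= k)%N ->
  cabs (G s (row_mx y w') - G s (row_mx y w)) <=
  K * dist w w' * (japanese w ^+ M * japanese w' ^+ M) * japanese y ^- N.
Proof.
have [K [M [K0 H]]] := kF.2 k.+1 N; exists (2 * K), M; split; first exact: mulr_ge0.
move=> s y w w' sk.
apply: le_trans (lipschitz (B := K * (japanese w ^+ M * japanese w' ^+ M) * japanese y ^- N) (sG s) _) _.
  move=> i z /between_row_mx [a [b [-> /between_refl -> bb]]].
  apply: le_trans (jet_foldr (i :: map (fun i : 'I_n => lshift p i) s) F (row_mx y b)) _.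
  apply: le_trans (jet_le _ _ (_ : (_ <= k.+1)%N)) _; first by rewrite /= size_map.
  apply: le_trans (H y b) _; rewrite ler_wpM2r ?japV_ge0// ler_wpM2l//.
  by rewrite -exprMn lerXn2r ?nnegrE ?mulr_ge0 ?jap_ge0//; exact: jap_between.
rewrite big_split_ord /= [X in X + _]big1 ?add0r; last first.
  by move=> i _; rewrite !row_mxEl subrr normr0.
rewrite /dist; under eq_bigr do rewrite !row_mxEr.
by apply: le_of_eq; ring.
Qed.

Variable u : functional R n.
Hypothesis hu : tempered u.

Let v w := u (fun y => F (row_mx y w)).

Lemma kernel_tempered_bound : exists K M, 0 <= K /\ forall w, cabs (v w) <= K * japanese w ^+ M.
Proof.
have [k [L [L0 HL]]] := tempered_bound hu.
have [K [M [K0 H]]] := kF.2 k k.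
exists (L * ((1 + \sum_(i < n) `|1 : R|) ^+ k * K)), M; split.
  by rewrite !mulr_ge0 ?exprn_ge0 ?addr_ge0 ?sumr_ge0.
move=> w; rewrite -!mulrA; apply: HL; first by apply/rapidP; exact: kernel_section.
move=> y; have yk := japX_gt0 y k; rewrite mulrC -ler_pdivlMr//.
apply: le_trans (jet_comp _ _ (coordmap_mxl w) kF.1) _.
by rewrite -mulrA ler_wpM2l ?exprn_ge0 ?addr_ge0 ?sumr_ge0.
Qed.

Lemma kernel_tempered_lipschitz : exists K M, 0 <= K /\ forall w w',
  cabs (v w' - v w) <= K * dist w w' * (japanese w ^+ M * japanese w' ^+ M).
Proof.
have [k [L [L0 HL]]] := tempered_bound hu.
have [K [M [K0 H]]] := kernel_lipschitz k k.
exists (L * (n.+1%:R ^+ k * K)), M; split; first by rewrite !mulr_ge0.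
have sw w := (rapidP _).2 (kernel_section w).
move=> w w'; rewrite -(temperedB hu (sw w') (sw w)).
rewrite -!mulrA; apply: HL; first exact: schwartzB (sw w') (sw w).
move=> y; have yk := japX_gt0 y k; rewrite mulrC -ler_pdivlMr// -!mulrA.
apply: jet_le_foldr => s sk.
have E : foldr (@pderiv R n) (fun y => F (row_mx y w') - F (row_mx y w)) s =
   (fun y => G s (row_mx y w') - G s (row_mx y w)).
  rewrite foldr_pderivB; [|exact: (kernel_section w').1|exact: (kernel_section w).1].
  by apply/funext => x; rewrite !foldr_section.
by rewrite E; apply: le_trans (H s y w w' sk) _; apply: le_of_eq; ring.
Qed.

Lemma kernel_tempered_cont : ccont v.
Proof.
have [K [M [K0 H]]] := kernel_tempered_lipschitz.
apply: (ccont_of_bound (h := fun w w' => K * dist w w' * (japanese w ^+ M * japanese w' ^+ M))) => //.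
  move=> w; apply: contM; last first.
    by apply: contM; [exact: cont_cst|apply: contX; exact: continuous_jap].
  apply: contM; first exact: cont_cst.
  apply: cont_sum => i; apply: cont_compR; first exact: norm_continuous.
  by apply: contB; [exact: coord_continuous|exact: cont_cst].
by move=> w; rewrite /dist big1 ?mulr0 ?mul0r// => i _; rewrite subrr normr0.
Qed.

(** The displacement is O(<w>^2 / N), and the decay of [c] absorbs every power of <w>. The factor
    [t] carries what does not depend on w, such as a power of <y>. *)
Let grid_gap M : exists Q, forall N (D : 'rV[R]_p -> C) (t : R), (0 < N)%N -> 0 <= t ->
  (forall w, cabs (D w) <= t * (dist w (grid_round N w) *
     (japanese w ^+ M * japanese (grid_round N w) ^+ M))) ->
  cabs (cintegral (fun w => c w * D w)) <= t * (Q / N%:R).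
Proof.
(* The exponent collects 2 from the displacement, M from <w>^M, and 2 M from the bracket of the
   rounded point, which is O(<w>^2). *)
have [K' [K'0 H']] := rapid_coef_mul rc ler01
  (fun w => le_of_eq (esym (mul1r (japanese w ^+ (2 + (M + 2 * M)))))).
pose r := rint (fun w : 'rV[R]_p => japanese w ^- (2 * p)).
pose A : R := 1 + 2 * p%:R.
have A0 : 0 <= A by rewrite addr_ge0// mulr_ge0.
exists (2 * (p%:R * A ^+ M * K' * r)) => N D t N0 t0 HD.
have N0' : 0 <= N%:R^-1 :> R by rewrite invr_ge0.
have d1 w : dist w (grid_round N w) <= p%:R * (japanese w ^+ 2 / N%:R).
  rewrite mulr_natl -[X in _ *+ X]card_ord -sumr_const; apply: ler_sum => i _.
  exact: grid_round_close.
have d2 w : japanese (grid_round N w) ^+ M <= A ^+ M * japanese w ^+ (2 * M).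
  rewrite exprM -exprMn; apply: lerXn2r; last exact: grid_round_jap.
    by rewrite nnegrE jap_ge0.
  by rewrite nnegrE mulr_ge0 ?japX_ge0.
have IL := L1_jap R (leqnn (2 * p)).
rewrite [leRHS](_ : _ = 2 * rint (fun w : 'rV[R]_p =>
    (t * (p%:R * A ^+ M / N%:R) * K') * japanese w ^- (2 * p))); last first.
  by rewrite rintZl// /r; ring.
apply: cintegral_norm_le; first exact: L1Zl.
move=> w; rewrite cabsM; apply: le_trans (ler_wpM2l (cabs_ge0 _) (HD w)) _.
apply: le_trans (_ : (t * (p%:R * A ^+ M / N%:R)) *
   (cabs (c w) * japanese w ^+ (2 + (M + 2 * M))) <= _); last first.
  by rewrite -[leRHS]mulrA ler_wpM2l ?mulr_ge0 ?exprn_ge0//; have := H' w; rewrite mulr1.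
rewrite [leRHS](_ : _ = cabs (c w) * (t * ((p%:R * (japanese w ^+ 2 / N%:R)) *
   (japanese w ^+ M * (A ^+ M * japanese w ^+ (2 * M)))))); last by rewrite !exprD; ring.
rewrite ler_wpM2l ?cabs_ge0// ler_wpM2l//; apply: ler_pM => //.
  by rewrite mulr_ge0 ?japX_ge0.
by rewrite ler_wpM2l ?japX_ge0.
Qed.

Let weak_approx : exists K, forall N, (0 < N)%N ->
  cabs (u (param_integral c F) - cintegral (fun w => c w * v w)) <= K / N%:R.
Proof.
have [k [L [L0 HL]]] := tempered_bound hu.
have [K1 [M1 [K10 H1]]] := kernel_lipschitz k k.
have [K2 [M2 [K20 H2]]] := kernel_tempered_lipschitz.
have [Q1 HQ1] := grid_gap M1; have [Q2 HQ2] := grid_gap M2.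
exists (L * (n.+1%:R ^+ k * (K1 * Q1)) + K2 * Q2) => N N0.
have Ic := rapid_coef_cL1 rc.
have sF w := (rapidP _).2 (kernel_section w).
pose a (j : {ffun 'I_p -> 'I_(2 * N * N).+1}) :=
  cintegral (fun w => c w * (grid_cell N w == j)%:R).
have sp : schwartz (param_integral c F) by apply/rapidP; exact: rapid_param_integral.
have [sS uS] := tempered_sum hu (index_enum _) a (fun j => sF (grid_point j)).
have [Iv vS] := @grid_sum p N c Ic v.
have Ivc : cL1 (fun w => c w * v w).
  have [K3 [M3 [K30 H3]]] := kernel_tempered_bound.
  have [K' [K'0 H']] := rapid_coef_mul rc K30 H3.
  apply: (cL1_le _ (L1Zl (K' * K3) (L1_jap R (leqnn (2 * p))))).
    by apply: cmeasM; [exact: rc.1|apply: ccont_meas; exact: kernel_tempered_cont].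
  by move=> w; rewrite cabsM.
(* Both sides are compared with the finite sum over the grid, on which linearity of u is
   available. *)
rewrite -[X in cabs X](subrKA (u (fun y => \sum_j a j * F (row_mx y (grid_point j))))).
apply: le_trans (cabsD _ _) _; rewrite mulrDl; apply: lerD.
  rewrite -(temperedB hu sp sS) -mulrA; apply: HL; first exact: schwartzB sp sS.
  move=> y; have yk := japX_gt0 y k; rewrite mulrC -ler_pdivlMr// -!mulrA.
  apply: jet_le_foldr => s sk.
  rewrite foldr_pderivB; [|exact: ((rapidP _).1 sp).1|exact: ((rapidP _).1 sS).1].
  rewrite foldr_param_integral foldr_pderiv_sum; last by move=> j; exact: (kernel_section _).1.
  under eq_bigr do rewrite foldr_section.
  have [Ig gS] := @grid_sum p N c Ic (fun w => G s (row_mx y w)).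
  rewrite /a gS /param_integral.
  have [_ <-] := cintegralB (param_integral_cL1 y (dG s)) Ig.
  have -> : (fun w => c w * G s (row_mx y w) - c w * G s (row_mx y (grid_round N w))) =
     (fun w => c w * (G s (row_mx y w) - G s (row_mx y (grid_round N w)))).
    by apply/funext => w; rewrite mulrBr.
  rewrite [leRHS](_ : _ = (K1 * japanese y ^- k) * (Q1 / N%:R)); last by ring.
  apply: HQ1 => //; first by rewrite mulr_ge0 ?japV_ge0.
  move=> w; rewrite cabs_distC; apply: le_trans (H1 _ _ _ _ sk) _; apply: le_of_eq; ring.
rewrite uS vS.
have [_ <-] := cintegralB Iv Ivc.
have -> : (fun w => c w * v (grid_round N w) - c w * v w) =
     (fun w => c w * (v (grid_round N w) - v w)).
  by apply/funext => w; rewrite mulrBr.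
rewrite -[leRHS]mulrA; apply: HQ2 => // w.
by apply: le_trans (H2 _ _) _; apply: le_of_eq; ring.
Qed.

(* Rounding [w] to the grid turns the integral into a finite sum, which [u] passes through;
   the kernel is Lipschitz in Schwartz seminorms, so both sides move by O(1/N). *)
Theorem weak_integral : u (param_integral c F) = cintegral (fun w => c w * v w).
Proof.
have [K H] := weak_approx; apply/eqP; rewrite -subr_eq0; apply/eqP/cabs_eq0.
by apply: (@eq0_of_le _ K) => N N0; rewrite ger0_norm ?cabs_ge0//; exact: H.
Qed.

End with_kernel.
End kernels.
End weak_integral.

(** * Off-diagonal decay *)

Section transfer.
Variable R : realType.
Local Notation C := R[i].

(** Only exponents past a threshold are allowed: [G] will be of polynomial growth, and for small N
    the integral may diverge, in which case [rint] would return the default value 0. *)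
Definition transfer n (m : R) (F G : 'rV[R]_n -> R) := exists N0, forall N, (N0 <= N)%N ->
  exists K, 0 <= K /\ forall z,
    F z <= K * japanese z `^ m * rint (fun w => japanese (z - w) ^- N * G w).

(** Since <w> <= 2 <z> <z - w> and symmetrically, |ln <w> - ln <z>| <= ln (2 <z - w>); multiplying
    by m treats both signs of the exponent at once. *)
Lemma peetre n (z w : 'rV[R]_n) (m : R) M : `|m| <= M%:R ->
  japanese w `^ m <= 2 ^+ M * (japanese z `^ m * japanese (z - w) ^+ M).
Proof.
move=> mM; set x := japanese w; set y := japanese z; set t := japanese (z - w).
have x0 : 0 < x by exact: jap_gt0.
have y0 : 0 < y by exact: jap_gt0.
have t1 : 1 <= t by exact: jap_ge1.
have t0 : 0 < t by exact: jap_gt0.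
have xy : x <= 2 * (y * t).
  by rewrite /x -{1}(subKr z w) /y /t -[japanese (z - w)]japN; exact: japD.
have yx : y <= 2 * (x * t).
  by rewrite /y -{1}(subrK w z) addrC; exact: japD.
have q0 : 0 < 2 * t by rewrite mulr_gt0.
rewrite mulrCA -exprMn -powR_mulrn; last exact: ltW.
rewrite /powR !gt_eqF// -expRD ler_expR -lerBlDl -mulrBr.
apply: le_trans (ler_norm _) _; rewrite normrM; apply: ler_pM => //.
have L a b : 0 < a -> 0 < b -> a <= 2 * (b * t) -> ln a - ln b <= ln (2 * t).
  move=> a0 b0 ab; rewrite lerBlDr -lnM ?posrE// ler_ln ?posrE//; last by rewrite mulr_gt0.
  by rewrite (le_trans ab)//; apply: le_of_eq; ring.
by rewrite ler_norml L// andbT lerNl opprB L.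
Qed.

Lemma peetre_shift n (z w : 'rV[R]_n) (m : R) M N : `|m| <= M%:R ->
  japanese w `^ m * japanese (z - w) ^- (N + M) <= 2 ^+ M * japanese z `^ m * japanese (z - w) ^- N.
Proof.
move=> mM; apply: le_trans (ler_wpM2r (japV_ge0 _ _) (peetre z w mM)) _.
by rewrite -(japV_cancel (z - w) M N); apply: le_of_eq; ring.
Qed.

Lemma L1_shift_weight n (G : 'rV[R]_n -> R) K M N z : mfun_row G ->
  (forall w, `|G w| <= K * japanese w ^+ M) -> (2 * n + M <= N)%N ->
  L1 (fun w => japanese (z - w) ^- N * G w).
Proof.
move=> mG GK nN.
have mj : mfun_row (fun w : 'rV[R]_n => japanese (z - w) ^- N).
  have := mfun_row_affine 1 (- z) (@mfun_japV R n N); congr mfun_row; apply/funext => w.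
  by rewrite scale1r jap_distC.
apply: (L1_le (mfunM mj mG) (L1Zl (2 ^+ (2 * n + M) * japanese z ^+ (2 * n + M) * K) (L1_jap R (leqnn (2 * n))))).
move=> w; rewrite normrM ger0_norm ?japV_ge0//.
apply: le_trans (ler_pM (japV_ge0 _ _) (normr_ge0 _) (japV_le _ nN) (GK w)) _.
have K0 : 0 <= K by apply: (coef_ge0 (japX_gt0 0 M) (normr_ge0 _) (GK 0)).
have h : japanese (z - w) ^- (2 * n + M) <= 2 ^+ (2 * n + M) * (japanese w ^- (2 * n + M) * japanese z ^+ (2 * n + M)).
  by rewrite addrC; apply: le_trans (japDV _ _ _) _; rewrite japN.
apply: le_trans (ler_wpM2r _ h) _; first by rewrite mulr_ge0 ?japX_ge0.
by rewrite -(japV_cancel w M (2 * n)); apply: le_of_eq; ring.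
Qed.

Variable d : nat.
Implicit Types (phi psi f : 'rV[R]_d -> C) (u : functional R d) (w z : 'rV[R]_(d + d)).

Definition stft_kernel_swap phi (z : 'rV[R]_(d + (d + d))) : C := stft_kernel phi (swap_mx z).

Lemma tfsE phi y w : stft_kernel_swap phi (row_mx y w) = conjc (time_freq phi w y).
Proof. by rewrite /stft_kernel_swap swap_row_mx tfjE. Qed.

Lemma kernel_stft_kernel_swap phi : rapid phi -> rapid_kernel (stft_kernel_swap phi).
Proof.
move=> rp; have st := smooth_stft_kernel rp.1; have cs := @coordmap_swap R d (d + d).
split; first exact: smooth_comp cs st.
move=> k N; have [K [M [K0 H]]] := stft_kernel_bound k N rp.
exists ((1 + \sum_(i < d + (d + d)) `|1 : R|) ^+ k * K), M; split.
  by rewrite mulr_ge0// exprn_ge0// addr_ge0// sumr_ge0.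
move=> y w; apply: le_trans (jet_comp _ _ cs st) _; rewrite swap_row_mx -!mulrA.
by rewrite ler_wpM2l ?exprn_ge0// ?addr_ge0 ?sumr_ge0// mulrA.
Qed.

Lemma stft_stft_kernel_swap phi u w : stft phi u w = u (fun y => stft_kernel_swap phi (row_mx y w)).
Proof. by congr u; apply/funext => y; rewrite tfsE. Qed.

Lemma stft_cont phi u : tempered u -> rapid phi -> ccont (stft phi u).
Proof.
move=> hu rp; have := kernel_tempered_cont (kernel_stft_kernel_swap rp) hu; congr ccont.
by apply/funext => w; rewrite stft_stft_kernel_swap.
Qed.

Lemma stft_mfun phi u : tempered u -> rapid phi -> mfun_row (fun w => cabs (stft phi u w)).
Proof. by move=> hu rp; apply: mfun_cabs; apply: ccont_meas; exact: stft_cont. Qed.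

Lemma stft_poly phi u : tempered u -> rapid phi -> exists K M, 0 <= K /\
  forall w, `|cabs (stft phi u w)| <= K * japanese w ^+ M.
Proof.
move=> hu rp; have [K [M [K0 H]]] := kernel_tempered_bound (kernel_stft_kernel_swap rp) hu.
by exists K, M; split => // w; rewrite ger0_norm ?cabs_ge0// stft_stft_kernel_swap.
Qed.

Section representation.
Variables (phi : 'rV[R]_d -> C) (u : functional R d).
Hypotheses (rp : rapid phi) (phi0 : exists x, phi x <> 0) (hu : tempered u).

(** With coefficients c = conj (V_phi f), inversion exhibits the conjugate of f as a multiple of
    [param_integral c]. This proves that it is Schwartz and at the same time brings it into the form
    to which [weak_integral] applies. *)
Lemma stft_representation f M (K : R) : ccont f -> 0 <= K ->
  (forall x, cabs (f x) <= K * japanese x ^+ M) ->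
  (forall N, exists K', forall w, cabs (fun_stft phi f w) <= K' * japanese w ^- N) ->
  u (fun x => conjc (f x)) = (conjc (window_const phi))^-1 *
    cintegral (fun w => conjc (fun_stft phi f w) * stft phi u w).
Proof.
move=> cf K0 fK VK.
pose c w := conjc (fun_stft phi f w).
have rc : rapid_coef c.
  split.
    apply: cmeas_conj; rewrite fun_stft_param_integral; apply: smooth_meas; apply: param_integral_smooth.
    exact: dominable_stft_kernel rp (ccont_meas cf) K0 fK.
  move=> N; have [K' H] := VK N; exists K'; split; last by move=> w; rewrite cabs_conj.
  exact: (coef_ge0 (japV_gt0 0 _) (cabs_ge0 _) (H 0)).
have kT := kernel_stft_kernel_swap rp.
have [K' HV] := VK (2 * d + 2 * d)%N.
have pE x : param_integral c (stft_kernel_swap phi) x = conjc (window_const phi) * conjc (f x).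
  rewrite -conjcM /window_const -(stft_inversion rp cf K0 fK HV).
  rewrite -cintegral_conj.
    rewrite /param_integral; congr (cintegral _); apply/funext => w.
    by rewrite tfsE [RHS]conjcM.
  have := cL1_conj (param_integral_cL1 x (kernel_dominable kT rc)); congr cL1.
  by apply/funext => w; rewrite tfsE conjcM !conjcK.
have W0 : conjc (window_const phi) != 0.
  apply/eqP => /(congr1 (@conjc R)); rewrite conjcK conjc0 => /eqP.
  by apply/negP; exact: window_const_neq0.
have -> : (fun x => conjc (f x)) =
   (fun x => (conjc (window_const phi))^-1 * param_integral c (stft_kernel_swap phi) x + 0).
  by apply/funext => x; rewrite pE addr0 mulrA mulVf// mul1r.
have sP : schwartz (param_integral c (stft_kernel_swap phi)) by apply/rapidP; exact: rapid_param_integral.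
rewrite hu.1//; last exact: schwartz0.
rewrite (tempered0 hu) addr0 (weak_integral kT rc hu); congr (_ * cintegral _).
by apply/funext => w; rewrite stft_stft_kernel_swap.
Qed.

(** Serves the change of window, with T z = pi(z) psi, and the Weyl operators, with T z their value
    on pi(z) phi. The growth constants of T z may depend on z, as they only give access to
    inversion; those in the decay of its STFT are uniform. *)
Lemma representation_transfer (m : R) (T : 'rV[R]_(d + d) -> 'rV[R]_d -> C) :
  (forall z, ccont (T z)) ->
  (forall z, exists K M, 0 <= K /\ forall x, cabs (T z x) <= K * japanese x ^+ M) ->
  (forall N, exists K, 0 <= K /\ forall z w,
     cabs (fun_stft phi (T z) w) <= K * japanese z `^ m * japanese (z - w) ^- N) ->
  transfer m (fun z => cabs (u (fun x => conjc (T z x)))) (fun w => cabs (stft phi u w)).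
Proof.
move=> cT bT VT; have [K [M [K0 H]]] := stft_poly hu rp.
(* M is the growth of [stft phi u]; the other 2 (d + d) powers make the integral over phase space
   converge. *)
exists (2 * (d + d) + M)%N => N hN; have [K1 [K10 H1]] := VT N.
exists (cabs (conjc (window_const phi))^-1 * (2 * K1)); split.
  by rewrite !mulr_ge0 ?cabs_ge0.
move=> z; have [K2 [M2 [K20 H2]]] := bT z.
rewrite (stft_representation (cT z) K20 H2); last first.
  move=> N'; have [K3 [K30 H3]] := VT N'.
  exists (K3 * japanese z `^ m * (2 ^+ N' * japanese z ^+ N')) => w.
  apply: le_trans (H3 z w) _; rewrite -[leRHS]mulrA ler_wpM2l ?mulr_ge0 ?powR_ge0//.
  rewrite addrC; apply: le_trans (japDV _ _ _) _; rewrite japN; apply: le_of_eq; ring.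
have IL := L1_shift_weight z (stft_mfun hu rp) H hN.
rewrite cabsM -!mulrA ler_wpM2l ?cabs_ge0//.
rewrite [leRHS](_ : _ = 2 * rint (fun w => (K1 * japanese z `^ m) *
   (japanese (z - w) ^- N * cabs (stft phi u w)))); last first.
  by rewrite rintZl//; ring.
apply: cintegral_norm_le; first exact: L1Zl.
move=> w; rewrite cabsM cabs_conj mulrA ler_wpM2r ?cabs_ge0//; exact: H1.
Qed.

Lemma window_transfer psi : rapid psi ->
  transfer 0 (fun z => cabs (stft psi u z)) (fun w => cabs (stft phi u w)).
Proof.
move=> rq; have rT z := rapid_time_freq z rq.
apply: (representation_transfer (T := time_freq psi)).
- by move=> z; exact: smooth_cont (rT z).1.
- move=> z; have [K [M [K0 H]]] := polyjet_bound 0 (rapid_polyjet (rT z)).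
  by exists K, M.
- move=> N; have [K [K0 H]] := fun_stft_time_freq N rp rq; exists K; split => // z w.
  by rewrite powRr0 mulr1.
Qed.

End representation.

Lemma rapid_gaussian : rapid (@gaussian R d).
Proof.
have := rapid_mulr (polyjet_cst d ((pi `^ (- (d%:R / 4)) : R)%:C%C)) (@rapid_gauss R d).
congr rapid; apply/funext => x; rewrite /gaussian /realC /gauss euclid_sqr.
by apply: complexP; rewrite /= ?mul0r ?mulr0 ?subr0 ?addr0.
Qed.

Lemma localization_transfer phi u (m : R) (a : 'rV[R]_(d + d) -> C) (Ka : R) :
  tempered u -> rapid phi -> (forall z, cabs (a z) <= Ka * japanese z `^ m) ->
  transfer m (fun z => cabs (stft phi (localization a u) z))
             (fun w => cabs (stft (@gaussian R d) u w)).
Proof.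
move=> hu rp aK; have rg := rapid_gaussian.
have Ka0 : 0 <= Ka.
  by apply: (coef_ge0 _ (cabs_ge0 _) (aK 0)); rewrite powR_gt0// jap_gt0.
have [K [M [K0 H]]] := stft_poly hu rg.
have [Mm mM] : exists Mm : nat, `|m| <= Mm%:R.
  by exists (Num.bound `|m|); apply: ltW; exact: archi_boundP.
exists (2 * (d + d) + M)%N => N hN.
(* The extra [Mm] powers pay for moving the weight of a from <w>^m to <z>^m by Peetre's
   inequality. *)
have [K1 [K10 H1]] := fun_stft_time_freq (N + Mm) rg rp.
exists (cabs (((2 * pi) ^- d : R)%:C%C) * (2 * (Ka * (K1 * 2 ^+ Mm)))); split.
  by rewrite !mulr_ge0 ?cabs_ge0 ?exprn_ge0.
move=> z.
have -> : stft phi (localization a u) z = ((2 * pi) ^- d : R)%:C%C *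
    cintegral (fun w => a w * stft (@gaussian R d) u w *
       conjc (fun_stft (@gaussian R d) (time_freq phi z) w)).
  rewrite /stft /pairing /localization /of_pairing; congr (_ * cintegral _).
  apply/funext => w; congr (_ * conjc _); rewrite -fun_stft_stft; congr fun_stft.
  by apply/funext => x; rewrite conjcK.
have IL := L1_shift_weight z (stft_mfun hu rg) H hN.
rewrite cabsM -!mulrA ler_wpM2l ?cabs_ge0//.
rewrite [leRHS](_ : _ = 2 * rint (fun w => (Ka * (K1 * 2 ^+ Mm) * japanese z `^ m) *
   (japanese (z - w) ^- N * cabs (stft (@gaussian R d) u w)))); last first.
  by rewrite rintZl//; ring.
apply: cintegral_norm_le; first exact: L1Zl.
move=> w; rewrite !cabsM cabs_conj.
rewrite -[leLHS]mulrA [X in _ * X]mulrC mulrA mulrA ler_wpM2r ?cabs_ge0//.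
apply: le_trans (ler_pM (cabs_ge0 _) (cabs_ge0 _) (aK w) (H1 z w)) _.
rewrite [leLHS](_ : _ = Ka * K1 * (japanese w `^ m * japanese (z - w) ^- (N + Mm))); last by ring.
apply: le_trans (ler_wpM2l (mulr_ge0 Ka0 K10) (peetre_shift z w N mM)) _.
by apply: le_of_eq; ring.
Qed.

End transfer.

(** * Partial Fourier transforms *)

Section partial_fourier_transform.
Variable R : realType.
Local Notation C := R[i].
Local Notation e_ i := (delta_mx ord0 i).

Lemma coordmap_mxr m n (w : 'rV[R]_m) :
  coordmap (fun y : 'rV[R]_n => row_mx w y) (fun=> 1) (fun i => rshift m i).
Proof.
move=> y t i; rewrite mulr1; apply/rowP => j.
case: (split_ordP j) => k ->; rewrite [RHS]mxE ?row_mxEl ?row_mxEr !mxE.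
  by rewrite eq_lrshift andbF mulr0 addr0.
by rewrite eq_rshift.
Qed.

Lemma jet_coordE n (i : 'I_n) k (x : 'rV[R]_n) : jet k (coordC i) x = `|x ord0 i| + k%:R.
Proof.
elim: k => [|k IH]; first by rewrite addr0 /= expr0n/= addr0 sqrtr_sqr.
rewrite /= IH -natr1 addrA; congr (_ + _).
rewrite (bigD1 i)//= pderiv_coord jet_cst eqxx cabs1 big1 ?addr0// => j ji.
by rewrite pderiv_coord jet_cst eq_sym (negbTE ji) cabs0.
Qed.

(** Choosing the constant before [A] makes it uniform over all maps with the same scalings [c], in
    particular over the translations inside [weyl_arg]. *)
Lemma jet_comp_ex m n (c : 'I_m -> R) k : exists L : R, 0 <= L /\
  forall (A : 'rV[R]_m -> 'rV[R]_n) s (f : 'rV[R]_n -> C) x, coordmap A c s -> smooth f ->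
    jet k (fun y => f (A y)) x <= L * jet k f (A x).
Proof.
exists ((1 + \sum_(i < m) `|c i|) ^+ k); split; last first.
  by move=> A s f x cA sf; exact: jet_comp cA sf.
by rewrite exprn_ge0// addr_ge0// sumr_ge0.
Qed.

Lemma split_lshiftE m n (j : 'I_m) : fintype.split (lshift n j) = inl j.
Proof. exact: (unsplitK (inl j)). Qed.

Variable d : nat.
Implicit Types (z : 'rV[R]_((d + d) + d)) (zeta : 'rV[R]_(d + d)) (x xi y : 'rV[R]_d).

Definition phase_arg z : 'rV[R]_(d + d) := row_mx (rsubmx (lsubmx z)) (rsubmx z).

Definition phase z : C := fourier_kernel (phase_arg z).

Lemma phaseE zeta y : phase (row_mx zeta y) = cis (- dot y (rsubmx zeta)).
Proof. by rewrite /phase /phase_arg row_mxKl row_mxKr ftkerE. Qed.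

Definition phase_scale (k : 'I_((d + d) + d)) : R :=
  match fintype.split k with
  | inl i => match fintype.split i with inl _ => 0 | inr _ => 1 end
  | inr _ => 1 end.

Lemma coordmap_phase : coordmap phase_arg phase_scale
  (fun k => match fintype.split k with
            | inl i => match fintype.split i with inl j => lshift d j | inr j => lshift d j end
            | inr j => rshift d j end).
Proof.
move=> z t k; rewrite /phase_arg /phase_scale; apply/rowP => l.
case: (split_ordP k) => i ->.
  case: (split_ordP i) => j ->.
    case: (split_ordP l) => h ->; rewrite [RHS]mxE ?row_mxEl ?row_mxEr !mxE ?eqxx/=.
      by rewrite eq_lshift eq_rlshift/= !mulr0 mul0r.
    by rewrite eq_rlshift/= !mulr0 mul0r.
  case: (split_ordP l) => h ->; rewrite [RHS]mxE ?row_mxEl ?row_mxEr !mxE ?eqxx/=.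
    by rewrite eq_lshift eq_rshift eq_lshift mulr1.
  by rewrite eq_rlshift eq_rlshift/= !mulr0.
case: (split_ordP l) => h ->; rewrite [RHS]mxE ?row_mxEl ?row_mxEr !mxE ?eqxx/=.
  by rewrite eq_lrshift eq_lrshift/= !mulr0.
by rewrite !eq_rshift mulr1.
Qed.

Lemma smooth_phase : smooth phase.
Proof. exact: smooth_comp coordmap_phase (polyjet_fourier_kernel R d).1. Qed.

Lemma polyjet_phase : polyjet phase.
Proof.
split; first exact: smooth_phase.
move=> k; have [K [M [K0 H]]] := polyjet_bound k (polyjet_fourier_kernel R d).
have [L [L0 HL]] := jet_comp_ex (d + d) phase_scale k.
exists (L * K), (M + M)%N => z.
apply: le_trans (HL _ _ _ _ coordmap_phase (polyjet_fourier_kernel R d).1) _.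
apply: le_trans (ler_wpM2l L0 (H _)) _; rewrite mulrA ler_wpM2l ?mulr_ge0//.
apply: le_trans (jap_row_mxX _ _ _) _; rewrite exprD.
have h1 : japanese (rsubmx z) <= japanese z by exact: jap_rsubmx.
have h2 : japanese (rsubmx (lsubmx z)) <= japanese z.
  by apply: le_trans (jap_rsubmx _) _; exact: jap_lsubmx.
by apply: ler_pM; rewrite ?japX_ge0// lerXn2r// nnegrE jap_ge0.
Qed.

(** The logarithmic derivatives of [phase] in the (x, xi) directions. *)
Definition phase_coef (i : 'I_(d + d)) : 'rV[R]_((d + d) + d) -> C :=
  match fintype.split i with
  | inl _ => fun=> 0
  | inr j => fun z => - 'i%C * coordC (rshift (d + d) j) z end.

Lemma smooth_phase_coef i : smooth (phase_coef i).
Proof.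
rewrite /phase_coef; case: fintype.split => j; first exact: smooth_cst.
by apply: smooth_mul; [exact: smooth_cst|exact: smooth_coord].
Qed.

Lemma jet_phase_coef k i zeta y : jet k (phase_coef i) (row_mx zeta y) <= k.+1%:R * japanese y.
Proof.
rewrite /phase_coef; case: fintype.split => j.
  by rewrite jet_cst cabs0 mulr_ge0// jap_ge0.
rewrite jet_cmul; last exact: smooth_coord.
rewrite cabsN cabs_i mul1r jet_coordE row_mxEr -natr1 mulrDl mul1r addrC; apply: lerD.
  by rewrite ler_peMr// jap_ge1.
exact: coord_le_jap.
Qed.

Lemma pderiv_phase i : pderiv (lshift d i) phase = (fun z => phase_coef i z * phase z).
Proof.
rewrite (pderiv_comp _ coordmap_phase (polyjet_fourier_kernel R d).1); apply/funext => z.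
rewrite /phase_coef /phase_scale split_lshiftE; case: (split_ordP i) => j _ /=.
  by rewrite !mul0r.
rewrite mul1r pderiv_fourier_kernel; congr (_ * _ * _).
by rewrite /coordC /realC /phase_arg row_mxEr mxE.
Qed.

(** The transform goes from y to xi, and xi is at the same time a variable of the amplitude B(x, xi,
    y): this is the inner y-integral of an oscillatory integral. *)
Definition partial_fourier (B : 'rV[R]_((d + d) + d) -> C) : 'rV[R]_(d + d) -> C :=
  param_integral (fun=> 1) (fun z => phase z * B z).

Lemma HftE B zeta : partial_fourier B zeta = fourier (fun y => B (row_mx zeta y)) (rsubmx zeta).
Proof. by congr cintegral; apply/funext => y; rewrite mul1r phaseE. Qed.

Section family.
Variables (I : Type) (v : I -> 'rV[R]_d -> R) (M : nat).
Hypothesis v0 : forall i x, 0 <= v i x.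
Hypothesis vpoly : forall i, exists K L, 0 <= K /\ forall x, v i x <= K * japanese x ^+ L.

(* The constants are uniform in the index, and the growth rate [M] in [xi] does not depend on [k]. *)
Definition family (B : I -> 'rV[R]_((d + d) + d) -> C) := (forall i, smooth (B i)) /\
  forall k N, exists K, 0 <= K /\ forall i x xi y,
    jet k (B i) (row_mx (row_mx x xi) y) <= K * v i x * japanese xi ^+ M * japanese y ^- N.

Lemma family_dominable B i : family B -> dominable (fun=> 1) (fun z => phase z * B i z).
Proof.
move=> [sB H]; split; [exact: cmeas_cst|exact: smooth_mul smooth_phase (sB i)|move=> k].
have [K1 [M1 [K10 H1]]] := polyjet_bound k polyjet_phase.
have [K2 [K20 H2]] := H k (2 * d + M1)%N.
have [K3 [L [K30 H3]]] := vpoly i.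
exists (K1 * K2 * K3), (M1 + L + M)%N => zeta y; rewrite cabs1 mul1r.
apply: le_trans (jet_mul _ _ smooth_phase (sB i)) _.
have h1 := le_trans (H1 (row_mx zeta y)) (ler_wpM2l K10 (jap_row_mxX _ _ _)).
have := H2 i (lsubmx zeta) (rsubmx zeta) y; rewrite hsubmxK => h2.
have h3 : v i (lsubmx zeta) * japanese (rsubmx zeta) ^+ M <= K3 * japanese zeta ^+ (L + M).
  rewrite exprD mulrA; apply: ler_pM; rewrite ?japX_ge0//.
    apply: le_trans (H3 _) _; rewrite ler_wpM2l// lerXn2r ?nnegrE ?jap_ge0//.
    exact: jap_lsubmx.
  by rewrite lerXn2r ?nnegrE ?jap_ge0//; exact: jap_rsubmx.
apply: le_trans (ler_pM (jet_ge0 _ _ _) (jet_ge0 _ _ _) h1 h2) _.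
rewrite [leLHS](_ : _ = (K1 * K2 * japanese zeta ^+ M1 * japanese y ^- (2 * d)) *
  (v i (lsubmx zeta) * japanese (rsubmx zeta) ^+ M)); last first.
  by rewrite -[in RHS](japV_cancel y M1 (2 * d)); ring.
apply: le_trans (ler_wpM2l _ h3) _; first by rewrite !mulr_ge0 ?japX_ge0 ?japV_ge0.
by apply: le_of_eq; rewrite !exprD; ring.
Qed.

(** Integrating by parts N + M times in y yields <xi>^-(N + M), and M of these powers cancel the
    growth of B in xi. This is where the independence of M from the number of derivatives enters. *)
Lemma family_partial_fourier_bound B : family B -> forall N, exists K, 0 <= K /\ forall i x xi,
  cabs (partial_fourier (B i) (row_mx x xi)) <= K * v i x * japanese xi ^- N.
Proof.
move=> [sB H] N; have [K [K0 HK]] := H (N + M)%N (2 * d)%N.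
pose L : R := (1 + \sum_(i < d) `|1 : R|) ^+ (N + M).
have L0 : 0 <= L by rewrite exprn_ge0// addr_ge0// sumr_ge0.
pose r := rint (fun y : 'rV[R]_d => japanese y ^- (2 * d)).
have r0 : 0 <= r by apply: rint_ge0 => y; exact: japV_ge0.
exists (2 * (L * K * r)); split; first by rewrite !mulr_ge0.
move=> i x xi; rewrite HftE row_mxKr.
have cm := @coordmap_mxr (d + d) d (row_mx x xi).
have IL := L1_jap R (leqnn (2 * d)).
apply: le_trans (fourier_decay (k := N + M) xi _
   (L1Zl (L * (K * v i x * japanese xi ^+ M)) IL) _) _.
- split; first exact: smooth_comp cm (sB i).
  move=> k; have [K' [K'0 HK']] := H k (2 * d)%N.
  have [L' [L'0 HL']] := jet_comp_ex (d + d + d) (fun _ : 'I_d => 1) k.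
  exists (L' * (K' * v i x * japanese xi ^+ M)) => y; apply: le_trans (HL' _ _ _ _ cm (sB i)) _.
  by rewrite -[leRHS]mulrA; apply: ler_wpM2l => //; exact: HK'.
- move=> y; apply: le_trans (jet_comp _ _ cm (sB i)) _.
  by rewrite -mulrA ler_wpM2l//; exact: HK.
- rewrite rintZl// -/r -(japV_cancel xi M N); apply: le_of_eq; ring.
Qed.

(** This is the amplitude of a derivative of the transform (see [pderiv_partial_fourier]), so jets
    of all orders follow by induction. The factor y_j from the phase costs one power of decay, hence
    [N.+1]. *)
Lemma family_pderiv B (j : 'I_(d + d)) : family B ->
  family (fun i z => phase_coef j z * B i z + pderiv (lshift d j) (B i) z).
Proof.
move=> [sB H].
have s1 i : smooth (fun z => phase_coef j z * B i z).
  exact: smooth_mul (smooth_phase_coef j) (sB i).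
have s2 i := smooth_pderiv (lshift d j) (sB i).
split; first by move=> i; exact: smooth_add (s1 i) (s2 i).
move=> k N; have [K1 [K10 H1]] := H k N.+1; have [K2 [K20 H2]] := H k.+1 N.
exists (k.+1%:R * K1 + K2); split; first by rewrite addr_ge0 ?mulr_ge0.
move=> i x xi y; apply: le_trans (jet_add _ _ (s1 i) (s2 i)) _.
rewrite -!mulrA [leRHS]mulrDl !mulrA; apply: lerD; last first.
  exact: le_trans (jet_pderiv _ _ _ _) (H2 i x xi y).
apply: le_trans (jet_mul _ _ (smooth_phase_coef j) (sB i)) _.
apply: le_trans (ler_pM (jet_ge0 _ _ _) (jet_ge0 _ _ _) (jet_phase_coef _ _ _ _) (H1 i x xi y)) _.
have := japV_cancel y 1 N; rewrite addn1 expr1 => <-.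
by apply: le_of_eq; ring.
Qed.

Lemma pderiv_partial_fourier B i (j : 'I_(d + d)) : family B ->
  pderiv j (partial_fourier (B i)) = partial_fourier (fun z => phase_coef j z * B i z + pderiv (lshift d j) (B i) z).
Proof.
move=> fB; rewrite /partial_fourier (pderiv_param_integral j (family_dominable i fB)); congr param_integral.
rewrite (pderiv_mul _ smooth_phase (fB.1 i)) pderiv_phase.
by apply/funext => z; ring.
Qed.

Lemma smooth_partial_fourier B i : family B -> smooth (partial_fourier (B i)).
Proof. by move=> fB; exact: param_integral_smooth (family_dominable i fB). Qed.

Lemma family_partial_fourier_jet k B : family B -> forall N, exists K, 0 <= K /\ forall i x xi,
  jet k (partial_fourier (B i)) (row_mx x xi) <= K * v i x * japanese xi ^- N.
Proof.
elim: k B => [|k IH] B fB N; first exact: family_partial_fourier_bound.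
have [K [K0 HK]] := IH B fB N.
have /choice[Kj HKj] := fun j => IH _ (family_pderiv j fB) N.
exists (K + \sum_(j < d + d) Kj j); split.
  by rewrite addr_ge0// sumr_ge0// => j _; exact: (HKj j).1.
move=> i x xi; rewrite -mulrA mulrDl !mulrA /=; apply: lerD; first exact: HK.
rewrite -mulrA mulr_suml; apply: ler_sum => j _; rewrite (pderiv_partial_fourier i j fB) mulrA.
exact: (HKj j).2.
Qed.

End family.
End partial_fourier_transform.

(** * Oscillatory integrals *)

Section oscillatory.
Variables (R : realType) (d : nat).
Local Notation C := R[i].
Implicit Types (x xi y : 'rV[R]_d).

Lemma rapid_scale_L1 (chi : 'rV[R]_d -> C) (eps : R) M : rapid chi -> 0 < eps ->
  L1 (fun xi => cabs (chi (eps *: xi)) * japanese xi ^+ M).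
Proof.
move=> rc e0; have [K [K0 H]] := rapid_bound 0 (2 * d + M) rc.
have mc : cmeas (fun xi => chi (eps *: xi)).
  have := cmeas_affine eps 0 (smooth_meas rc.1); congr cmeas.
  by apply/funext => xi; rewrite addr0.
have mj : mfun_row (fun xi => japanese xi ^+ M).
  by apply: (mfun_comp (h := fun t => t ^+ M)); [exact: exprn_continuous|exact: mfun_jap].
pose D : R := 1 + `|eps^-1|.
have D0 : 0 <= D by rewrite addr_ge0.
apply: (L1_le (mfunM (mfun_cabs mc) mj) (L1Zl (K * D ^+ (2 * d + M)) (L1_jap R (leqnn (2 * d))))).
move=> xi; rewrite ger0_norm ?mulr_ge0 ?cabs_ge0 ?japX_ge0//.
have h : japanese (eps *: xi) ^- (2 * d + M) <= D ^+ (2 * d + M) * japanese xi ^- (2 * d + M).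
  rewrite ler_pdivlMr ?japX_gt0// mulrC ler_pdivrMr ?japX_gt0// -exprMn.
  apply: lerXn2r; rewrite ?nnegrE ?mulr_ge0 ?jap_ge0//.
  have := jap_scale eps^-1 (eps *: xi); rewrite scalerA mulVf ?scale1r//; exact: lt0r_neq0.
apply: le_trans (ler_wpM2r (japX_ge0 _ _) (le_trans (H _) (ler_wpM2l K0 h))) _.
by rewrite -(japV_cancel xi M (2 * d)); apply: le_of_eq; ring.
Qed.

Lemma rapid_cutoff (chi : 'rV[R]_d -> C) : rapid chi -> chi 0 = 1 ->
  exists L, 0 <= L /\ forall (eps : R) xi, 0 < eps ->
    cabs (chi (eps *: xi) - 1) <= L * eps * japanese xi.
Proof.
move=> rc c1; have [K [K0 H]] := rapid_bound 1 0 rc.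
exists (2 * (K * d.+1%:R)); split; first by rewrite !mulr_ge0.
move=> eps xi e0; rewrite -c1.
apply: le_trans (lipschitz (B := K) rc.1 _) _.
  move=> i z _; apply: le_trans (cabs_le_jet 0 _ _) _.
  apply: le_trans (jet_pderiv _ _ _ _) _.
  by apply: le_trans (H z) _; rewrite expr0 invr1 mulr1.
rewrite -!mulrA ler_wpM2l// ler_wpM2l//.
have -> : \sum_(i < d) `|(eps *: xi) ord0 i - (0 : 'rV[R]_d) ord0 i| = eps * \sum_(i < d) `|xi ord0 i|.
  by rewrite mulr_sumr; apply: eq_bigr => i _; rewrite !mxE subr0 normrM gtr0_norm.
rewrite [leRHS]mulrCA; apply: ler_wpM2l; first exact: ltW.
by apply: le_trans (sum_le_jap xi); rewrite lerDr.
Qed.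

Section evaluation.
Variables (F : 'rV[R]_d -> 'rV[R]_d -> C) (K K' : R) (M : nat).
Hypothesis mF : cmeas (fun w : 'rV[R]_(d + d) => F (lsubmx w) (rsubmx w)).
Hypothesis FK : forall y xi, cabs (F y xi) <= K * japanese y ^- (2 * d) * japanese xi ^+ M.
Let h xi := cintegral (fun y => F y xi).
Hypothesis mh : cmeas h.
Hypothesis hK : forall xi, cabs (h xi) <= K' * japanese xi ^- (2 * d + 1).

Let K0 : 0 <= K.
Proof.
have := FK 0 0; rewrite -mulrA => /(coef_ge0 _ (cabs_ge0 _)); apply.
by rewrite mulr_gt0 ?japV_gt0 ?japX_gt0.
Qed.

Let K'0 : 0 <= K'. Proof. exact: (coef_ge0 (japV_gt0 0 _) (cabs_ge0 _) (hK 0)). Qed.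

Let regularized (chi : 'rV[R]_d -> C) (eps : R) :=
  cintegral (fun w : 'rV[R]_(d + d) => chi (eps *: rsubmx w) * F (lsubmx w) (rsubmx w)).

(** With the cutoff the double integral converges absolutely, so the y-integration may be carried
    out first. *)
Let regularizedE chi eps : rapid chi -> 0 < eps ->
  regularized chi eps = cintegral (fun xi => chi (eps *: xi) * h xi).
Proof.
move=> rc e0.
have mc : cmeas (fun xi => chi (eps *: xi)).
  have := cmeas_affine eps 0 (smooth_meas rc.1); congr cmeas.
  by apply/funext => xi; rewrite addr0.
rewrite /regularized (@cfubini2 _ _ _ _ (fun y => K * japanese y ^- (2 * d))
   (fun xi => cabs (chi (eps *: xi)) * japanese xi ^+ M)).
- congr (cintegral _); apply/funext => xi; rewrite /h -cintegralZl.
    by congr (cintegral _); apply/funext => y; rewrite row_mxKl row_mxKr.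
  split.
    by have := cmeas_mxl xi mF; congr cmeas; apply/funext => y; rewrite row_mxKl row_mxKr.
  exists (fun y => (japanese xi ^+ M * K) * japanese y ^- (2 * d)).
    by apply: L1Zl; exact: L1_jap.
  by move=> y; apply: le_trans (FK y xi) _; apply: le_of_eq; ring.
- by apply: cmeasM mF; exact: (cmeas_rsub d mc).
- by apply: L1Zl; exact: L1_jap.
- exact: rapid_scale_L1.
- by move=> y; rewrite mulr_ge0 ?japV_ge0.
- by move=> xi; rewrite mulr_ge0 ?cabs_ge0 ?japX_ge0.
- move=> y xi; rewrite row_mxKl row_mxKr cabsM.
  apply: le_trans (ler_wpM2l (cabs_ge0 _) (FK y xi)) _; apply: le_of_eq; ring.
Qed.

(** The cutoff differs from 1 by O(eps <xi>), and [h] has one power of decay beyond integrability,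
    so the error is O(eps). *)
Let regularized_cvg chi : schwartz chi -> chi 0 = 1 ->
  cabs (regularized chi eps - cintegral h) @[eps --> (0 : R)^'+] --> (0 : R).
Proof.
move=> /rapidP rc c1; have [L [L0 HL]] := rapid_cutoff rc c1.
pose r := rint (fun xi : 'rV[R]_d => japanese xi ^- (2 * d)).
have r0 : 0 <= r by apply: rint_ge0 => xi; exact: japV_ge0.
have IL := L1_jap R (leqnn (2 * d)).
have Ih : cL1 h.
  apply: (cL1_le mh (L1Zl K' IL)) => xi; apply: le_trans (hK xi) _.
  by rewrite ler_wpM2l// japV_le// leq_addr.
have main eps : 0 < eps -> cabs (regularized chi eps - cintegral h) <= 2 * (L * K' * r) * eps.
  move=> e0; rewrite regularizedE//.
  have mc : cmeas (fun xi => chi (eps *: xi)).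
    have := cmeas_affine eps 0 (smooth_meas rc.1); congr cmeas.
    by apply/funext => xi; rewrite addr0.
  have [B [B0 HB]] := rapid_bound 0 0 rc.
  have Ich : cL1 (fun xi => chi (eps *: xi) * h xi).
    have [_ [g Ig gB]] := Ih; split; first exact: cmeasM.
    exists (fun xi => B * g xi); first exact: L1Zl.
    move=> xi; rewrite cabsM; apply: ler_pM; rewrite ?cabs_ge0//.
    by have := HB (eps *: xi); rewrite expr0 invr1 mulr1.
  have [_ <-] := cintegralB Ich Ih.
  rewrite [leRHS](_ : _ = 2 * rint (fun xi : 'rV[R]_d => (L * eps * K') * japanese xi ^- (2 * d))); last first.
    by rewrite rintZl// -/r; ring.
  apply: cintegral_norm_le; first exact: L1Zl.
  move=> xi; rewrite -[X in _ - X]mul1r -mulrBl cabsM.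
  apply: le_trans (ler_pM (cabs_ge0 _) (cabs_ge0 _) (HL eps xi e0) (hK xi)) _.
  have := japV_cancel xi 1 (2 * d); rewrite expr1 => <-.
  by apply: le_of_eq; ring.
pose A := 2 * (L * K' * r); have A0 : 0 <= A by rewrite !mulr_ge0.
have A1 : 0 < A + 1 by rewrite ltr_pwDr.
apply/(@cvgrPdist_lt R R^o) => e e0; near=> t.
have t0 : 0 < t by near: t; exact: nbhs_right_gt.
rewrite sub0r normrN ger0_norm ?cabs_ge0//; apply: le_lt_trans (main t t0) _; rewrite -/A.
apply: (@le_lt_trans _ _ ((A + 1) * t)).
  by rewrite mulrDl lerDl mul1r ltW.
rewrite -ltr_pdivlMl// mulrC; near: t; apply: nbhs_right_lt.
by rewrite divr_gt0.
Unshelve. all: by end_near.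
Qed.

(** [xget] returns some value with the limit property, once one exists. Testing that value and the
    integral of [h] with the same cutoff, a Gaussian, shows that they agree. *)
Lemma osc_integralE : osc_integral F = cintegral h.
Proof.
rewrite /osc_integral; set P := (X in xget _ X).
have Ph : P (cintegral h) by move=> chi sc c1; exact: regularized_cvg.
have Px : P (xget 0 P) by apply: xgetPex; exists (cintegral h).
have sg : schwartz (realC (@gauss R d)) by apply/rapidP; exact: rapid_gauss.
have g1 : realC (@gauss R d) 0 = 1.
  by rewrite /realC /gauss dot0l mul0r oppr0 expR0.
apply/eqP; rewrite -subr_eq0; apply/eqP/cabs_eq0/eqP; rewrite eq_le cabs_ge0 andbT.
apply/ler_addgt0Pl => e e0; rewrite addr0.
have e2 : 0 < e / 2 by rewrite divr_gt0.
have /(@cvgrPdist_lt R R^o) /(_ _ e2) n1 := Ph _ sg g1.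
have /(@cvgrPdist_lt R R^o) /(_ _ e2) n2 := Px _ sg g1.
have [t [h1 h2]] := filter_ex (filterI n1 n2).
move: h1 h2; rewrite !sub0r !normrN !ger0_norm ?cabs_ge0// => h1 h2.
set I := cintegral _ in h1 h2.
rewrite (_ : _ - _ = (I - cintegral h) - (I - xget 0 P)); last by ring.
apply: le_trans (cabsB _ _) _; rewrite [leRHS]splitr; apply: lerD; exact: ltW.
Qed.

End evaluation.
End oscillatory.

(** * Weyl operators *)

Section weyl_estimates.
Variables (R : realType).
Local Notation C := R[i].
Local Notation e_ i := (delta_mx ord0 i).

(** All derivatives share the weight <z>^m, so a single Peetre exponent serves for jets of every
    order. *)
Definition symbol n (m : R) (b : 'rV[R]_n -> C) := smooth b /\
  forall k, exists K, 0 <= K /\ forall z, jet k b z <= K * japanese z `^ m.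

Lemma shubin_symbol n m (a : 'rV[R]_n -> C) : shubin m a -> symbol m a.
Proof.
move=> [sa H]; split => // k.
have p0 (z : 'rV[R]_n) : 0 < japanese z `^ m by rewrite powR_gt0// jap_gt0.
have [K HK] : exists K, forall z, jet k a z <= K * japanese z `^ m.
  apply: jet_bound => [z|s]; first exact: powR_ge0.
  have [K K0 HK] := H (index_of s); exists K => z; rewrite -mderiv_index//.
  apply: le_trans (HK z) _; apply: ler_wpM2l; first exact: ltW.
  by apply: ler_powR; [exact: jap_ge1|rewrite gerBl ler0n].
by exists K; split => //; apply: (bound_ge0 (g := fun z => japanese z `^ m)) HK.
Qed.

Lemma symbol_conj n m (a : 'rV[R]_n -> C) : symbol m a -> symbol m (fun z => conjc (a z)).
Proof.
move=> [sa H]; split; first exact: smooth_conj.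
by move=> k; have [K [K0 HK]] := H k; exists K; split => // z; rewrite jet_conj.
Qed.

Lemma jap_eq n p (x : 'rV[R]_n) (y : 'rV[R]_p) : dot x x = dot y y -> japanese x = japanese y.
Proof. by move=> e; rewrite /japanese !euclid_sqr e. Qed.

Variable d : nat.
Implicit Types (z w c : 'rV[R]_(d + d)) (x xi y t : 'rV[R]_d).

Definition blockc (a b c : R) (k : 'I_((d + d) + d)) : R :=
  match fintype.split k with
  | inl i => match fintype.split i with inl _ => a | inr _ => b end
  | inr _ => c end.

Definition lin_arg (a g : R) (q : 'rV[R]_((d + d) + d)) : 'rV[R]_d :=
  a *: lsubmx (lsubmx q) + g *: rsubmx q.

(** In the variables (x, xi, t): with a = 1/2 and c = 0 it is the Weyl midpoint ((x + t)/2, xi);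
    with a = 1 and c the [weyl_center] it is the argument of the symbol after the substitution in
    the matrix coefficients. *)
Definition weyl_arg (a : R) c (q : 'rV[R]_((d + d) + d)) : 'rV[R]_(d + d) :=
  row_mx (a *: lsubmx (lsubmx q) + 2^-1 *: rsubmx q) (rsubmx (lsubmx q)) + c.

Lemma lin_argE a g x xi t : lin_arg a g (row_mx (row_mx x xi) t) = a *: x + g *: t.
Proof. by rewrite /lin_arg !row_mxKl row_mxKr. Qed.

Lemma weyl_argE a c x xi t : weyl_arg a c (row_mx (row_mx x xi) t) =
  row_mx (a *: x + 2^-1 *: t) xi + c.
Proof. by rewrite /weyl_arg !row_mxKl !row_mxKr. Qed.

Lemma coordmap_lin a g : coordmap (lin_arg a g) (blockc a 0 g)
  (fun k => match fintype.split k with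
            | inl i => match fintype.split i with inl j => j | inr j => j end
            | inr j => j end).
Proof.
move=> q s k; rewrite /lin_arg /blockc; case: (split_ordP k) => i ->.
  case: (split_ordP i) => j ->; apply/rowP => l; rewrite !mxE !eqxx/=.
    rewrite !eq_lshift eq_rlshift/= !mulr0 addr0; ring.
  by rewrite eq_lshift eq_lrshift eq_rlshift/= !mulr0 !addr0 mul0r addr0.
apply/rowP => l; rewrite !mxE !eqxx/= eq_lrshift eq_rshift/=; ring.
Qed.

Lemma coordmap_weyl a c : coordmap (weyl_arg a c) (blockc a 1 2^-1)
  (fun k => match fintype.split k with
            | inl i => match fintype.split i with inl j => lshift d j | inr j => rshift d j end
            | inr j => lshift d j end).
Proof.
move=> q s k; rewrite /weyl_arg /blockc [RHS]addrAC; congr (_ + c); apply/rowP => l.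
case: (split_ordP k) => i ->.
  case: (split_ordP i) => j ->; case: (split_ordP l) => h ->;
    rewrite [RHS]mxE ?row_mxEl ?row_mxEr !mxE !eqxx/=.
  - rewrite !eq_lshift eq_rlshift/=; ring.
  - by rewrite eq_lshift eq_rlshift/= !mulr0.
  - by rewrite eq_lshift eq_lrshift eq_rlshift/=; ring.
  - by rewrite eq_lshift !eq_rshift mulr1.
case: (split_ordP l) => h ->; rewrite [RHS]mxE ?row_mxEl ?row_mxEr !mxE !eqxx/=.
  rewrite eq_lrshift eq_rshift eq_lshift/=; ring.
by rewrite eq_lrshift eq_rlshift/= !mulr0.
Qed.

Section with_symbol.
Variables (m : R) (Mm : nat) (b : 'rV[R]_(d + d) -> C).
Hypotheses (mM : `|m| <= Mm%:R) (sb : symbol m b).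

(** Peetre's inequality moves the weight to the center c, uniformly in c, and leaves [Mm] powers of
    the variables relative to it, whatever the order k. *)
Lemma weyl_arg_bound a k : exists K, 0 <= K /\ forall c x xi t,
  jet k (fun q => b (weyl_arg a c q)) (row_mx (row_mx x xi) t) <=
  K * japanese c `^ m * (japanese x ^+ Mm * japanese xi ^+ Mm * japanese t ^+ Mm).
Proof.
have [L [L0 HL]] := jet_comp_ex (d + d) (blockc a 1 2^-1) k.
have [K [K0 HK]] := sb.2 k.
pose D : R := 2 * ((1 + `|a|) * (1 + `|2^-1|)).
have D0 : 0 <= D by rewrite !mulr_ge0// addr_ge0.
exists (L * K * 2 ^+ Mm * D ^+ Mm); split; first by rewrite !mulr_ge0 ?exprn_ge0.
move=> c x xi t; apply: le_trans (HL _ _ _ _ (coordmap_weyl a c) sb.1) _.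
apply: le_trans (ler_wpM2l L0 (HK _)) _.
apply: le_trans (ler_wpM2l L0 (ler_wpM2l K0 (peetre c _ mM))) _.
rewrite weyl_argE jap_distC addrK.
have h : japanese (a *: x + 2^-1 *: t) <= D * (japanese x * japanese t).
  apply: le_trans (japD _ _) _; rewrite /D -mulrA ler_wpM2l// mulrACA.
  by apply: ler_pM; rewrite ?jap_ge0 ?jap_scale.
have h' : japanese (row_mx (a *: x + 2^-1 *: t) xi) ^+ Mm <=
    D ^+ Mm * (japanese x ^+ Mm * japanese t ^+ Mm) * japanese xi ^+ Mm.
  apply: le_trans (jap_row_mxX _ _ _) _; rewrite ler_wpM2r ?japX_ge0//.
  rewrite -!exprMn; apply: lerXn2r; rewrite ?nnegrE ?jap_ge0 ?mulr_ge0 ?jap_ge0//.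
apply: le_trans (ler_wpM2l L0 (ler_wpM2l K0 (ler_wpM2l _ (ler_wpM2l _ h')))) _.
- by rewrite exprn_ge0.
- exact: powR_ge0.
- by apply: le_of_eq; ring.
Qed.

Lemma smooth_weyl_arg a c : smooth (fun q => b (weyl_arg a c q)).
Proof. exact: smooth_comp (coordmap_weyl a c) sb.1. Qed.

Section action.
Variable g : 'rV[R]_d -> C.
Hypothesis rg : rapid g.

(** The amplitude b((x + y)/2, xi) g(y), indexed by [unit] so as to be a [family] with one
    member. *)
Let Bg (_ : unit) (q : 'rV[R]_((d + d) + d)) : C := b (weyl_arg 2^-1 0 q) * g (lin_arg 0 1 q).

Let v1 (_ : unit) x : R := japanese x ^+ Mm.

Let BgE x xi y : Bg tt (row_mx (row_mx x xi) y) = b (row_mx (2^-1 *: (x + y)) xi) * g y.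
Proof. by rewrite /Bg weyl_argE lin_argE addr0 scale0r add0r scale1r scalerDr. Qed.

Let family_Bg : family v1 Mm Bg.
Proof.
have s1 := smooth_weyl_arg 2^-1 0.
have s2 := smooth_comp (coordmap_lin 0 1) rg.1.
split; first by case; exact: smooth_mul s1 s2.
move=> k N; have [K [K0 HK]] := weyl_arg_bound 2^-1 k.
have [L [L0 HL]] := jet_comp_ex d (blockc 0 0 1) k.
have [K2 [K20 HK2]] := rapid_bound k (N + Mm) rg.
exists (K * (L * K2)); split; first by rewrite !mulr_ge0.
case=> x xi y; apply: le_trans (jet_mul _ _ s1 s2) _.
apply: le_trans (ler_pM (jet_ge0 _ _ _) (jet_ge0 _ _ _) (HK 0 x xi y)
  (le_trans (HL _ _ _ _ (coordmap_lin 0 1) rg.1) (ler_wpM2l L0 (HK2 _)))) _.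
rewrite lin_argE scale0r add0r scale1r jap0 powR1 mulr1 /v1 -(japV_cancel y Mm N).
by apply: le_of_eq; ring.
Qed.

Let v10 i x : 0 <= v1 i x. Proof. exact: japX_ge0. Qed.

Let v1poly i : exists K L, 0 <= K /\ forall x, v1 i x <= K * japanese x ^+ L.
Proof. by exists 1, Mm; split => // x; rewrite mul1r. Qed.

Let H := partial_fourier (Bg tt).

Let smooth_H : smooth H. Proof. exact: (smooth_partial_fourier v10 v1poly tt family_Bg). Qed.

(** What remains under the xi-integral after the y-integration: the Weyl operator applied to g is
    the integral of this over xi, by [weylE]. *)
Definition weyl_kernel (q : 'rV[R]_(d + d)) : C :=
  ((2 * pi) ^- d)%:C%C * (conjc (fourier_kernel q) * partial_fourier (fun q => b (weyl_arg 2^-1 0 q) * g (lin_arg 0 1 q)) q).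

Lemma smooth_weyl_kernel : smooth weyl_kernel.
Proof.
apply: smooth_mul; first exact: smooth_cst.
by apply: smooth_mul smooth_H; apply: smooth_conj; exact: (polyjet_fourier_kernel R d).1.
Qed.

Lemma weyl_kernel_bound N : exists K, 0 <= K /\ forall x xi,
  cabs (weyl_kernel (row_mx x xi)) <= K * japanese x ^+ Mm * japanese xi ^- N.
Proof.
have [K [K0 HK]] := family_partial_fourier_bound family_Bg N.
exists (cabs (((2 * pi) ^- d : R)%:C%C) * K); split; first by rewrite mulr_ge0 ?cabs_ge0.
move=> x xi; rewrite !cabsM cabs_conj ftkerE cabs_cis mul1r -!mulrA ler_wpM2l ?cabs_ge0//.
by rewrite mulrA; exact: (HK tt).
Qed.

Lemma weyl_kernel_dominable : dominable (fun=> 1) weyl_kernel.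
Proof.
split; [exact: cmeas_cst|exact: smooth_weyl_kernel|move=> k].
have [K1 [M1 [K10 H1]]] := polyjet_bound k
  (polyjet_mul (polyjet_cst _ (((2 * pi) ^- d : R)%:C%C)) (polyjet_conj (polyjet_fourier_kernel R d))).
have [K [K0 HK]] := family_partial_fourier_jet v10 v1poly k family_Bg (2 * d + M1).
exists (K1 * K), (M1 + Mm)%N => x xi; rewrite cabs1 mul1r.
have -> : weyl_kernel = (fun q => (((2 * pi) ^- d : R)%:C%C * conjc (fourier_kernel q)) * H q).
  by apply/funext => q; rewrite /weyl_kernel mulrA.
have s1 : smooth (fun q : 'rV[R]_(d + d) => ((2 * pi) ^- d : R)%:C%C * conjc (fourier_kernel q)).
  by apply: smooth_mul; [exact: smooth_cst|apply: smooth_conj; exact: (polyjet_fourier_kernel R d).1].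
apply: le_trans (jet_mul _ _ s1 smooth_H) _.
apply: le_trans (ler_pM (jet_ge0 _ _ _) (jet_ge0 _ _ _)
  (le_trans (H1 _) (ler_wpM2l K10 (jap_row_mxX x xi M1))) (HK tt x xi)) _.
rewrite /v1 -(japV_cancel xi M1 (2 * d)) [japanese x ^+ (M1 + _)]exprD.
by apply: le_of_eq; ring.
Qed.

Lemma weylE x : weyl b g x = param_integral (fun=> 1) weyl_kernel x.
Proof.
have dB := family_dominable v10 v1poly tt family_Bg.
have FE y xi : cis (dot (x - y) xi) * b (row_mx (2^-1 *: (x + y)) xi) * g y =
    cis (dot x xi) * (1 * (phase (row_mx (row_mx x xi) y) * Bg tt (row_mx (row_mx x xi) y))).
  by rewrite BgE mul1r phaseE row_mxKr dotBl cisD; ring.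
have hE xi : cintegral (fun y => cis (dot (x - y) xi) * b (row_mx (2^-1 *: (x + y)) xi) * g y) =
    cis (dot x xi) * H (row_mx x xi).
  under [X in cintegral X]eq_fun do rewrite FE.
  by rewrite cintegralZl//; exact: (param_integral_cL1 _ dB).
have mcis : cmeas (fun xi => cis (dot x xi)).
  apply: cmeas_cis; apply: mfun_dot => i; [exact: mfun_cst|exact: mfun_coord].
have mh : cmeas (fun xi => cis (dot x xi) * H (row_mx x xi)).
  by apply: cmeasM => //; apply: cmeas_mxr; exact: smooth_meas smooth_H.
have [K [K0 HK]] := family_Bg.2 0%N (2 * d)%N.
(* One power beyond integrability in xi, as [osc_integralE] asks. *)
have [K' [K'0 HK']] := family_partial_fourier_bound family_Bg (2 * d + 1).
rewrite /weyl (@osc_integralE _ _ _ (K * v1 tt x) (K' * v1 tt x) Mm).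
- under [X in cintegral X]eq_fun do rewrite hE.
  rewrite -cintegralZl.
    congr (cintegral _); apply/funext => xi.
    by rewrite mul1r /weyl_kernel ftkerE conj_cis opprK [dot xi x]dotC.
  apply: (cL1_le mh (L1Zl (K' * v1 tt x) (L1_jap R (leqnn (2 * d))))) => xi.
  rewrite cabsM cabs_cis mul1r; apply: le_trans (HK' tt x xi) _.
  by rewrite ler_wpM2l ?mulr_ge0 ?japV_le ?leq_addr.
(* The oscillatory integral runs over (y, xi), while the amplitude takes ((x, xi), y). *)
- have me : measurable_fun setT (fun w : 'rV[R]_(d + d) => row_mx (row_mx x (rsubmx w)) (lsubmx w)).
    apply: measurable_fun_row => i; case: (split_ordP i) => j ->.
      under eq_fun do rewrite row_mxEl; case: (split_ordP j) => l ->.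
        under eq_fun do rewrite row_mxEl; exact: measurable_cst.
      by under eq_fun do rewrite row_mxEr; exact: mfun_rcoord.
    by under eq_fun do rewrite row_mxEr; exact: mfun_lcoord.
  have m1 : cmeas (fun w : 'rV[R]_(d + d) => phase (row_mx (row_mx x (rsubmx w)) (lsubmx w)) *
      Bg tt (row_mx (row_mx x (rsubmx w)) (lsubmx w))).
    apply: (cmeas_comp me (f := fun q => phase q * Bg tt q)); apply: smooth_meas.
    exact: smooth_mul (@smooth_phase R d) (family_Bg.1 tt).
  have := cmeasM (cmeas_rsub d mcis) m1; congr cmeas; apply/funext => w.
  by rewrite FE mul1r.
- move=> y xi; rewrite FE cabsM cabs_cis mul1r mul1r cabsM phaseE cabs_cis mul1r.
  by apply: le_trans (HK tt x xi y) _; apply: le_of_eq; ring.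
- by under [X in cmeas X]eq_fun do rewrite hE.
- by move=> xi; rewrite hE cabsM cabs_cis mul1r; exact: (HK' tt).
Qed.

Lemma weyl_integrand_cL1 x xi : cL1 (fun y => cis (- dot y xi) *
  (b (weyl_arg 2^-1 0 (row_mx (row_mx x xi) y)) * g (lin_arg 0 1 (row_mx (row_mx x xi) y)))).
Proof.
have := param_integral_cL1 (row_mx x xi) (family_dominable v10 v1poly tt family_Bg).
by congr cL1; apply/funext => y; rewrite mul1r phaseE row_mxKr.
Qed.

Lemma weyl_ccont : ccont (weyl b g).
Proof.
rewrite (_ : weyl b g = param_integral (fun=> 1) weyl_kernel).
  exact: param_integral_ccont weyl_kernel_dominable.
by apply/funext => x; rewrite weylE.
Qed.

Lemma weyl_poly : exists K M, 0 <= K /\ forall x, cabs (weyl b g x) <= K * japanese x ^+ M.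
Proof.
have [K [K0 HK]] := weyl_kernel_bound (2 * d).
pose r := rint (fun y : 'rV[R]_d => japanese y ^- (2 * d)).
have r0 : 0 <= r by apply: rint_ge0 => y; exact: japV_ge0.
have IL := L1_jap R (leqnn (2 * d)).
exists (2 * (K * r)), Mm; split; first by rewrite !mulr_ge0.
move=> x; rewrite weylE [leRHS](_ : _ = 2 * rint (fun xi : 'rV[R]_d => (K * japanese x ^+ Mm) * japanese xi ^- (2 * d))); last first.
  by rewrite rintZl// -/r; ring.
apply: cintegral_norm_le; first exact: L1Zl.
by move=> xi; rewrite mul1r.
Qed.

End action.

Section matrix_coefficients.
Variable phi : 'rV[R]_d -> C.
Hypothesis rp : rapid phi.

(** The argument of the symbol at the origin of the shifted variables: the midpoint of the two
    positions, but the frequency of the first point alone, because xi is shifted by xi0. *)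
Definition weyl_center (i : 'rV[R]_(d + d) * 'rV[R]_(d + d)) : 'rV[R]_(d + d) :=
  row_mx (2^-1 *: (lsubmx i.1 + lsubmx i.2)) (rsubmx i.1).

(* Substituting x := x + x1, y := t + x + x0, xi := xi + xi0 in the integral of
   weyl b (time_freq phi (x0, xi0)) against time_freq phi (x1, xi1) makes all phases linear and
   leaves this amplitude in (x, xi, t). *)
Definition weyl_amplitude (i : 'rV[R]_(d + d) * 'rV[R]_(d + d)) (q : 'rV[R]_((d + d) + d)) : C :=
  b (weyl_arg 1 (weyl_center i) q) * (phi (lin_arg 1 1 q) * conjc (phi (lin_arg 1 0 q))).

(** The exponent that is integrable over the whole phase space. It is imposed on x and on xi
    separately, since the product of the two brackets dominates that of (x, xi). *)
Let n0 := (2 * (d + d))%N.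

Let v2 (i : 'rV[R]_(d + d) * 'rV[R]_(d + d)) x : R :=
  japanese (weyl_center i) `^ m * japanese x ^- n0.

Let v20 i x : 0 <= v2 i x. Proof. by rewrite mulr_ge0 ?powR_ge0 ?japV_ge0. Qed.

Let v2poly i : exists K L, 0 <= K /\ forall x, v2 i x <= K * japanese x ^+ L.
Proof.
exists (japanese (weyl_center i) `^ m), 0%N; split; first exact: powR_ge0.
by move=> x; rewrite /v2 ler_wpM2l ?powR_ge0// expr0 japV_le1.
Qed.

Lemma family_weyl_amplitude : family v2 Mm weyl_amplitude.
Proof.
have s1 i := smooth_weyl_arg 1 (weyl_center i).
have s2 := smooth_comp (coordmap_lin 1 1) rp.1.
have s3' := smooth_comp (coordmap_lin 1 0) rp.1.
have s3 := smooth_conj s3'; have s23 := smooth_mul s2 s3.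
split; first by move=> i; exact: smooth_mul (s1 i) s23.
move=> k N; have [K [K0 HK]] := weyl_arg_bound 1 k.
have [L1 [L10 HL1]] := jet_comp_ex d (blockc 1 0 1) k.
have [L2 [L20 HL2]] := jet_comp_ex d (blockc 1 0 0) k.
have [K1 [K10 HK1]] := rapid_bound k (N + Mm) rp.
(* Decay in x pays three times: [n0] is kept, [Mm] offsets the growth of the symbol in x, and
   [N + Mm] converts decay in x + t into decay in t. *)
have [K2 [K20 HK2]] := rapid_bound k (n0 + Mm + (N + Mm)) rp.
exists (K * (L1 * K1 * 2 ^+ (N + Mm) * (L2 * K2))); split.
  by rewrite !mulr_ge0 ?exprn_ge0.
move=> i x xi t; apply: le_trans (jet_mul _ _ (s1 i) s23) _.
have h1 : jet k (fun q => phi (lin_arg 1 1 q)) (row_mx (row_mx x xi) t) <=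
    L1 * (K1 * (2 ^+ (N + Mm) * (japanese t ^- (N + Mm) * japanese x ^+ (N + Mm)))).
  apply: le_trans (HL1 _ _ _ _ (coordmap_lin 1 1) rp.1) _; rewrite ler_wpM2l//.
  apply: le_trans (HK1 _) _; rewrite ler_wpM2l// lin_argE !scale1r addrC.
  exact: japDV.
have h2 : jet k (fun q => conjc (phi (lin_arg 1 0 q))) (row_mx (row_mx x xi) t) <=
    L2 * (K2 * japanese x ^- (n0 + Mm + (N + Mm))).
  rewrite (jet_conj _ _ s3'); apply: le_trans (HL2 _ _ _ _ (coordmap_lin 1 0) rp.1) _.
  rewrite ler_wpM2l//; apply: le_trans (HK2 _) _.
  by rewrite lin_argE scale1r scale0r addr0.
have h12 := le_trans (jet_mul k (row_mx (row_mx x xi) t) s2 s3)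
  (ler_pM (jet_ge0 _ _ _) (jet_ge0 _ _ _) h1 h2).
apply: le_trans (ler_pM (jet_ge0 _ _ _) (jet_ge0 _ _ _) (HK (weyl_center i) x xi t) h12) _.
rewrite /v2 -(japV_cancel x Mm n0) -(japV_cancel t Mm N).
rewrite -[in leRHS](japV_cancel x (N + Mm) (n0 + Mm)).
by apply: le_of_eq; ring.
Qed.

Section point.
Variables z w : 'rV[R]_(d + d).
Let x0 := lsubmx z.
Let xi0 := rsubmx z.
Let x1 := lsubmx w.
Let xi1 := rsubmx w.
Let g := time_freq phi z.
Let rg : rapid g. Proof. exact: rapid_time_freq. Qed.
Let k0 : C := ((2 * pi) ^- d : R)%:C%C.
Let Q (q : 'rV[R]_(d + d)) : C := weyl_kernel g q * conjc (time_freq phi w (lsubmx q)).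
Let H := partial_fourier (weyl_amplitude (z, w)).
Let eta : 'rV[R]_(d + d) := row_mx (xi1 - xi0) (x0 - x1).
Let kappa : C := k0 * cis (dot x1 (xi0 - xi1)).

Let smooth_H : smooth H.
Proof. exact: (smooth_partial_fourier v20 v2poly (z, w) family_weyl_amplitude). Qed.

Let meas_Q : cmeas Q.
Proof.
apply: cmeasM; first exact: smooth_meas (smooth_weyl_kernel rg).
apply: cmeas_conj; apply: (cmeas_lsub d (f := time_freq phi w)).
exact: smooth_meas (rapid_time_freq w rp).1.
Qed.

Let Q_bound : exists K, 0 <= K /\ forall x xi,
  cabs (Q (row_mx x xi)) <= (K * japanese x ^- (2 * d)) * japanese xi ^- (2 * d).
Proof.
have [K [K0 HK]] := weyl_kernel_bound rg (2 * d).
have [K' [K'0 HK']] := rapid_bound 0 (2 * d + Mm) (rapid_time_freq w rp).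
exists (K * K'); split; first exact: mulr_ge0.
move=> x xi; rewrite cabsM cabs_conj row_mxKl.
apply: le_trans (ler_pM (cabs_ge0 _) (cabs_ge0 _) (HK x xi) (HK' x)) _.
by rewrite -(japV_cancel x Mm (2 * d)); apply: le_of_eq; ring.
Qed.

Let A x xi t : C := cis (- dot t xi) *
  (b (row_mx (x + 2^-1 *: t) xi + weyl_center (z, w)) * phi (x + t)).

Let F x xi y : C := cis (- dot y (xi + xi0)) *
    (b (weyl_arg 2^-1 0 (row_mx (row_mx (x + x1) (xi + xi0)) y)) *
     g (lin_arg 0 1 (row_mx (row_mx (x + x1) (xi + xi0)) y))).

(** The translation y = t + (x + x0): the frequency xi0 of pi(z) phi cancels the shift of xi in the
    phase, and what is left besides - t . xi does not depend on t. *)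
Let AE x xi : A x xi = (fun t => cis (dot (x + x0) xi) * F x xi (t + (x + x0))).
Proof.
apply/funext => t; rewrite /A /F weyl_argE lin_argE addr0 scale0r add0r scale1r /g /time_freq.
have -> : row_mx (x + 2^-1 *: t) xi + weyl_center (z, w) =
   row_mx (2^-1 *: (x + x1) + 2^-1 *: (t + (x + x0))) (xi + xi0).
  rewrite /weyl_center add_row_mx -/x0 -/x1 -/xi0; congr row_mx.
  by apply/rowP => i; rewrite !mxE; field.
rewrite -/x0 -/xi0 (_ : t + (x + x0) - x0 = x + t); last by rewrite addrA addrK addrC.
rewrite (_ : - dot t xi = dot (x + x0) xi + (- dot (t + (x + x0)) (xi + xi0) + dot (t + (x + x0)) xi0)); last first.
  by rewrite !(dotDl, dotDr); ring.
by rewrite !cisD; ring.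
Qed.

Let F_cL1 x xi : cL1 (F x xi). Proof. exact: weyl_integrand_cL1. Qed.

Let A_cL1 x xi : cL1 (A x xi).
Proof. by rewrite AE; apply: cL1Zl; apply: cL1_shift; exact: F_cL1. Qed.

Let kernel_shift x xi : weyl_kernel g (row_mx (x + x1) (xi + xi0)) =
  k0 * (cis (dot (x + x1) (xi + xi0)) * (cis (- dot (x + x0) xi) * cintegral (A x xi))).
Proof.
rewrite /weyl_kernel -/k0 ftkerE conj_cis opprK [dot _ (x + x1)]dotC; congr (_ * (_ * _)).
rewrite HftE row_mxKr /fourier AE (cintegralZl _ (cL1_shift _ (F_cL1 x xi))).
by rewrite (cintegral_shift _ (F_cL1 x xi)) mulrA -cisD addNr cis0 mul1r.
Qed.

Let HE x xi : H (row_mx x xi) = conjc (phi x) * cintegral (A x xi).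
Proof.
rewrite -(cintegralZl _ (A_cL1 x xi)) /H HftE row_mxKr /fourier; congr (cintegral _).
apply/funext => t; rewrite /weyl_amplitude weyl_argE !lin_argE !scale1r scale0r addr0 /A.
by ring.
Qed.

(** The quadratic phases x . xi cancel; only the constant phase in [kappa] and a linear phase with
    frequency [eta] survive. *)
Let Q_shift x xi : Q (row_mx (x + x1) (xi + xi0)) =
  kappa * (cis (- dot (row_mx x xi) eta) * H (row_mx x xi)).
Proof.
rewrite /Q kernel_shift HE row_mxKl /time_freq -/x1 -/xi1 addrK conjcM conj_cis.
rewrite dot_row_mx /kappa.
transitivity (k0 * (cis (dot (x + x1) (xi + xi0)) * cis (- dot (x + x0) xi) * cis (- dot (x + x1) xi1)) *
  (conjc (phi x) * cintegral (A x xi))); first by ring.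
transitivity (k0 * (cis (dot x1 (xi0 - xi1)) * cis (- (dot x (xi1 - xi0) + dot xi (x0 - x1)))) *
  (conjc (phi x) * cintegral (A x xi))); last by ring.
congr (_ * _ * _); rewrite -!cisD; congr cis.
rewrite !(dotDl, dotDr, dotNr) [dot xi x0]dotC [dot xi x1]dotC; ring.
Qed.

Let H_bound N : exists K, 0 <= K /\ forall x xi,
  cabs (H (row_mx x xi)) <= K * v2 (z, w) x * japanese xi ^- N.
Proof.
have [K [K0 HK]] := family_partial_fourier_bound family_weyl_amplitude N.
by exists K; split => // x xi; exact: HK.
Qed.

Let sdecay_H : sdecay H.
Proof.
split; first exact: smooth_H.
move=> k; have [K [K0 HK]] := family_partial_fourier_jet v20 v2poly k family_weyl_amplitude n0.
exists (K * japanese (weyl_center (z, w)) `^ m) => q.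
rewrite -[q]hsubmxK; apply: le_trans (HK (z, w) _ _) _.
by rewrite /v2 -!mulrA ler_wpM2l// ler_wpM2l ?powR_ge0//; exact: jap_row_mxV.
Qed.

Lemma fun_stft_weyl : fun_stft phi (weyl b g) w = kappa * fourier H eta.
Proof.
have [K [K0 HQ]] := Q_bound.
have IL := L1_jap R (leqnn (2 * d)).
have IL1 : L1 (fun x : 'rV[R]_d => K * japanese x ^- (2 * d)) by exact: L1Zl.
have p1 (x : 'rV[R]_d) : 0 <= K * japanese x ^- (2 * d) by rewrite mulr_ge0 ?japV_ge0.
have p2 (x : 'rV[R]_d) : 0 <= japanese x ^- (2 * d) by exact: japV_ge0.
transitivity (cintegral (fun x => cintegral (fun xi => Q (row_mx x xi)))).
  rewrite /fun_stft; congr (cintegral _); apply/funext => x.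
  rewrite weylE// /param_integral [LHS]mulrC -cintegralZl; last exact: (param_integral_cL1 x (weyl_kernel_dominable rg)).
  congr (cintegral _); apply/funext => xi; rewrite /Q row_mxKl; ring.
(* As an iterated integral with xi outside, it allows xi to be translated by xi0 and then x by x1;
   afterwards Fubini reassembles the integral over phase space. *)
rewrite -(cfubini1 meas_Q IL1 IL p1 p2 HQ) (cfubini2 meas_Q IL1 IL p1 p2 HQ).
have IQ xi : cL1 (fun x => Q (row_mx x xi)).
  split; first exact: cmeas_mxl.
  exists (fun x => japanese xi ^- (2 * d) * (K * japanese x ^- (2 * d))); first exact: L1Zl.
  by move=> x; rewrite mulrC; exact: HQ.
have IQ2 : cL1 (fun xi => cintegral (fun x => Q (row_mx x xi))).
  split; first exact: (cmeas_fubini2 meas_Q IL1 IL p1 p2 HQ).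
  exists (fun xi => (2 * rint (fun x : 'rV[R]_d => K * japanese x ^- (2 * d))) * japanese xi ^- (2 * d)).
    exact: L1Zl.
  move=> xi; rewrite [leRHS](_ : _ = 2 * rint (fun x : 'rV[R]_d => japanese xi ^- (2 * d) * (K * japanese x ^- (2 * d)))); last first.
    by rewrite [X in _ = 2 * X]rintZl//; ring.
  apply: cintegral_norm_le; first exact: L1Zl.
  by move=> x; rewrite mulrC; exact: HQ.
rewrite -(cintegral_shift xi0 IQ2).
under [X in cintegral X]eq_fun => xi.
  rewrite -(cintegral_shift x1 (IQ _)).
  under [X in cintegral X]eq_fun do rewrite Q_shift.
  over.
have [K' [K'0 HK']] := H_bound (2 * d).
pose P (q : 'rV[R]_(d + d)) := kappa * (cis (- dot q eta) * H q).
have mc : cmeas (fun q : 'rV[R]_(d + d) => cis (- dot q eta) * H q).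
  apply: cmeasM; last exact: smooth_meas.
  exact: smooth_meas (smooth_cisdot eta).
have mP : cmeas P by apply: cmeasM => //; exact: cmeas_cst.
pose T := japanese (weyl_center (z, w)) `^ m.
have T0 : 0 <= T by exact: powR_ge0.
have HP x xi : cabs (P (row_mx x xi)) <=
    (cabs kappa * (K' * T) * japanese x ^- (2 * d)) * japanese xi ^- (2 * d).
  rewrite /P cabsM [X in _ * X]cabsM cabs_cis mul1r -!mulrA ler_wpM2l ?cabs_ge0//.
  apply: le_trans (HK' x xi) _; rewrite /v2 -!mulrA ler_wpM2l// ler_wpM2l//.
  by rewrite ler_wpM2r ?japV_ge0// japV_le// /n0 leq_mul2l leq_addr orbT.
have IL3 : L1 (fun x : 'rV[R]_d => cabs kappa * (K' * T) * japanese x ^- (2 * d)) by exact: L1Zl.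
have p3 (x : 'rV[R]_d) : 0 <= cabs kappa * (K' * T) * japanese x ^- (2 * d).
  by rewrite !mulr_ge0 ?cabs_ge0 ?japV_ge0.
rewrite -(cfubini2 mP IL3 IL p3 p2 HP) /P cintegralZl//.
exact: sdecay_cL1 (sdecay_cisdot eta sdecay_H).
Qed.

Lemma fun_stft_weyl_le k (K : R) : 0 <= K ->
  (forall x xi, jet k H (row_mx x xi) <= K * v2 (z, w) x * japanese xi ^- n0) ->
  cabs (fun_stft phi (weyl b g) w) <= cabs k0 * (2 * (K * japanese (weyl_center (z, w)) `^ m *
    rint (fun q : 'rV[R]_(d + d) => japanese q ^- n0)) * japanese (z - w) ^- k).
Proof.
move=> K0 HK; rewrite fun_stft_weyl !cabsM cabs_cis mulr1 ler_wpM2l ?cabs_ge0//.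
have IL := L1_jap R (leqnn n0).
have eE : japanese eta = japanese (z - w).
  apply: jap_eq; rewrite /eta -{1 2}[z]hsubmxK -{1 2}[w]hsubmxK opp_row_mx add_row_mx.
  rewrite !dot_row_mx -/x0 -/x1 -/xi0 -/xi1 addrC; congr (_ + _).
  by rewrite -(opprB xi0) dotNl dotNr opprK.
rewrite -eE -rintZl//; apply: fourier_decay sdecay_H _ _; first exact: L1Zl.
move=> q; rewrite -[q]hsubmxK; apply: le_trans (HK _ _) _.
rewrite /v2 -!mulrA ler_wpM2l// ler_wpM2l ?powR_ge0//; exact: jap_row_mxV.
Qed.

End point.

Lemma fun_stft_weyl_bound N : exists K, 0 <= K /\ forall z w,
  cabs (fun_stft phi (weyl b (time_freq phi z)) w) <= K * japanese z `^ m * japanese (z - w) ^- N.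
Proof.
(* The additional [Mm] derivatives pay for moving the weight from the center to z. *)
have [K [K0 HK]] := family_partial_fourier_jet v20 v2poly (N + Mm) family_weyl_amplitude n0.
set r := rint (fun q : 'rV[R]_(d + d) => japanese q ^- n0).
have r0 : 0 <= r by apply: rint_ge0 => q; exact: japV_ge0.
exists (cabs (((2 * pi) ^- d : R)%:C%C) * (2 * (K * 2 ^+ Mm * r))); split.
  by rewrite !mulr_ge0 ?cabs_ge0 ?exprn_ge0.
move=> z w; apply: le_trans (fun_stft_weyl_le K0 (HK (z, w))) _.
rewrite -/r; set kk := cabs _; have kk0 : 0 <= kk by exact: cabs_ge0.
set W := japanese (weyl_center _) `^ m; set t := japanese (z - w); set zm := japanese z `^ m.
rewrite [leLHS](_ : _ = (kk * 2 * K) * (W * (r * t ^- (N + Mm)))); last by ring.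
rewrite [leRHS](_ : _ = (kk * 2 * K) * (2 ^+ Mm * r * zm * t ^- N)); last by ring.
apply: ler_wpM2l; first by rewrite mulr_ge0// mulr_ge0.
have h : japanese (weyl_center (z, w)) `^ m <= 2 ^+ Mm * (japanese z `^ m * japanese (z - w) ^+ Mm).
  apply: le_trans (peetre z _ mM) _; rewrite ler_wpM2l ?exprn_ge0// ler_wpM2l ?powR_ge0//.
  rewrite lerXn2r ?nnegrE ?jap_ge0//; apply: jap_le.
  (* The center is half way to w in position and has the frequency of z, so it is no farther from z
     than w is. *)
  have -> : z - weyl_center (z, w) = row_mx (2^-1 *: (lsubmx z - lsubmx w)) 0.
    rewrite /weyl_center -{1}[z]hsubmxK opp_row_mx add_row_mx subrr; congr row_mx.
    by apply/rowP => i; rewrite !mxE; field.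
  have -> : z - w = row_mx (lsubmx z - lsubmx w) (rsubmx z - rsubmx w).
    by rewrite -{1}[z]hsubmxK -{1}[w]hsubmxK opp_row_mx add_row_mx.
  rewrite !dot_row_mx dot0l addr0.
  rewrite dotZl dotZr; have := dot_ge0 (lsubmx z - lsubmx w).
  by have := dot_ge0 (rsubmx z - rsubmx w); lra.
apply: le_trans (ler_wpM2r _ h) _; first by rewrite mulr_ge0 ?japV_ge0.
by rewrite -[in leRHS](japV_cancel (z - w) Mm N) -/t -/zm; apply: le_of_eq; ring.
Qed.

Lemma weyl_transfer u : tempered u -> (exists x, phi x <> 0) ->
  transfer m (fun z => cabs (u (fun x => conjc (weyl b (time_freq phi z) x))))
             (fun w => cabs (stft phi u w)).
Proof.
move=> hu phi0; apply: (representation_transfer rp phi0 hu (T := fun z => weyl b (time_freq phi z))).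
- by move=> z; exact: weyl_ccont (rapid_time_freq z rp).
- by move=> z; exact: weyl_poly (rapid_time_freq z rp).
- exact: fun_stft_weyl_bound.
Qed.
End matrix_coefficients.
End with_symbol.
End weyl_estimates.

(** * Cones *)

Section cones.
Variable R : realType.
Local Notation C := R[i].

Lemma tonelli_swap m n (f : 'rV[R]_(m + n) -> \bar R) :
  measurable_fun setT f -> (forall z, 0 <= f z)%E ->
  (\int[RL R m]_x \int[RL R n]_y f (row_mx x y) =
   \int[RL R n]_y \int[RL R m]_x f (row_mx x y))%E.
Proof.
move=> mf f0; apply: (@fubini_tonelli _ _ _ _ _ _ _ (fun p => f (row_mx p.1 p.2))) => //.
exact: (measurableT_comp mf (@measurable_row_mx R m n)).
Qed.

(* A point of a narrower cone is at distance at least a multiple of its norm from the complement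
   of the original cone. *)
Lemma cone_separation n (G0 : set 'rV[R]_n) z0 : open G0 -> conic G0 -> ~ G0 0 -> G0 z0 ->
  exists (G1 : set 'rV[R]_n) (c : R), [/\ open G1, conic G1, ~ G1 0, G1 z0 & 0 <= c /\
    forall z w : 'rV[R]_n, G1 z -> ~ G0 w -> japanese z <= c * japanese (z - w)].
Proof.
move=> oG cG G00 Gz0.
have /nbhs_ballP[e e0' H] : nbhs z0 G0 by exact: open_nbhs_nbhs.
have e0 : 0 < e by exact: e0'.
have He (y : 'rV[R]_n) : (forall i, `|y ord0 i - z0 ord0 i| < e) -> G0 y.
  move=> hy; apply: H; split => // u v; rewrite [u]ord1 /ball/= distrC; exact: hy.
(* The open cone over the cube of half-width e/2 about z0, half the size of a cube contained in the
   given cone. *)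
pose G1 : set 'rV[R]_n := [set z | exists2 t : R, 0 < t &
  forall i, `|z ord0 i - t * z0 ord0 i| < t * (e / 2)].
(* At scale t, a point w outside the cone differs from z by at least t e/2 in some coordinate, while
   |z_j| <= t (|z0_j| + e/2) = k_j (t e/2). *)
pose k i : R := (2 / e) * (`|z0 ord0 i| + e / 2).
have k0 i : 0 <= k i by apply: mulr_ge0; [|apply: addr_ge0 => //]; rewrite divr_ge0// ltW.
exists G1, (1 + \sum_(i < n) k i); split.
- rewrite openE => z [t t0 hz]; rewrite /interior.
  suff : \forall y \near (z : 'rV[R]_n), forall i : 'I_n,
      `|(y : 'rV[R]_n) ord0 i - t * z0 ord0 i| < t * (e / 2).
    by apply: filterS => y hy; exists t.
  have := @filter_forall _ 'I_n (fun i (y : 'rV[R]_n) => `|y ord0 i - t * z0 ord0 i| < t * (e / 2))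
    (nbhs (z : 'rV[R]_n)) _.
  apply => i.
  have ci : continuous (fun y : 'rV[R]_n => `|y ord0 i - t * z0 ord0 i|).
    apply: cont_compR; first exact: norm_continuous.
    by apply: contB; [exact: coord_continuous|exact: cont_cst].
  exact: (cvgr_lt _ (ci z)).
- move=> r z r0 [t t0 hz] /=; exists (r * t); first exact: mulr_gt0.
  move=> i; rewrite mxE -!mulrA -mulrBr normrM gtr0_norm// ltr_pM2l//.
- move=> [t t0 h0]; apply: G00; apply: He => i; rewrite mxE sub0r normrN.
  have := h0 i; rewrite mxE sub0r normrN normrM gtr0_norm// ltr_pM2l// => h.
  by apply: lt_trans h _; rewrite gtr_pMr// invf_lt1// ltr1n.
- by exists 1 => // i; rewrite !mul1r subrr normr0 divr_gt0.
- split; first by rewrite addr_ge0// sumr_ge0.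
  move=> z w [t t0 hz] Gw.
  have [i hi] : exists i, t * (e / 2) <= `|z ord0 i - w ord0 i|.
    apply: contrapT => /forallNP hN; apply: Gw.
    have -> : w = t *: (t^-1 *: w) by rewrite scalerA divff ?scale1r// gt_eqF.
    apply: cG => //; apply: He => j; rewrite mxE.
    have -> : t^-1 * w ord0 j - z0 ord0 j = t^-1 * (w ord0 j - t * z0 ord0 j).
      by rewrite mulrBr mulKf// gt_eqF.
    rewrite normrM gtr0_norm ?invr_gt0// ltr_pdivrMl//.
    have h1 := hz j; have /negP := hN j; rewrite -ltNge => h2.
    rewrite (_ : w ord0 j - _ = (z ord0 j - t * z0 ord0 j) - (z ord0 j - w ord0 j)); last by ring.
    apply: le_lt_trans (ler_normB _ _) _.
    by apply: lt_le_trans (ltrD h1 h2) _; lra.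
  have tw : t * (e / 2) <= japanese (z - w).
    by apply: le_trans hi _; have := coord_le_jap (z - w) i; rewrite !mxE.
  apply: le_trans (jap_le_sum _) _; rewrite mulrDl mul1r; apply: lerD; first exact: jap_ge1.
  rewrite mulr_suml; apply: ler_sum => j _.
  apply: le_trans (_ : k j * (t * (e / 2)) <= _); last by rewrite ler_wpM2l.
  have -> : k j * (t * (e / 2)) = t * (`|z0 ord0 j| + e / 2).
    by rewrite /k; field; rewrite gt_eqF.
  rewrite -[z ord0 j](subrK (t * z0 ord0 j)); apply: le_trans (ler_normD _ _) _.
  rewrite normrM gtr0_norm// mulrDr addrC lerD2l; exact: ltW.
Qed.

(** Since <w> <= 2 <z> <z - w> <= 2 c <z - w>^2, each power of <w> costs two of <z - w>, hence
    [2 * N2]. *)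
Lemma japV_cone n (z w : 'rV[R]_n) c N1 N2 : 0 <= c -> japanese z <= c * japanese (z - w) ->
  japanese (z - w) ^- (N1 + 2 * N2) <=
  c ^+ N1 * (2 * c) ^+ N2 * (japanese z ^- N1 * japanese w ^- N2).
Proof.
move=> c0 zc; set t := japanese (z - w).
have t0 : 0 < t by exact: jap_gt0.
have wc : japanese w <= (2 * c) * t ^+ 2.
  rewrite -{1}(subKr z w); apply: le_trans (japD _ _) _; rewrite japN -/t.
  by rewrite -mulrA ler_wpM2l// expr2 mulrA; apply: ler_wpM2r zc; exact: ltW.
have h1 : t ^- N1 <= c ^+ N1 * japanese z ^- N1.
  rewrite ler_pdivlMr ?japX_gt0// mulrC ler_pdivrMr ?exprn_gt0// -exprMn.
  by apply: lerXn2r zc; rewrite nnegrE ?jap_ge0// mulr_ge0 ?jap_ge0.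
have h2 : t ^- (2 * N2) <= (2 * c) ^+ N2 * japanese w ^- N2.
  rewrite ler_pdivlMr ?japX_gt0// mulrC ler_pdivrMr ?exprn_gt0// exprM -exprMn.
  apply: lerXn2r wc; rewrite nnegrE; first exact: jap_ge0.
  by apply: mulr_ge0; [exact: mulr_ge0|exact: sqr_ge0].
rewrite exprD invfM; apply: le_trans (ler_pM _ _ h1 h2) _; rewrite ?japV_ge0//.
by apply: le_of_eq; ring.
Qed.

(* The summand 1 avoids a separate treatment of [rint h = 0]. *)
Lemma weighted_cauchy_schwarz n (h G : 'rV[R]_n -> R) : (forall x, 0 <= h x) -> L1 h ->
  L1 (fun x => h x * G x) -> L1 (fun x => h x * G x ^+ 2) ->
  rint (fun x => h x * G x) ^+ 2 <= (rint h + 1) * rint (fun x => h x * G x ^+ 2).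
Proof.
move=> h0 Ih IG IG2; set A := rint h; set a := rint (fun x => h x * G x); set B := rint _.
have A0 : 0 <= A by exact: rint_ge0.
(* The expansion of h ((A + 1) G - a)^2. Its nonnegative integral gives (A + 2) a^2 <= (A + 1)^2 B,
   which is divided by A + 1 after A + 2 is lowered to A + 1. *)
have IS : L1 (fun x => (A + 1) ^+ 2 * (h x * G x ^+ 2) - (2 * (A + 1) * a * (h x * G x) - a ^+ 2 * h x)).
  by apply: L1D; [exact: L1Zl|apply: L1N; apply: L1D; [exact: L1Zl|apply: L1N; exact: L1Zl]].
have : 0 <= rint (fun x => (A + 1) ^+ 2 * (h x * G x ^+ 2) - (2 * (A + 1) * a * (h x * G x) - a ^+ 2 * h x)).
  apply: rint_ge0 => x; rewrite [leRHS](_ : _ = h x * ((A + 1) * G x - a) ^+ 2); last by ring.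
  by rewrite mulr_ge0 ?sqr_ge0.
rewrite rintB; [|exact: L1Zl|by apply: L1D; [exact: L1Zl|apply: L1N; exact: L1Zl]].
rewrite rintB; [|exact: L1Zl|exact: L1Zl].
rewrite !rintZl// -/A -/a -/B => H.
have A1 : 0 < A + 1 by rewrite ltr_pwDr.
have : (A + 1) * a ^+ 2 <= (A + 1) * ((A + 1) * B).
  by have := sqr_ge0 a; nra.
by rewrite ler_pM2l.
Qed.

Section transfer_cone.
Variables (n : nat) (m s : R) (F G : 'rV[R]_n -> R) (K : R) (M : nat).
Hypotheses (FG : transfer m F G) (F0 : forall z, 0 <= F z) (mG : mfun_row G).
Hypotheses (G0 : forall w, 0 <= G w) (GK : forall w, G w <= K * japanese w ^+ M).

Let K0 : 0 <= K.
Proof. by apply: (coef_ge0 (japX_gt0 0 M) (G0 0)); exact: GK. Qed.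

Let G2K w : `|G w ^+ 2| <= K ^+ 2 * japanese w ^+ (2 * M).
Proof.
rewrite ger0_norm ?sqr_ge0// mulnC exprM -exprMn.
by apply: lerXn2r => //; rewrite nnegrE ?mulr_ge0 ?japX_ge0.
Qed.

Let mG2 : mfun_row (fun w => G w ^+ 2).
Proof. exact: (mfunM mG mG). Qed.

(** Cauchy-Schwarz with weight <z - w>^-N makes the bound linear in G^2, and <z>^(2m) from the
    squared estimate completes <z>^(2(s - m)) to <z>^(2s). The threshold has 2 M because G^2 must be
    integrable against the weight. *)
Let transfer_sqr : exists N0, forall N, (N0 <= N)%N -> exists L, 0 <= L /\ forall z,
  japanese z `^ (2 * (s - m)) * F z ^+ 2 <=
  L * rint (fun w => japanese z `^ (2 * s) * (japanese (z - w) ^- N * G w ^+ 2)).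
Proof.
have [N0 HN0] := FG; exists (maxn N0 (2 * n + 2 * M)) => N; rewrite geq_max => /andP[N0N nN].
have [L [L0 HL]] := HN0 N N0N.
have nN' : (2 * n <= N)%N by apply: leq_trans nN; exact: leq_addr.
have nM : (2 * n + M <= N)%N by apply: leq_trans nN; rewrite leq_add2l leq_pmull.
pose A := rint (fun w : 'rV[R]_n => japanese w ^- N).
have A0 : 0 <= A by apply: rint_ge0 => w; exact: japV_ge0.
exists (L ^+ 2 * (A + 1)); split; first by rewrite mulr_ge0 ?exprn_ge0// addr_ge0.
move=> z.
have IA : L1 (fun w : 'rV[R]_n => japanese w ^- N) by exact: L1_jap.
have zE : (fun w => japanese (z - w) ^- N) = (fun w => japanese (w + (- z)) ^- N).
  by apply/funext => w; rewrite jap_distC.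
have Ih : L1 (fun w => japanese (z - w) ^- N).
  by rewrite zE; exact: (L1_shift (- z) IA).
have AE : rint (fun w => japanese (z - w) ^- N) = A.
  by rewrite zE (rint_shift (- z) IA).
have GK' w : `|G w| <= K * japanese w ^+ M by rewrite ger0_norm.
have I1 := L1_shift_weight z mG GK' nM.
have I2 := L1_shift_weight z mG2 G2K nN.
have CS := weighted_cauchy_schwarz (fun w => japV_ge0 (z - w) N) Ih I1 I2.
rewrite AE in CS; rewrite (rintZl _ I2).
set a := rint (fun w => japanese (z - w) ^- N * G w) in CS *.
set B := rint (fun w => japanese (z - w) ^- N * G w ^+ 2) in CS *.
have zm0 : 0 <= japanese z `^ m by exact: powR_ge0.
have a0 : 0 <= a by apply: rint_ge0 => w; rewrite mulr_ge0 ?japV_ge0.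
have F2 : F z ^+ 2 <= L ^+ 2 * (japanese z `^ m) ^+ 2 * ((A + 1) * B).
  apply: (@le_trans _ _ ((L * japanese z `^ m * a) ^+ 2)).
    by apply: lerXn2r; rewrite ?nnegrE ?mulr_ge0//; exact: HL.
  by rewrite !exprMn ler_wpM2l ?mulr_ge0 ?sqr_ge0.
have E : japanese z `^ (2 * (s - m)) * (japanese z `^ m) ^+ 2 = japanese z `^ (2 * s).
  have zn : japanese z != 0 by rewrite gt_eqF// jap_gt0.
  have -> : 2 * s = 2 * (s - m) + (m + m) by ring.
  by rewrite powRD ?zn ?implybT// [in RHS]powRD ?zn ?implybT// expr2.
apply: le_trans (ler_wpM2l (powR_ge0 _ _) F2) _; rewrite -E; apply: le_of_eq; ring.
Qed.

Variables (G0s : set 'rV[R]_n) (z0 : 'rV[R]_n).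
Hypotheses (oG : open G0s) (cG : conic G0s) (G00 : ~ G0s 0) (Gz0 : G0s z0).
Hypothesis finG :
  (\int[RL R n]_(z in G0s) (japanese z `^ (2 * s) * G z ^+ 2)%:E < +oo)%E.

Let gs w : R := \1_G0s w * (japanese w `^ (2 * s) * G w ^+ 2).

Let gs0 w : 0 <= gs w.
Proof. by rewrite mulr_ge0 ?mulr_ge0 ?powR_ge0 ?sqr_ge0// indicE. Qed.

Let L1_gs : L1 gs.
Proof.
apply: L1_of_lty => //.
  apply: mfunM; first exact: measurable_indic (open_measurable_row oG).
  apply: mfunM => //; have := @mfun_jap R n => mj.
  exact: (measurableT_comp (measurable_powR _) mj).
move: finG; rewrite integral_mkcond; congr (_ < _)%E; apply: eq_integral => w _.
by rewrite patchE /gs indicE; case: (w \in G0s); rewrite ?mul1r ?mul0r.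
Qed.

Lemma transfer_cone : exists G1 : set 'rV[R]_n,
  [/\ open G1, conic G1, ~ G1 0, G1 z0 &
   (\int[RL R n]_(z in G1) (japanese z `^ (2 * (s - m)) * F z ^+ 2)%:E < +oo)%E].
Proof.
have [G1 [c [oG1 cG1 G10 G1z0 [c0 Hc]]]] := cone_separation oG cG G00 Gz0.
exists G1; split => //.
have [N0 HN0] := transfer_sqr.
have [l hl] : exists l : nat, `|2 * s| <= l%:R.
  by exists (Num.bound `|2 * s|); apply: ltW; exact: archi_boundP.
(* Decay needed off the cone: in z, 2n powers for integrability and l against <z>^(2s); in w, 2n for
   integrability and 2 M against the growth of G^2. *)
pose N1 := (2 * n + l)%N; pose N2 := (2 * n + 2 * M)%N.
have [L [L0 HL]] := HN0 (N0 + (N1 + 2 * N2))%N (leq_addr _ _).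
set N := (N0 + _)%N in HL.
pose C2 : R := 2 ^+ l * (c ^+ N1 * (2 * c) ^+ N2) * K ^+ 2.
have C20 : 0 <= C2 by rewrite !mulr_ge0 ?exprn_ge0 ?mulr_ge0.
(* The first summand majorizes the integrand for w inside the given cone, the second for w outside;
   both are defined for all z and w, so that Tonelli applies. *)
pose H (z w : 'rV[R]_n) : R := 2 ^+ l * japanese (z - w) ^- (2 * n) * gs w +
   C2 * japanese z ^- (2 * n) * japanese w ^- (2 * n).
have Ha (z w : 'rV[R]_n) : 0 <= 2 ^+ l * japanese (z - w) ^- (2 * n) * gs w.
  apply: mulr_ge0; last exact: gs0.
  by apply: mulr_ge0; [exact: exprn_ge0|exact: japV_ge0].
have Hb (z w : 'rV[R]_n) : 0 <= C2 * japanese z ^- (2 * n) * japanese w ^- (2 * n).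
  apply: mulr_ge0; last exact: japV_ge0.
  by apply: mulr_ge0; [exact: C20|exact: japV_ge0].
have H0 z w : 0 <= H z w by apply: addr_ge0; [exact: Ha|exact: Hb].
have key z w : G1 z -> japanese z `^ (2 * s) * (japanese (z - w) ^- N * G w ^+ 2) <= H z w.
  move=> G1z; have [Gw|Gw] := pselect (G0s w).
    rewrite -[leLHS]addr0; apply: lerD; last exact: Hb.
    rewrite /gs indicE mem_set// mul1r [leLHS]mulrA [leRHS]mulrA.
    apply: ler_wpM2r; first exact: sqr_ge0.
    apply: le_trans (_ : japanese z `^ (2 * s) * japanese (w - z) ^- (2 * n + l) <= _).
      rewrite ler_wpM2l ?powR_ge0// jap_distC japV_le//.
      by rewrite /N /N1; apply: leq_trans (leq_addl _ _); exact: leq_addr.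
    apply: le_trans (peetre_shift w z (2 * n) hl) _.
    by rewrite jap_distC; apply: le_of_eq; ring.
  rewrite -[leLHS]add0r; apply: lerD; first exact: Ha.
  have h1 : japanese z `^ (2 * s) <= 2 ^+ l * japanese z ^+ l.
    have := peetre 0 z hl; rewrite jap0 powR1 mul1r sub0r japN; exact.
  have h2 : japanese (z - w) ^- N <= c ^+ N1 * (2 * c) ^+ N2 * (japanese z ^- N1 * japanese w ^- N2).
    apply: le_trans (japV_cone N1 N2 c0 (Hc z w G1z Gw)).
    by rewrite japV_le// /N leq_addl.
  have h3 := le_trans (ler_norm _) (G2K w).
  apply: le_trans (ler_pM _ _ h1 (ler_pM _ _ h2 h3)) _; rewrite ?powR_ge0 ?mulr_ge0 ?japV_ge0 ?sqr_ge0//.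
  rewrite /C2 /N1 /N2 -(japV_cancel z l (2 * n)) -(japV_cancel w (2 * M) (2 * n)).
  by apply: le_of_eq; ring.
pose f (q : 'rV[R]_(n + n)) : \bar R := (L * H (lsubmx q) (rsubmx q))%:E.
have f0 q : (0 <= f q)%E by rewrite lee_fin mulr_ge0.
have mf : measurable_fun setT f.
  apply: mfun_EFin; apply: mfunM; first exact: mfun_cst.
  have mL := @measurable_lsubmx R n n; have mR := @measurable_rsubmx R n n.
  have mjV (A : 'rV[R]_(n + n) -> 'rV[R]_n) : measurable_fun setT A ->
      mfun_row (fun q => japanese (A q) ^- (2 * n)).
    by move=> mA; exact: (measurableT_comp (@mfun_japV R n (2 * n)) mA).
  apply: mfunD.
    apply: mfunM; last exact: (measurableT_comp (L1_mfun L1_gs) mR).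
    apply: mfunM; first exact: mfun_cst.
    apply: (mjV (fun q => lsubmx q - rsubmx q)); apply: measurable_fun_row => i.
    rewrite (_ : (fun q => _) = (fun q : 'rV[R]_(n + n) => lsubmx q ord0 i - rsubmx q ord0 i)); last first.
      by apply/funext => q; rewrite !mxE.
    exact: (mfunD (@mfun_lcoord R n n i) (mfunN (@mfun_rcoord R n n i))).
  apply: mfunM; last exact: mjV.
  by apply: mfunM; [exact: mfun_cst|exact: mjV].
have IL := L1_jap R (leqnn (2 * n)).
have L1H z : L1 (fun w => L * H z w).
  apply: L1Zl; apply: L1D; last exact: L1Zl.
  rewrite (_ : (fun w => _) = (fun w => 2 ^+ l * (japanese (z - w) ^- (2 * n) * gs w))); last first.
    by apply/funext => w; rewrite mulrA.
  apply: L1Zl; apply: (L1_le _ L1_gs).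
    apply: mfunM; last exact: L1_mfun.
    have := mfun_row_affine 1 (- z) (@mfun_japV R n (2 * n)); congr mfun_row; apply/funext => w.
    by rewrite scale1r jap_distC.
  move=> w; rewrite ger0_norm; last by apply: mulr_ge0; [exact: japV_ge0|exact: gs0].
  by apply: ler_piMl; [exact: gs0|exact: japV_le1].
apply: (@le_lt_trans _ _ (\int[RL R n]_z \int[RL R n]_w f (row_mx z w))%E).
  rewrite integral_mkcond; apply: ge0_le_integral_nomeas => z _.
    by rewrite patchE; case: ifP => // _; rewrite lee_fin mulr_ge0 ?powR_ge0 ?sqr_ge0.
  rewrite patchE; case: ifPn => [/set_mem G1z|_]; last first.
    by apply: integral_ge0 => w _.
  apply: (@le_trans _ _ (rint (fun w => L * H z w))%:E); last first.
    rewrite (L1_ge0_intE (L1H z)) le_eqVlt; apply/orP; left; apply/eqP.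
    by apply: eq_integral => w _; rewrite /f row_mxKl row_mxKr.
  rewrite lee_fin; apply: le_trans (HL z) _; rewrite -rintZl.
    apply: rint_le; first exact: L1H.
      by move=> w; rewrite !mulr_ge0 ?powR_ge0 ?japV_ge0 ?sqr_ge0.
    by move=> w; rewrite ler_wpM2l// key.
  apply: L1Zl; apply: (L1_shift_weight z mG2 G2K).
  rewrite /N /N1 /N2; lia.
(* Integrated in z first, the two summands become multiples of [gs], integrable by the assumption on
   the cone, and of <w>^(-2n). *)
rewrite tonelli_swap//.
pose r := rint (fun w : 'rV[R]_n => japanese w ^- (2 * n)).
have inner w : (\int[RL R n]_z f (row_mx z w) =
   ((L * 2 ^+ l * r) * gs w + (L * C2 * r) * japanese w ^- (2 * n))%:E)%E.
  have I1 : L1 (fun z => japanese (z - w) ^- (2 * n)) by exact: (L1_shift (- w) IL).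
  have r1 : rint (fun z => japanese (z - w) ^- (2 * n)) = r by exact: (rint_shift (- w) IL).
  have fE z : f (row_mx z w) = ((L * 2 ^+ l * gs w) * japanese (z - w) ^- (2 * n) +
      (L * C2 * japanese w ^- (2 * n)) * japanese z ^- (2 * n))%:E.
    by rewrite /f row_mxKl row_mxKr /H; congr EFin; ring.
  under eq_integral do rewrite fE.
  rewrite -L1_ge0_intE; last by apply: L1D; exact: L1Zl.
  rewrite rintD; [|exact: L1Zl|exact: L1Zl].
  by rewrite !rintZl// r1 -/r; congr EFin; ring.
under eq_integral do rewrite inner.
rewrite -L1_ge0_intE; first exact: ltry.
by apply: L1D; exact: L1Zl.
Qed.

End transfer_cone.
End cones.

(** * Wave front sets *)

Section wave_front.
Variables (R : realType) (d : nat).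
Local Notation C := R[i].
Implicit Types (phi psi : 'rV[R]_d -> C) (u v : functional R d) (m s : R).

(** The condition that excludes z0 from the wave front set, stated for a function F: [weyl_op a u]
    and [localization a u] enter only through the moduli of their STFTs. *)
Definition regular_at (F : 'rV[R]_(d + d) -> R) s (z0 : 'rV[R]_(d + d)) :=
  exists G : set 'rV[R]_(d + d), [/\ open G, conic G, ~ G 0, G z0 &
    (\int[row_lebesgue R (d + d)]_(z in G) (japanese z `^ (2 * s) * F z ^+ 2)%:E < +oo)%E].

Lemma regular_transfer phi u m s (F : 'rV[R]_(d + d) -> R) z0 : tempered u -> rapid phi ->
  transfer m F (fun w => cabs (stft phi u w)) -> (forall z, 0 <= F z) ->
  regular_at (fun w => cabs (stft phi u w)) s z0 -> regular_at F (s - m) z0.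
Proof.
move=> hu rp FG F0 [G [oG cG G0 Gz0 fG]].
have [K [M [K0 H]]] := stft_poly hu rp.
apply: (transfer_cone FG F0 (stft_mfun hu rp) (fun w => cabs_ge0 _) _ oG cG G0 Gz0 fG).
by move=> w; apply: le_trans (H w); exact: ler_norm.
Qed.

Lemma WF_regular phi s v (z0 : 'rV[R]_(d + d)) : WF phi s v z0 <->
  z0 != 0 /\ ~ regular_at (fun z => cabs (stft phi v z)) s z0.
Proof. by []. Qed.

Lemma stft_weyl_op phi u a z : stft phi (weyl_op a u) z =
  u (fun x => conjc (weyl (fun q => conjc (a q)) (time_freq phi z) x)).
Proof.
rewrite /stft /pairing /weyl_op /of_pairing /pairing.
have -> // : (fun y => conjc (conjc (time_freq phi z y))) = time_freq phi z.
by apply/funext => y; rewrite conjcK.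
Qed.

End wave_front.

Unset Implicit Arguments.
Set Strict Implicit.
Set Printing Implicit Defensive.

Theorem proposition4p1 (R : realType) (d : nat) (hd : (0 < d)%N)
    (phi : 'rV[R]_d -> R[i]) (hphi : schwartz phi)
    (phi_neq0 : exists x, phi x <> 0)
    (u : functional R d) (hu : tempered u) (m s : R)
    (a : 'rV[R]_(d + d) -> R[i]) (ha : shubin m a) :
  WF phi (s - m) (weyl_op a u) `<=` WF phi s u /\
  WF phi (s - m) (localization a u) `<=` WF phi s u.
Proof.
have rp := (rapidP phi).1 hphi.
have sa := shubin_symbol ha.
split=> z0 /WF_regular[z00 nreg]; apply/WF_regular; split => // reg; apply: nreg.
- have [Mm mM] : exists Mm : nat, `|m| <= Mm%:R.
    by exists (Num.bound `|m|); apply: ltW; exact: archi_boundP.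
  apply: (regular_transfer hu rp _ _ reg) => [|z]; last exact: cabs_ge0.
  rewrite (_ : (fun z => cabs (stft phi (weyl_op a u) z)) = (fun z => cabs (u (fun x =>
    conjc (weyl (fun q => conjc (a q)) (time_freq phi z) x))))).
    exact: (weyl_transfer mM (symbol_conj sa) rp hu phi_neq0).
  by apply/funext => z; rewrite stft_weyl_op.
- have [Ka [_ aK]] := sa.2 0%N.
  have rg := rapid_gaussian R d.
  (* The operator A_a is built from the Gaussian window, so regularity of u is first moved from
     [phi] to the Gaussian, by a transfer of order 0. *)
  have reg' : regular_at (fun z => cabs (stft (@gaussian R d) u z)) s z0.
    rewrite -[s]subr0; apply: (regular_transfer hu rp _ _ reg) => [|z]; last exact: cabs_ge0.
    exact: window_transfer.
  apply: (regular_transfer hu rg _ _ reg') => [|z]; last exact: cabs_ge0.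
  exact: (localization_transfer hu rp aK).
Qed.
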